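(* Assume that both $\mathcal{L}=\sum_{|I|=\nu}c_IX_I$ and its formal transpose $\mathcal{L}^*$ are generalized Rockland operators on $\mathbb{R}^n$ (in the sense defined in the context). Let $\Lambda\in\mathcal{S}'(\mathbb{R}^n)$ be a tempered distribution satisfying $\mathcal{L}\Lambda=0$ in $\mathcal{S}'(\mathbb{R}^n)$. Then there exists a polynomial function $P=P(x)$ on $\mathbb{R}^n$ such that $\Lambda=P$ in $\mathcal{S}'(\mathbb{R}^n)$. In particular, any bounded solution of $\mathcal{L}\Lambda=0$ in $\mathcal{S}'(\mathbb{R}^n)$ is a constant.
   Context: **Assumption on the vector fields.** $X=\{X_1,\dots,X_m\}$ is a family of real smooth vector fields on $\mathbb{R}^n$, linearly independent in the (infinite-dimensional) real vector space of smooth vector fields on $\mathbb{R}^n$, satisfying Hörmander's condition at the origin (the vector fields in the Lie algebra $\mathrm{Lie}(X)$ generated by $X$, evaluated at $0$, span $\mathbb{R}^n$). $\mathbb{R}^n$ carries dilations $\delta_\lambda(x)=(\lambda^{\sigma_1}x_1,\dots,\lambda^{\sigma_n}x_n)$, $\lambda>0$, with integers $1=\sigma_1\le\sigma_2\le\dots\le\sigma_n$, and each $X_i$ is $\delta_\lambda$-homogeneous of positive integer degree $\nu_i$: $X_i(u\circ\delta_\lambda)=\lambda^{\nu_i}(X_iu)\circ\delta_\lambda$ for all $\lambda>0$, $u\in C^\infty(\mathbb{R}^n)$; moreover $1\le\nu_1\le\dots\le\nu_m$. Put $q=\sum_{i=1}^n\sigma_i$. It follows that $N:=\dim\mathrm{Lie}(X)$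 is finite and $N\ge n$; put $p=N-n$. **Operators.** For a multi-index $I=(i_1,\dots,i_k)$ with $i_j\in\{1,\dots,m\}$, put $X_I=X_{i_1}\cdots X_{i_k}$ and $|I|=\nu_{i_1}+\dots+\nu_{i_k}$. $\mathcal{L}=\sum_{|I|=\nu}c_IX_I$, with $\nu$ a positive integer and given real constants $c_I$. The formal transpose $\mathcal{L}^*$ is defined by $\int(\mathcal{L}u)v=\int u(\mathcal{L}^*v)$ for $u,v\in C_0^\infty$. One has $X_i^*=-X_i$, so $\mathcal{L}^*=\sum_{|I|=\nu}(-1)^kc_IX_{i_k}\cdots X_{i_1}$, which is of the same form. **Homogeneous group.** A homogeneous group $\mathbb{G}=(\mathbb{R}^N,\star,D_\lambda)$ is a Lie group structure on $\mathbb{R}^N$ (with neutral element $0$) together with diagonal dilations $D_\lambda$ (positive exponents) that are group automorphisms; $\mathrm{Lie}(\mathbb{G})$ is the Lie algebra of its left-invariant vector fields; its homogeneous dimension is the sum of the exponents of $D_\lambda$. **Lifting.** Assume $p\ge1$ and write points of $\mathbb{R}^N=\mathbb{R}^n\times\mathbb{R}^p$ as $(x,\xi)$. By a lifting theorem of Biagi and Bonfiglioli there exist a homogeneous group $\mathbb{G}=(\mathbb{R}^N,\star,D_\lambda)$, of homogeneous dimension $Q>q$, with $D_\lambda(x,\xi)=(\delta_\lambda(x),E_\lambda(\xi))$, $E_\lambda(\xi)=(\lambda^{\tau_1}\xi_1,\dots,\lambda^{\tau_p}\xi_p)$ for integers $1\le\tau_1\le\dots\le\tau_p$, and vector fields $\widetilde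 X_1,\dots,\widetilde X_m\in\mathrm{Lie}(\mathbb{G})$ generating $\mathrm{Lie}(\mathbb{G})$ as a Lie algebra, such that $\widetilde X_j$ is $D_\lambda$-homogeneous of degree $\nu_j$ and $\widetilde X_j=X_j+R_j$, where $R_j$ is a non-vanishing smooth vector field operating only in the $\xi$ variables (with coefficients possibly depending on $(x,\xi)$). This group and these vector fields are fixed. The lifted operator is $\widetilde{\mathcal{L}}=\sum_{|I|=\nu}c_I\widetilde X_I$, with $\widetilde X_I=\widetilde X_{i_1}\cdots\widetilde X_{i_k}$; the lifted operator of $\mathcal{L}^*$ is $(\widetilde{\mathcal{L}})^*$. **Generalized Rockland operator.** $\mathcal{L}=\sum_{|I|=\nu}c_IX_I$ is a generalized Rockland operator if $X_1,\dots,X_m$ satisfy the assumption above, $p\ge1$, and the lifted operator $\widetilde{\mathcal{L}}$ is hypoelliptic on $\mathbb{R}^N$ (for every open $\Omega'\subseteq\Omega\subseteq\mathbb{R}^N$ and $u\in\mathcal{D}'(\Omega)$, $\widetilde{\mathcal{L}}u\in C^\infty(\Omega')$ implies $u\in C^\infty(\Omega')$). *)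

(* Defs.v *)
From HB Require Import structures.
From mathcomp Require Import all_boot all_order all_algebra.
From mathcomp Require Import all_classical all_reals all_analysis.
From mathcomp Require mpoly.
Set Implicit Arguments.
Unset Strict Implicit.
Unset Printing Implicit Defensive.
Import Order.TTheory GRing.Theory Num.Theory.
Import numFieldNormedType.Exports.
Local Open Scope classical_set_scope.
Local Open Scope ring_scope.

(* MathComp-Analysis has the product sigma-algebra on n.-tuple T but no n-fold
   product measure; it is built here by iterating the binary product. *)

Section lebesgue_tuple_step.
Local Open Scope ereal_scope.
Context {R : realType} (n : nat).
Notation RR := (measurableTypeR R).
Variable mu : {sigma_finite_measure set (n.-tuple RR) -> \bar R}.

Let leb : {sigma_finite_measure set RR -> \bar R} := @lebesgue_measure R.

Definition consRR (z : RR * n.-tuple RR) : n.+1.-tuple RR :=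
  [tuple of z.1 :: z.2].

Lemma measurable_consRR : measurable_fun setT consRR.
Proof. exact: measurable_cons. Qed.

Definition lebesgue_cons : set (n.+1.-tuple RR) -> \bar R :=
  pushforward (leb \x mu) consRR.

Let lebesgue_cons0 : lebesgue_cons set0 = 0.
Proof. by rewrite /lebesgue_cons /pushforward preimage_set0 measure0. Qed.

Let lebesgue_cons_ge0 A : 0 <= lebesgue_cons A.
Proof. by rewrite /lebesgue_cons /pushforward measure_ge0. Qed.

Let lebesgue_cons_sigma_additive : semi_sigma_additive lebesgue_cons.
Proof.
move=> F mF tF mUF; rewrite /lebesgue_cons /pushforward preimage_bigcup.
apply: measure_semi_sigma_additive.
- by move=> k; rewrite -[X in measurable X]setTI; exact: measurable_consRR.
- apply/trivIsetP => /= i j _ _ ij; rewrite -preimage_setI.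
  by move/trivIsetP : tF => /(_ _ _ _ _ ij) ->//; rewrite preimage_set0.
- by rewrite -preimage_bigcup -[X in measurable X]setTI;
    exact: measurable_consRR.
Qed.

HB.instance Definition _ := isMeasure.Build _ _ _ lebesgue_cons
  lebesgue_cons0 lebesgue_cons_ge0 lebesgue_cons_sigma_additive.

Let unconsRR (t : n.+1.-tuple RR) : RR * n.-tuple RR :=
  (thead t, [tuple of behead t]).

Let unconsRRK : cancel consRR unconsRR.
Proof.
by case=> a t; rewrite /unconsRR /consRR /= theadE; congr (_, _); apply/val_inj.
Qed.

Let lebesgue_cons_sigma_finite : sigma_finite setT lebesgue_cons.
Proof.
have [F FT Foo] : sigma_finite setT (leb \x mu).
  have /sigma_finiteP[F [TF ndF Foo]] := sigma_finiteT leb.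
  have /sigma_finiteP[G [TG ndG Goo]] := sigma_finiteT mu.
  exists (fun k => F k `*` G k).
    rewrite -setXTT TF TG predeqE => -[x y]; split.
      move=> [/= [i _ Fix] [k _ Gky]]; exists (maxn i k) => //; split.
      - by move: x Fix; exact/subsetPset/ndF/leq_maxl.
      - by move: y Gky; exact/subsetPset/ndG/leq_maxr.
    by move=> [i _ []/= ? ?]; split; exists i.
  move=> k; have [? ?] := Foo k; have [? ?] := Goo k.
  split; first exact: measurableX.
  by rewrite product_measure1E// lte_mul_pinfty// ge0_fin_numE.
exists (fun k => unconsRR @^-1` F k).
  by rewrite -preimage_bigcup -FT preimage_setT.
move=> k; have [mF Fk] := Foo k; split.
  rewrite -[X in measurable X]setTI.
  suff muncons : measurable_fun setT unconsRR by exact: muncons.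
  apply: measurable_fun_pair => /=; last exact: measurable_behead.
  exact: measurable_tnth.
rewrite /lebesgue_cons /pushforward -comp_preimage.
rewrite (_ : unconsRR \o consRR = idfun) ?preimage_id//.
by apply/funext => z /=; rewrite unconsRRK.
Qed.

HB.instance Definition _ := Measure_isSigmaFinite.Build _ _ _ lebesgue_cons
  lebesgue_cons_sigma_finite.

End lebesgue_tuple_step.

Fixpoint lebesgue_tuple {R : realType} (n : nat) :
    {sigma_finite_measure set (n.-tuple (measurableTypeR R)) -> \bar R} :=
  match n with
  | 0%N => \d_([tuple] : 0.-tuple (measurableTypeR R))
  | n'.+1 => lebesgue_cons (lebesgue_tuple n')
  end.

Definition rv_of_tuple {R : realType} (n : nat)
  (t : n.-tuple (measurableTypeR R)) : 'rV[R]_n := \row_i (tnth t i : R).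

Definition integral_rV {R : realType} (n : nat) (f : 'rV[R]_n -> R) : R :=
  \int[lebesgue_tuple n]_(t in setT) f (rv_of_tuple t).

Definition measurable_rV {R : realType} (n : nat) (f : 'rV[R]_n -> R) : Prop :=
  measurable_fun setT (fun t : n.-tuple (measurableTypeR R) =>
    (f (rv_of_tuple t) : measurableTypeR R)).

Definition partial {R : realType} (n : nat) (i : 'I_n) (f : 'rV[R]_n -> R) :
    'rV[R]_n -> R :=
  fun x => 'D_(delta_mx 0 i) f x.

Definition partials {R : realType} (n : nat) (s : seq 'I_n)
    (f : 'rV[R]_n -> R) : 'rV[R]_n -> R :=
  foldr (@partial R n) f s.

(* Only meaningful for open Omega; f is total but only its germs at points of
   Omega matter. *)
Definition smooth_on {R : realType} (n : nat) (Omega : set 'rV[R]_n)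
    (f : 'rV[R]_n -> R) : Prop :=
  forall (s : seq 'I_n) x, Omega x ->
    {for x, continuous (partials s f)} /\
    forall i : 'I_n, derivable (partials s f) x (delta_mx 0 i).

Definition smooth {R : realType} (n : nat) (f : 'rV[R]_n -> R) : Prop :=
  smooth_on setT f.

Definition smooth_map {R : realType} (n k : nat) (F : 'rV[R]_n -> 'rV[R]_k) :
    Prop :=
  forall j : 'I_k, smooth (fun x => F x 0 j).

(* The vector field \sum_j V_j(x) d/dx_j, given by its coefficients. *)
Definition vfield (R : realType) (n : nat) := 'rV[R]_n -> 'rV[R]_n.

Definition vf_app {R : realType} (n : nat) (V : vfield R n)
    (u : 'rV[R]_n -> R) : 'rV[R]_n -> R :=
  fun x => \sum_(j < n) V x 0 j * partial j u x.

Definition vf_bracket {R : realType} (n : nat) (V W : vfield R n) :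
    vfield R n :=
  fun x => \row_j (vf_app V (fun y => W y 0 j) x -
                   vf_app W (fun y => V y 0 j) x).

Inductive lie_gen {R : realType} (n m : nat) (X : 'I_m -> vfield R n) :
    vfield R n -> Prop :=
| lie_gen_base i : lie_gen X (X i)
| lie_gen_zero : lie_gen X (fun=> 0)
| lie_gen_lin (a : R) V W :
    lie_gen X V -> lie_gen X W -> lie_gen X (fun x => a *: V x + W x)
| lie_gen_bracket V W :
    lie_gen X V -> lie_gen X W -> lie_gen X (vf_bracket V W).

Definition vf_free {R : realType} (n d : nat) (B : 'I_d -> vfield R n) : Prop :=
  forall a : 'I_d -> R,
    (forall x, \sum_(i < d) a i *: B i x = 0) -> forall i, a i = 0.

Definition vf_dim {R : realType} (n : nat) (S : vfield R n -> Prop) (d : nat) :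
    Prop :=
  exists B : 'I_d -> vfield R n,
    [/\ forall i, S (B i), vf_free B &
        forall V, S V -> exists a : 'I_d -> R,
          forall x, V x = \sum_(i < d) a i *: B i x].

Definition dilation {R : realType} (n : nat) (sigma : 'I_n -> nat) (lam : R)
    (x : 'rV[R]_n) : 'rV[R]_n :=
  \row_i (lam ^+ sigma i * x 0 i).

Definition vf_homogeneous {R : realType} (n : nat) (sigma : 'I_n -> nat)
    (d : nat) (V : vfield R n) : Prop :=
  forall lam : R, 0 < lam -> forall u, smooth u -> forall x,
    vf_app V (u \o dilation sigma lam) x =
    lam ^+ d * vf_app V u (dilation sigma lam x).

Record hormander_system {R : realType} (n m : nat) (sigma : 'I_n -> nat)
    (nu : 'I_m -> nat) (X : 'I_m -> vfield R n) : Prop := HormanderSystem {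
  hs_dim_gt0 : (0 < n)%N ;
  hs_smooth : forall i, smooth_map (X i) ;
  hs_free : vf_free X ;
  hs_hormander : forall v : 'rV[R]_n, exists2 V, lie_gen X V & V 0 = v ;
  hs_sigma1 : forall i : 'I_n, i = 0%N :> nat -> sigma i = 1%N ;
  hs_sigma_nd : forall i j : 'I_n, (i <= j)%N -> (sigma i <= sigma j)%N ;
  hs_homogeneous : forall i, vf_homogeneous sigma (nu i) (X i) ;
  hs_nu_gt0 : forall i, (0 < nu i)%N ;
  hs_nu_nd : forall i j : 'I_m, (i <= j)%N -> (nu i <= nu j)%N }.

Record homogeneous_group {R : realType} (N : nat) (rho : 'I_N -> nat)
    (op : 'rV[R]_N -> 'rV[R]_N -> 'rV[R]_N) : Prop := HomogeneousGroup {
  hg_smooth : smooth_map (fun z : 'rV[R]_(N + N) => op (lsubmx z) (rsubmx z)) ;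
  hg_assoc : associative op ;
  hg_unitl : left_id 0 op ;
  hg_unitr : right_id 0 op ;
  hg_inv : exists inv : 'rV[R]_N -> 'rV[R]_N,
    [/\ smooth_map inv, left_inverse 0 inv op & right_inverse 0 inv op] ;
  hg_rho_gt0 : forall i, (0 < rho i)%N ;
  hg_dilation : forall lam : R, 0 < lam -> forall x y,
    dilation rho lam (op x y) = op (dilation rho lam x) (dilation rho lam y) }.

Definition left_invariant {R : realType} (N : nat)
    (op : 'rV[R]_N -> 'rV[R]_N -> 'rV[R]_N) (V : vfield R N) : Prop :=
  smooth_map V /\
  forall a u, smooth u -> forall x, vf_app V (u \o op a) x = vf_app V u (op a x).

Definition lift_exponents (n p : nat) (sigma : 'I_n -> nat)
    (tau : 'I_p -> nat) : 'I_(n + p) -> nat :=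
  fun k => match fintype.split k with inl i => sigma i | inr j => tau j end.

(* A point (x, xi) of R^n x R^p is row_mx x xi : 'rV[R]_(n + p). *)
Record is_lifting {R : realType} (n m p : nat) (sigma : 'I_n -> nat)
    (nu : 'I_m -> nat) (X : 'I_m -> vfield R n) (tau : 'I_p -> nat)
    (op : 'rV[R]_(n + p) -> 'rV[R]_(n + p) -> 'rV[R]_(n + p))
    (Xt : 'I_m -> vfield R (n + p)) : Prop := IsLifting {
  lift_tau_gt0 : forall j, (0 < tau j)%N ;
  lift_tau_nd : forall i j : 'I_p, (i <= j)%N -> (tau i <= tau j)%N ;
  lift_group : homogeneous_group (lift_exponents sigma tau) op ;
  lift_homdim :
    (\sum_(i < n) sigma i < \sum_(k < n + p) lift_exponents sigma tau k)%N ;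
  lift_invariant : forall j, left_invariant op (Xt j) ;
  lift_generate : forall V, left_invariant op V -> lie_gen Xt V ;
  lift_homogeneous : forall j,
    vf_homogeneous (lift_exponents sigma tau) (nu j) (Xt j) ;
  lift_split : forall j, exists Rj : 'rV[R]_(n + p) -> 'rV[R]_p,
    [/\ smooth_map Rj, exists z, Rj z != 0 &
        forall z, Xt j z = row_mx (X j (lsubmx z)) (Rj z)] }.

(* A distribution is a map defined on all functions, of which only the values
   on the relevant test functions are constrained or used. *)

Definition test_fun {R : realType} (n : nat) (Omega : set 'rV[R]_n)
    (phi : 'rV[R]_n -> R) : Prop :=
  smooth phi /\ exists2 K : set 'rV[R]_n,
    compact K /\ K `<=` Omega & forall x, ~ K x -> phi x = 0.

Definition distribution {R : realType} (n : nat) (Omega : set 'rV[R]_n)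
    (u : ('rV[R]_n -> R) -> R) : Prop :=
  (forall (a : R) phi psi, test_fun Omega phi -> test_fun Omega psi ->
    u (fun x => a * phi x + psi x) = a * u phi + u psi) /\
  (forall K : set 'rV[R]_n, compact K -> K `<=` Omega ->
    exists (C : R) (k : nat), forall phi (M : R),
      smooth phi -> (forall x, ~ K x -> phi x = 0) ->
      (forall s : seq 'I_n, (size s <= k)%N ->
         forall x, `|partials s phi x| <= M) ->
      `|u phi| <= C * M).

Definition schwartz {R : realType} (n : nat) (phi : 'rV[R]_n -> R) : Prop :=
  smooth phi /\
  forall (k : nat) (s : seq 'I_n), exists M : R,
    forall x, (1 + `|x|) ^+ k * `|partials s phi x| <= M.

Definition tempered {R : realType} (n : nat) (Lambda : ('rV[R]_n -> R) -> R) :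
    Prop :=
  (forall (a : R) phi psi, schwartz phi -> schwartz psi ->
    Lambda (fun x => a * phi x + psi x) = a * Lambda phi + Lambda psi) /\
  exists (C : R) (k : nat), forall phi (M : R), schwartz phi ->
    (forall s : seq 'I_n, (size s <= k)%N ->
       forall x, (1 + `|x|) ^+ k * `|partials s phi x| <= M) ->
    `|Lambda phi| <= C * M.

(* The distribution phi |-> \int f phi. *)
Definition dist_of_fun {R : realType} (n : nat) (f : 'rV[R]_n -> R) :
    ('rV[R]_n -> R) -> R :=
  fun phi => integral_rV (fun x => f x * phi x).

Definition dist_eq {R : realType} (n : nat) (D : set ('rV[R]_n -> R))
    (u v : ('rV[R]_n -> R) -> R) : Prop :=
  forall phi, D phi -> u phi = v phi.

Definition is_smooth_dist {R : realType} (n : nat) (Omega : set 'rV[R]_n)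
    (u : ('rV[R]_n -> R) -> R) : Prop :=
  exists2 f, smooth_on Omega f & dist_eq (test_fun Omega) u (dist_of_fun f).

Definition is_bounded_dist {R : realType} (n : nat)
    (u : ('rV[R]_n -> R) -> R) : Prop :=
  exists f : 'rV[R]_n -> R,
    [/\ measurable_rV f, exists M : R, forall x, `|f x| <= M &
        dist_eq (@schwartz R n) u (dist_of_fun f)].

(* <V u, phi> = <u, V^* phi> with V^* phi = - \sum_j d/dx_j (V_j phi). *)
Definition vf_dist {R : realType} (n : nat) (V : vfield R n)
    (u : ('rV[R]_n -> R) -> R) : ('rV[R]_n -> R) -> R :=
  fun phi => u (fun x => - \sum_(j < n) partial j (fun y => V y 0 j * phi y) x).

Definition weight (m : nat) (nu : 'I_m -> nat) (I : seq 'I_m) : nat :=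
  (\sum_(i <- I) nu i)%N.

(* X_I u = X_{i_1} (... (X_{i_k} u)) for I = (i_1, ..., i_k). *)
Definition word_dist {R : realType} (n m : nat) (X : 'I_m -> vfield R n)
    (I : seq 'I_m) (u : ('rV[R]_n -> R) -> R) : ('rV[R]_n -> R) -> R :=
  foldr (fun i => vf_dist (X i)) u I.

(* Since all nu i are positive, |I| = d forces the length of I to be at most d,
   so the sum runs over all multi-indices of weight d. *)
Definition op_dist {R : realType} (n m : nat) (nu : 'I_m -> nat) (d : nat)
    (c : seq 'I_m -> R) (X : 'I_m -> vfield R n)
    (u : ('rV[R]_n -> R) -> R) : ('rV[R]_n -> R) -> R :=
  fun phi => \sum_(k < d.+1) \sum_(I : k.-tuple 'I_m | weight nu I == d)
    c I * word_dist X I u phi.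

(* Each X_i is homogeneous of positive degree, hence divergence free, so
   X_i^* = - X_i and the formal transpose of \sum_I c_I X_I is
   \sum_I (-1)^k c_I X_{i_k} ... X_{i_1}, re-indexed here by the reversed I. *)
Definition transpose_coef {R : realType} (m : nat) (c : seq 'I_m -> R) :
    seq 'I_m -> R :=
  fun I => (-1) ^+ size I * c (rev I).

Definition hypoelliptic {R : realType} (n : nat)
    (A : (('rV[R]_n -> R) -> R) -> (('rV[R]_n -> R) -> R)) : Prop :=
  forall Omega Omega' : set 'rV[R]_n, open Omega -> open Omega' ->
    Omega' `<=` Omega ->
  forall u, distribution Omega u ->
    is_smooth_dist Omega' (A u) -> is_smooth_dist Omega' u.

Record generalized_rockland {R : realType} (n m p : nat)
    (sigma : 'I_n -> nat) (nu : 'I_m -> nat) (X : 'I_m -> vfield R n)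
    (tau : 'I_p -> nat)
    (op : 'rV[R]_(n + p) -> 'rV[R]_(n + p) -> 'rV[R]_(n + p))
    (Xt : 'I_m -> vfield R (n + p)) (d : nat) (c : seq 'I_m -> R) : Prop :=
  GeneralizedRockland {
  gr_degree_gt0 : (0 < d)%N ;
  gr_system : hormander_system sigma nu X ;
  gr_dim : vf_dim (lie_gen X) (n + p) ;
  gr_p_gt0 : (0 < p)%N ;
  gr_lifting : is_lifting sigma nu X tau op Xt ;
  gr_hypoelliptic : hypoelliptic (op_dist nu d c Xt) }.

Definition mpoly_fun {R : realType} (n : nat) (P : mpoly.mpoly n R) :
    'rV[R]_n -> R :=
  fun x => mpoly.meval (fun i => x 0 i) P.

(* Main.v *)
(** A tempered solution [u] of [L u = 0] is turned into a solution on the lifted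
    space by [u~ phi = u (\int phi(., xi) dxi)]: the part of the lifted fields
    acting in [xi] integrates to zero.  By homogeneity every rescaling
    [u_lam phi = u (phi o delta_(1/lam))] is again a solution, and temperedness
    gives [|u_lam phi| <= C lam^E |phi|_k] for [lam >= 1], with a fixed exponent
    [E].  Suppose [u (d^s psi) != 0] for a derivative [d^s] of weight [> E].
    Tested against [theta_j = d^s (psi o delta_(4^j))], the functionals
    [4^(-lE) u_(4^l)] have unbounded values, while each of them is bounded by a
    fixed seminorm; a gliding hump therefore produces an absolutely convergent
    series [v = \sum_i a_i 4^(-l_i E) u_(4^l_i)] with [v (theta_j)] unbounded.
    But the lift of [v] solves the lifted equation, so it is a smooth function
    [f] by hypoellipticity, and integrating by parts bounds [v (theta_j)] by the
    supremum of a derivative of [f] on a fixed box.  Hence all derivatives of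
    [u] of large weight vanish; since the lift of [u] is itself smooth, [u] is a
    polynomial. *)

Require Import Defs.
From mathcomp Require Import all_boot all_order all_algebra.
From mathcomp Require Import all_classical all_reals all_analysis.
From mathcomp Require Import measurable_realfun.
From mathcomp Require mpoly.
From mathcomp Require Import ring lra.
Set Implicit Arguments.
Unset Strict Implicit.
Unset Printing Implicit Defensive.
Import Order.TTheory GRing.Theory Num.Theory.
Import numFieldNormedType.Exports.
Local Open Scope classical_set_scope.
Local Open Scope ring_scope.

(** * Smooth functions *)

(** The hypothesis is qualitative: it asserts smoothness of lifted solutions without any estimate.
    An estimate would usually be drawn from it by a closed graph or Banach-Steinhaus argument; the
    gliding hump instead constructs the single solution on which the missing estimate would fail.
    The numbers are matched to this end: a derivative of weight above [E] gains at least one factor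
    [lam], so the diagonal values grow like 4^j, while the coefficients 3^-i give convergence in a
    fixed seminorm and still leave growth (4/3)^j. The contradicting bound does not depend on [j]
    because dilations by [lam >= 1] shrink supports. All this is done on compactly supported
    functions, whose fiber integrals are again of this kind. Schwartz functions enter only at the
    end, through a cutoff, when the solution is known to be a polynomial on test functions and so to
    have moderate growth. *)

Section Ck.
Context {R : realType} {n : nat}.
Implicit Types f g : 'rV[R]_n -> R.

(** Continuity is a separate clause: in several variables it does not follow from the existence of
    the partial derivatives. *)
Definition c0 f := continuous f /\ forall i x, derivable f x (delta_mx 0 i).

(* [smooth] quantifies over words of derivatives; this recursive form lets closure
   properties be proved by induction on the order. *)
Fixpoint ck k f : Prop :=
  if k is k'.+1 then c0 f /\ forall i, ck k' (partial i f) else c0 f.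

Lemma ckS k f : ck k.+1 f -> ck k f.
Proof.
elim: k f => [|k IH] f; first by case.
by move=> [c0f H]; split => // i; exact: IH (H i).
Qed.

(** The last letter of a word acts first. Peeling it off turns a claim about [f] into one about
    shorter words on [partial i f]; the order of derivatives is kept, and their symmetry is never
    invoked. *)
Lemma partials_rcons (s : seq 'I_n) i f :
  partials (rcons s i) f = partials s (partial i f).
Proof. by rewrite /partials foldr_rcons. Qed.

Lemma smooth_ck f : smooth f <-> forall k, ck k f.
Proof.
split=> [sf k|H].
  elim: k f sf => [|k IH] f sf.
    by split=> [x|i x]; have [] := sf [::] x I.
  split; first by split=> [x|i x]; have [] := sf [::] x I.
  by move=> i; apply: IH => s x _; rewrite -partials_rcons; exact: sf.
suff Q (s : seq 'I_n) : c0 (partials s f).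
  by move=> s x _; have [cf df] := Q s; split => [|i]; [exact: cf|exact: df].
elim/last_ind: s f H => [|s i IH] f H; first exact: (H 0%N).
by rewrite partials_rcons; apply: IH => k; have [_ pf] := H k.+1; exact: pf.
Qed.

Lemma smooth_cont f : smooth f -> continuous f.
Proof. by move=> /smooth_ck /(_ 0%N) []. Qed.

Lemma smooth_derivable f i x : smooth f -> derivable f x (delta_mx 0 i).
Proof. by move=> /smooth_ck /(_ 0%N) []. Qed.

Lemma smooth_partial f i : smooth f -> smooth (partial i f).
Proof.
by move=> /smooth_ck H; apply/smooth_ck => k; have [_ pf] := H k.+1; exact: pf.
Qed.

Lemma smooth_partials f s : smooth f -> smooth (partials s f).
Proof. by move=> sf; elim: s => //= i s; exact: smooth_partial. Qed.

Lemma partialD f g i : c0 f -> c0 g ->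
  partial i (fun x => f x + g x) = fun x => partial i f x + partial i g x.
Proof. by move=> [_ df] [_ dg]; apply/funext => x; exact: deriveD. Qed.

Lemma partialZ f (a : R) i : c0 f ->
  partial i (fun x => a * f x) = fun x => a * partial i f x.
Proof. by move=> [_ df]; apply/funext => x; exact: deriveZ. Qed.

Lemma partialM f g i : c0 f -> c0 g ->
  partial i (fun x => f x * g x) =
  fun x => f x * partial i g x + partial i f x * g x.
Proof.
move=> [_ df] [_ dg]; apply/funext => x.
rewrite /partial (@deriveM _ _ f g)//; congr (_ + _).
by rewrite /GRing.scale/= mulrC.
Qed.

Lemma partial_cst (a : R) (i : 'I_n) : partial i (fun=> a) = (fun=> 0).
Proof. by apply/funext => x; exact: derive_cst. Qed.

Lemma ckD k f g : ck k f -> ck k g -> ck k (fun x => f x + g x).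
Proof.
have C0 f' g' : c0 f' -> c0 g' -> c0 (fun x => f' x + g' x).
  move=> [cf df] [cg dg]; split=> [x|i x]; last exact: derivableD.
  exact: (cvgD (cf x) (cg x)).
elim: k f g => [|k IH] f g; first exact: C0.
move=> [cf pf] [cg pg]; split; first exact: C0.
by move=> i; rewrite partialD//; exact: IH (pf i) (pg i).
Qed.

Lemma ck_cst k (a : R) : ck k (fun _ : 'rV[R]_n => a).
Proof.
have C0 (b : R) : c0 (fun _ : 'rV[R]_n => b).
  by split=> [x|i x]; [exact: cst_continuous|exact: derivable_cst].
elim: k a => [|k IH] a; first exact: C0.
split; first exact: C0.
by move=> i; rewrite partial_cst; exact: IH.
Qed.

Lemma ckM k f g : ck k f -> ck k g -> ck k (fun x => f x * g x).
Proof.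
have C0 f' g' : c0 f' -> c0 g' -> c0 (fun x => f' x * g' x).
  move=> [cf df] [cg dg]; split=> [x|i x]; last exact: derivableM.
  exact: (cvgM (cf x) (cg x)).
elim: k f g => [|k IH] f g; first exact: C0.
move=> f1 g1; have [cf pf] := f1; have [cg pg] := g1; split; first exact: C0.
move=> i; rewrite partialM//; apply: ckD.
  exact: IH (ckS f1) (pg i).
exact: IH (pf i) (ckS g1).
Qed.

Lemma smooth_c0 f : smooth f -> c0 f.
Proof. by move=> /smooth_ck /(_ 0%N). Qed.

Lemma smooth_cst (a : R) : smooth (fun _ : 'rV[R]_n => a).
Proof. by apply/smooth_ck => k; exact: ck_cst. Qed.

Lemma smoothD f g : smooth f -> smooth g -> smooth (fun x => f x + g x).
Proof.
by move=> /smooth_ck sf /smooth_ck sg; apply/smooth_ck => k; exact: ckD.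
Qed.

Lemma smoothM f g : smooth f -> smooth g -> smooth (fun x => f x * g x).
Proof.
by move=> /smooth_ck sf /smooth_ck sg; apply/smooth_ck => k; exact: ckM.
Qed.

Lemma smoothZ (a : R) f : smooth f -> smooth (fun x => a * f x).
Proof. by move=> sf; apply: smoothM => //; exact: smooth_cst. Qed.

Lemma smooth_prod (I : Type) (r : seq I) (F : I -> 'rV[R]_n -> R) :
  (forall i, smooth (F i)) -> smooth (fun x => \prod_(i <- r) F i x).
Proof.
move=> sF; elim: r => [|i r IH].
  rewrite (_ : (fun _ => _) = fun=> 1); first exact: smooth_cst.
  by apply/funext => x; rewrite big_nil.
rewrite (_ : (fun _ => _) = fun x => F i x * \prod_(j <- r) F j x).
  exact: smoothM.
by apply/funext => x; rewrite big_cons.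
Qed.

Lemma partialsD f g s : smooth f -> smooth g ->
  partials s (fun x => f x + g x) = fun x => partials s f x + partials s g x.
Proof.
move=> sf sg; elim: s => //= i s ->.
by rewrite partialD//; exact/smooth_c0/smooth_partials.
Qed.

Lemma partialsZ f (a : R) s : smooth f ->
  partials s (fun x => a * f x) = fun x => a * partials s f x.
Proof.
move=> sf; elim: s => //= i s ->.
by rewrite partialZ//; exact/smooth_c0/smooth_partials.
Qed.

End Ck.

Section line.
Context {R : realType} {n : nat}.
Implicit Types f g : 'rV[R]_n -> R.

(** Restriction to a coordinate line gives access to the one-variable mean value theorem, chain rule
    and fundamental theorem of calculus. *)
Lemma is_derive_line f i (x : 'rV[R]_n) (t : R) :
  (forall y, derivable f y (delta_mx 0 i)) ->
  is_derive t (1 : R) (fun h : R => f (h *: delta_mx 0 i + x))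
    (partial i f (t *: delta_mx 0 i + x)).
Proof.
move=> df; set y := t *: delta_mx 0 i + x.
have /derivable1P d1 := df y.
have E h : (h - t) *: delta_mx 0 i + y = h *: delta_mx 0 i + x.
  by rewrite /y addrA -scalerDl subrK.
have F : (fun h : R => h^-1 *: (f ((h *: (1:R) + t) *: delta_mx 0 i + x) -
    f (t *: delta_mx 0 i + x))) =
    (fun h : R => h^-1 *: (f (h *: delta_mx 0 i + y) - f y)).
  apply/funext => h; rewrite -[h *: 1]/(h * 1) mulr1.
  by rewrite scalerDl -addrA.
apply: DeriveDef.
  by rewrite /derivable/= /comp/= F; exact: df.
by rewrite /derive /comp/= F.
Qed.

End line.

(** * Chain rule for maps that send basis directions to multiples of basis directions *)

Section composition.
Context {R : realType}.

Lemma is_derive_dirP n (f : 'rV[R]_n -> R) x v d :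
  is_derive x v f d <-> is_derive (0 : R) (1 : R) (fun h : R => f (h *: v + x)) d.
Proof.
have F : (fun h : R => h^-1 *: (f ((h *: (1:R) + 0) *: v + x) - f (0 *: v + x)))
    = (fun h : R => h^-1 *: (f (h *: v + x) - f x)).
  by apply/funext => h; rewrite addr0 scale0r add0r -[h *: 1]/(h * 1) mulr1.
split=> -[H1 H2]; apply: DeriveDef.
- by rewrite /derivable/= /comp/= F.
- by rewrite -H2 /derive /comp/= F.
- by move: H1; rewrite /derivable/= /comp/= F.
- by rewrite -H2 /derive /comp/= F.
Qed.

(* Image of a basis direction under a map that is affine coordinate by coordinate:
   [Some (a, j)] is [a] times the [j]-th basis vector, [None] is [0]. *)
Definition stepdir m (o : option (R * 'I_m)) : 'rV[R]_m :=
  if o is Some (a, j) then a *: delta_mx 0 j else 0.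

Variables (n m : nat) (A : 'rV[R]_n -> 'rV[R]_m) (pi : 'I_n -> option (R * 'I_m)).
Hypothesis contA : continuous A.
Hypothesis stepA : forall i x (h : R),
  A (h *: delta_mx 0 i + x) = h *: stepdir (pi i) + A x.

(** Along a basis direction [A] moves in one basis direction or stays put, so the one-variable chain
    rule suffices although [c0] gives no joint differentiability. *)
Lemma is_derive_comp_step (f : 'rV[R]_m -> R) i x : c0 f ->
  is_derive x (delta_mx 0 i) (fun y => f (A y))
    (if pi i is Some (a, j) then a * partial j f (A x) else 0).
Proof.
move=> [_ df]; apply/is_derive_dirP.
under [X in is_derive _ _ X _]funext do rewrite stepA.
case: (pi i) => [[a j]|] /=.
  have H := @is_derive_line _ _ f j (A x) (0 * a) (df j).
  have K : is_derive (0 : R) (1 : R) (fun h : R => h * a) a.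
    have -> : (fun h : R => h * a) = a *: (@id R).
      by apply/funext => h; rewrite /GRing.scale/= mulrC.
    by apply: is_derive_eq; rewrite -[a *: 1]/(a * 1) mulr1.
  under [X in is_derive _ _ X _]funext do rewrite scalerA.
  have := @is_derive1_comp _ (fun h : R => f (h *: delta_mx 0 j + A x))
    (fun h => h * a) 0 _ _ H K.
  by rewrite mul0r scale0r add0r mulrC.
under [X in is_derive _ _ X _]funext do rewrite scaler0.
exact: is_derive_cst.
Qed.

Lemma partial_comp (f : 'rV[R]_m -> R) i : c0 f ->
  partial i (fun y => f (A y)) =
  if pi i is Some (a, j) then fun x => a * partial j f (A x) else fun=> 0.
Proof.
move=> cf; apply/funext => x; rewrite /partial.
have /@derive_val -> := is_derive_comp_step i x cf.
by case: (pi i) => [[a j]|].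
Qed.

Lemma smooth_comp (f : 'rV[R]_m -> R) : smooth f -> smooth (fun x => f (A x)).
Proof.
have C0 g : c0 g -> c0 (fun x => g (A x)).
  move=> cg; split=> [x|i x]; last first.
    by have [] := is_derive_comp_step i x cg.
  by apply: continuous_comp; [exact: contA|case: cg => cg _; exact: cg].
move=> /smooth_ck sf; apply/smooth_ck => k.
elim: k f sf => [|k IH] f sf; first exact/C0/(sf 0%N).
have cf : c0 f by exact: (sf 0%N).
split; first exact: C0.
move=> i; rewrite partial_comp//; case: (pi i) => [[a j]|]; last exact: ck_cst.
apply: (@ckM _ _ k (fun=> a)); first exact: ck_cst.
by apply: IH => l; have [_ pf] := sf l.+1; exact: pf.
Qed.

End composition.

(** * Dilations, projections and embeddings of the factors, tensor products *)

Section coordinatewise_maps.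
Context {R : realType}.

Lemma mx_continuous (T : topologicalType) n (A : T -> 'rV[R]_n) :
  (forall j, continuous (fun x => A x 0 j)) -> continuous A.
Proof.
move=> H x.
apply/cvg_ballP => e e0; near=> y.
rewrite /ball/= ; split => // i j; rewrite (ord1 i).
move: j; near: y.
apply: filter_forall => j.
have /cvg_ballP/(_ e e0) := H j x.
by [].
Unshelve. all: by end_near. Qed.

Lemma dilation_step n (sigma : 'I_n -> nat) (lam : R) i x (h : R) :
  dilation sigma lam (h *: delta_mx 0 i + x) =
  h *: stepdir (Some (lam ^+ sigma i, i)) + dilation sigma lam x.
Proof.
apply/rowP => j; rewrite /= !mxE eqxx /=.
case: eqVneq => [->|_]; rewrite ?mulr1 ?mulr0 ?add0r//.
by rewrite mulrDr [_ * h]mulrC.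
Qed.

Lemma dilation_continuous n (sigma : 'I_n -> nat) (lam : R) :
  continuous (dilation sigma lam).
Proof.
apply: mx_continuous => j x.
rewrite (_ : (fun y => dilation sigma lam y 0 j) = fun y => lam ^+ sigma j * y 0 j).
  apply: (@continuousM _ _ (fun=> lam ^+ sigma j) (fun y : 'rV[R]_n => y 0 j)).
    exact: cst_continuous.
  exact: coord_continuous.
by apply/funext => y; rewrite mxE.
Qed.

Lemma smooth_dilation n (sigma : 'I_n -> nat) (lam : R) f :
  smooth f -> smooth (fun x => f (dilation sigma lam x)).
Proof.
apply: (@smooth_comp _ _ _ _ (fun i => Some (lam ^+ sigma i, i))).
  exact: dilation_continuous.
exact: dilation_step.
Qed.

Lemma partial_dilation n (sigma : 'I_n -> nat) (lam : R) f i : smooth f ->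
  partial i (fun x => f (dilation sigma lam x)) =
  fun x => lam ^+ sigma i * partial i f (dilation sigma lam x).
Proof.
move=> sf.
by rewrite (partial_comp (@dilation_step n sigma lam))//; exact: smooth_c0.
Qed.

Lemma partials_dilation n (sigma : 'I_n -> nat) (lam : R) f s : smooth f ->
  partials s (fun x => f (dilation sigma lam x)) =
  fun x => lam ^+ (\sum_(i <- s) sigma i) * partials s f (dilation sigma lam x).
Proof.
move=> sf; elim: s => [|i s IH] /=.
  by apply/funext => x; rewrite big_nil mul1r.
rewrite IH partialZ; last first.
  exact/smooth_c0/smooth_dilation/smooth_partials.
rewrite partial_dilation; last exact: smooth_partials.
by apply/funext => x; rewrite big_cons mulrA -exprD addnC.
Qed.

Variables (n p : nat).

Definition lsub_step (k : 'I_(n + p)) : option (R * 'I_n) :=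
  if fintype.split k is inl i then Some (1, i) else None.
Definition rsub_step (k : 'I_(n + p)) : option (R * 'I_p) :=
  if fintype.split k is inr i then Some (1, i) else None.

Lemma lsubmx_step k (x : 'rV[R]_(n + p)) (h : R) :
  lsubmx (h *: delta_mx 0 k + x) = h *: stepdir (lsub_step k) + lsubmx x.
Proof.
apply/rowP => j; rewrite /lsub_step; case: splitP => i ki; rewrite /= !mxE /=.
  by rewrite mul1r -val_eqE /= ki.
rewrite mulr0.
suff /negbTE -> : lshift p j != k by rewrite mulr0.
by rewrite -val_eqE /= ki ltn_eqF// (leq_trans (ltn_ord j))// leq_addr.
Qed.

Lemma rsubmx_step k (x : 'rV[R]_(n + p)) (h : R) :
  rsubmx (h *: delta_mx 0 k + x) = h *: stepdir (rsub_step k) + rsubmx x.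
Proof.
apply/rowP => j; rewrite /rsub_step; case: splitP => i ki; rewrite /= !mxE /=.
  rewrite mulr0.
  suff /negbTE -> : rshift n j != k by rewrite mulr0.
  by rewrite -val_eqE /= ki gtn_eqF// (leq_trans (ltn_ord i))// leq_addr.
by rewrite mul1r -val_eqE /= ki eqn_add2l.
Qed.

Lemma row_mxl_step (xi : 'rV[R]_p) i (x : 'rV[R]_n) (h : R) :
  row_mx (h *: delta_mx 0 i + x) xi =
  h *: stepdir (Some (1, lshift p i)) + row_mx x xi.
Proof.
apply/rowP => j; rewrite /= scale1r !mxE; case: splitP => k jk; rewrite ?mxE /=.
  by rewrite -!val_eqE /= jk.
rewrite -val_eqE /= jk gtn_eqF ?mulr0 ?add0r//.
by rewrite (leq_trans (ltn_ord i))// leq_addr.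
Qed.

Lemma row_mxr_step (x : 'rV[R]_n) i (xi : 'rV[R]_p) (h : R) :
  row_mx x (h *: delta_mx 0 i + xi) =
  h *: stepdir (Some (1, rshift n i)) + row_mx x xi.
Proof.
apply/rowP => j; rewrite /= scale1r !mxE; case: splitP => k jk; rewrite ?mxE /=.
  rewrite -val_eqE /= jk ltn_eqF ?mulr0 ?add0r//.
  by rewrite (leq_trans (ltn_ord k))// leq_addr.
by rewrite -!val_eqE /= jk eqn_add2l.
Qed.

Lemma lsubmx_continuous : continuous (lsubmx : 'rV[R]_(n + p) -> 'rV[R]_n).
Proof.
apply: mx_continuous => j x; rewrite /continuous_at; under eq_fun do rewrite mxE.
by rewrite mxE; exact: coord_continuous.
Qed.

Lemma rsubmx_continuous : continuous (rsubmx : 'rV[R]_(n + p) -> 'rV[R]_p).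
Proof.
apply: mx_continuous => j x; rewrite /continuous_at; under eq_fun do rewrite mxE.
by rewrite mxE; exact: coord_continuous.
Qed.

Lemma row_mx_continuous (T : topologicalType) (A : T -> 'rV[R]_n)
    (B : T -> 'rV[R]_p) : continuous A -> continuous B ->
  continuous (fun x => row_mx (A x) (B x)).
Proof.
move=> cA cB; apply: mx_continuous => j x; rewrite /continuous_at.
under eq_fun do rewrite mxE; rewrite mxE.
case: splitP => k _.
  by apply: (@continuous_comp _ _ _ A (fun z => z 0 k));
    [exact: cA|exact: coord_continuous].
by apply: (@continuous_comp _ _ _ B (fun z => z 0 k));
  [exact: cB|exact: coord_continuous].
Qed.

Definition tensor (f : 'rV[R]_n -> R) (g : 'rV[R]_p -> R) (z : 'rV[R]_(n + p)) :=
  f (lsubmx z) * g (rsubmx z).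

Lemma smooth_lsubmx f : smooth f -> smooth (fun z : 'rV[R]_(n + p) => f (lsubmx z)).
Proof.
by apply: (@smooth_comp _ _ _ _ lsub_step);
  [exact: lsubmx_continuous|exact: lsubmx_step].
Qed.

Lemma smooth_rsubmx f : smooth f -> smooth (fun z : 'rV[R]_(n + p) => f (rsubmx z)).
Proof.
by apply: (@smooth_comp _ _ _ _ rsub_step);
  [exact: rsubmx_continuous|exact: rsubmx_step].
Qed.

Lemma smooth_tensor f g : smooth f -> smooth g -> smooth (tensor f g).
Proof.
by move=> sf sg; apply: smoothM; [exact: smooth_lsubmx|exact: smooth_rsubmx].
Qed.

Lemma partial_tensor f g i : smooth f -> smooth g ->
  partial (lshift p i) (tensor f g) = tensor (partial i f) g.
Proof.
move=> sf sg.
rewrite partialM; [|exact/smooth_c0/smooth_lsubmx|exact/smooth_c0/smooth_rsubmx].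
rewrite (partial_comp rsubmx_step); last exact: smooth_c0.
rewrite (partial_comp lsubmx_step); last exact: smooth_c0.
rewrite /lsub_step /rsub_step.
rewrite (_ : fintype.split (lshift p i) = inl i); last exact: (unsplitK (inl i)).
by apply/funext => z; rewrite mulr0 add0r mul1r.
Qed.

Lemma partials_tensor f g s : smooth f -> smooth g ->
  partials (map (lshift p) s) (tensor f g) = tensor (partials s f) g.
Proof.
move=> sf sg; elim: s => //= i s ->.
by rewrite partial_tensor//; exact: smooth_partials.
Qed.

Lemma smooth_row_mxl (f : 'rV[R]_(n + p) -> R) xi : smooth f ->
  smooth (fun x => f (row_mx x xi)).
Proof.
apply: (@smooth_comp _ _ _ _ (fun i => Some (1, lshift p i))).
  by apply: row_mx_continuous => x; [exact: cvg_id|exact: cst_continuous].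
exact: row_mxl_step.
Qed.

Lemma smooth_row_mxr (f : 'rV[R]_(n + p) -> R) x : smooth f ->
  smooth (fun xi => f (row_mx x xi)).
Proof.
apply: (@smooth_comp _ _ _ _ (fun i => Some (1, rshift n i))).
  by apply: row_mx_continuous => y; [exact: cst_continuous|exact: cvg_id].
exact: row_mxr_step.
Qed.

Lemma partial_row_mxl (f : 'rV[R]_(n + p) -> R) xi i : smooth f ->
  partial i (fun x => f (row_mx x xi)) =
  fun x => partial (lshift p i) f (row_mx x xi).
Proof.
move=> sf; rewrite (partial_comp (@row_mxl_step xi)); last exact: smooth_c0.
by apply/funext => x; rewrite mul1r.
Qed.

Lemma partial_row_mxr (f : 'rV[R]_(n + p) -> R) x i : smooth f ->
  partial i (fun xi => f (row_mx x xi)) =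
  fun xi => partial (rshift n i) f (row_mx x xi).
Proof.
move=> sf; rewrite (partial_comp (@row_mxr_step x)); last exact: smooth_c0.
by apply/funext => y; rewrite mul1r.
Qed.

End coordinatewise_maps.

(** * Boxes, supports and mean value estimates *)

Section bounds.
Context {R : realType} {n : nat}.
Implicit Types (f g : 'rV[R]_n -> R) (x y : 'rV[R]_n).

Lemma coord_le_norm x i : `|x 0 i| <= `|x|.
Proof.
have /mapP[j Hj ->] : `|x 0 i| \in [seq `|x k.1 k.2| | k : 'I_1 * 'I_n].
  by apply/mapP; exists (ord0, i) => //=; rewrite mem_enum.
by rewrite [leRHS]/Num.Def.normr /= mx_normrE; apply/bigmax_geP; right => /=;
  exists j.
Qed.

(** The norm of a row vector is the largest absolute value of its coordinates, so closed balls are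
    boxes; supports are measured by these throughout. *)
Lemma norm_leP x (r : R) : 0 <= r ->
  (`|x| <= r <-> forall i, `|x 0 i| <= r).
Proof.
move=> r0; split=> [xr i|H]; first exact: le_trans (coord_le_norm x i) xr.
rewrite [leLHS]/Num.Def.normr /= mx_normrE; apply/bigmax_leP;
  split => // -[i j] _ /=.
by rewrite (ord1 i).
Qed.

Lemma norm_gt_coord x (r : R) : 0 <= r -> r < `|x| -> exists i, r < `|x 0 i|.
Proof.
move=> r0 rx; apply: contrapT => /forallNP H.
have : `|x| <= r by apply/norm_leP => // i; rewrite leNgt; exact/negP.
by rewrite leNgt rx.
Qed.

Lemma compact_box (r : R) : compact [set x : 'rV[R]_n | `|x| <= r].
Proof.
apply: bounded_closed_compact.
  exists r; split; first exact: num_real.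
  by move=> M rM x /= xr; rewrite (le_trans xr)// ltW.
apply: (@closed_comp _ _ (fun x : 'rV[R]_n => `|x|) [set t : R | t <= r]).
  by move=> x _; exact: norm_continuous.
exact: closed_le.
Qed.

Lemma continuous_box_bounded f (r : R) : continuous f ->
  exists2 M, 0 <= M & forall x, `|x| <= r -> `|f x| <= M.
Proof.
move=> cf; have [r0|r0] := leP 0 r; last first.
  exists 0 => // x xr; have := normr_ge0 x.
  by rewrite leNgt (le_lt_trans xr r0).
have A0 : [set x : 'rV[R]_n | `|x| <= r] !=set0 by exists 0; rewrite /= normr0.
have cB : {within [set x : 'rV[R]_n | `|x| <= r], continuous (fun x => `|f x|)}.
  apply: continuous_subspaceT => x.
  by apply: continuous_comp; [exact: cf|exact: norm_continuous].
have [c _ H] := EVT_max_rV A0 (@compact_box r) cB.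
by exists `|f c| => // x xr; apply: H; rewrite inE.
Qed.

Definition supp_in (r : R) f := forall x, r < `|x| -> f x = 0.

Lemma supp_bounded r f : continuous f -> supp_in r f ->
  exists2 M, 0 <= M & forall x, `|f x| <= M.
Proof.
move=> cf sf; have [M M0 HM] := continuous_box_bounded r cf; exists M => // x.
have [xr|xr] := leP `|x| r; first exact: HM.
by rewrite sf// normr0.
Qed.

Lemma supp_partial r f i : supp_in r f -> supp_in r (partial i f).
Proof.
move=> sf x xr; rewrite /partial (@near_eq_derive _ _ _ f (fun=> 0)).
  exact: derive_cst.
have : nbhs x [set y | r < `|y|].
  apply: open_nbhs_nbhs; split => //.
  apply: (@open_comp _ _ (fun x : 'rV[R]_n => `|x|) [set t : R | r < t]).
    by move=> y _; exact: norm_continuous.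
  exact: open_gt.
by apply: filterS => y; exact: sf.
Qed.

Lemma supp_partials r f s : supp_in r f -> supp_in r (partials s f).
Proof. by move=> sf; elim: s => //= i s; exact: supp_partial. Qed.

Lemma mvt_coord f i x (h : R) : (forall y, derivable f y (delta_mx 0 i)) ->
  exists2 c : R, `|c| <= `|h| &
    f (h *: delta_mx 0 i + x) - f x = partial i f (c *: delta_mx 0 i + x) * h.
Proof.
move=> df.
have D (t : R) := is_derive_line x t df.
have C (a b : R) : {within `[a, b],
  continuous (fun h : R => f (h *: delta_mx 0 i + x))}.
  apply: continuous_subspaceT => t.
  apply: differentiable_continuous; apply/derivable1_diffP.
  by have [] := D t.
have [h0|h0] := leP 0 h.
  have [c] := MVT_segment h0 (fun t _ => D t) (C 0 h).
  rewrite in_itv /= => /andP[c0 ch]; rewrite scale0r add0r subr0 => E.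
  by exists c => //; rewrite ger0_norm// ger0_norm.
have [c] := MVT_segment (ltW h0) (fun t _ => D t) (C h 0).
rewrite in_itv /= => /andP[hc c0]; rewrite scale0r add0r sub0r => E.
exists c; first by rewrite ler0_norm// ltr0_norm// lerN2.
by rewrite -opprB E mulrN opprK.
Qed.

(** A walk from [x] to [y] that changes one coordinate at a time uses the mean value theorem once
    per coordinate. The estimate later yields continuity of fiber integrals and, with [M] equal to
    0, constancy along the fibers. *)
Lemma lipschitz_partial f (M : R) : 0 <= M ->
  (forall i y, derivable f y (delta_mx 0 i)) ->
  (forall i y, `|partial i f y| <= M) ->
  forall x y, `|f y - f x| <= n%:R * M * `|y - x|.
Proof.
move=> M0 df HM x y.
pose z k : 'rV[R]_n := \row_i (if (i < k)%N then y 0 i else x 0 i).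
have z0 : z 0%N = x by apply/rowP => i; rewrite mxE.
have zn : z n = y by apply/rowP => i; rewrite mxE ltn_ord.
have zS k (kn : (k < n)%N) :
    z k.+1 = (y 0 (Ordinal kn) - x 0 (Ordinal kn)) *: delta_mx 0 (Ordinal kn) + z k.
  apply/rowP => i; rewrite !mxE /=; case: (eqVneq i (Ordinal kn)) => [->|ik] /=.
    by rewrite ltnS leqnn ltnn mulr1 subrK.
  rewrite mulr0 add0r ltnS leq_eqVlt.
  suff /negbTE -> : (i != k :> nat) by [].
  by apply: contraNN ik => /eqP ik; apply/eqP/val_inj.
suff H k : (k <= n)%N -> `|f (z k) - f x| <= k%:R * M * `|y - x|.
  by have := H n (leqnn n); rewrite zn.
elim: k => [_|k IH kn]; first by rewrite z0 subrr normr0 !mul0r.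
have [c _ E] := @mvt_coord f (Ordinal kn) (z k)
  (y 0 (Ordinal kn) - x 0 (Ordinal kn)) (df _).
rewrite -zS in E.
rewrite -[f (z k.+1)](subrK (f (z k))) -addrA -natr1 mulrDl mulrDl addrC.
apply: le_trans (ler_normD _ _) _; apply: lerD; first exact/IH/ltnW.
rewrite E normrM mul1r ler_pM//.
by have := coord_le_norm (y - x) (Ordinal kn); rewrite !mxE.
Qed.

Lemma lipschitz_continuous f (M : R) :
  (forall x y, `|f y - f x| <= M * `|y - x|) -> continuous f.
Proof.
move=> H x; apply/(@cvgrPdist_lt _ _ _ (nbhs x) (nbhs_filter x)) => e e0.
have M0 : 0 < `|M| + 1 by rewrite ltr_wpDl.
have : nbhs x (ball x (e / (`|M| + 1))) by apply: nbhsx_ballx; rewrite divr_gt0.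
apply: filterS => y; rewrite -ball_normE /ball_ /= => xy.
rewrite distrC; apply: le_lt_trans (H x y) _.
apply: (@le_lt_trans _ _ ((`|M| + 1) * `|y - x|)).
  by rewrite ler_wpM2r// (le_trans (ler_norm M))// lerDl.
by rewrite mulrC -ltr_pdivlMr// distrC.
Qed.

Lemma taylor2_coord f i (M : R) x (h : R) :
  (forall y, derivable f y (delta_mx 0 i)) ->
  (forall y, derivable (partial i f) y (delta_mx 0 i)) ->
  (forall y, `|partial i (partial i f) y| <= M) ->
  `|f (h *: delta_mx 0 i + x) - f x - h * partial i f x| <= M * h ^+ 2.
Proof.
move=> df ddf HM; have [c ch E] := mvt_coord x h df.
have [c' _ E'] := mvt_coord x c ddf.
rewrite E [h * _]mulrC -mulrBl E' 2!normrM -mulrA ler_pM//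
  -(real_normK (num_real h)).
by rewrite expr2 ler_wpM2r.
Qed.

End bounds.

(** * Test functions *)

Section test_functions.
Context {R : realType}.

Definition test n (f : 'rV[R]_n -> R) := test_fun setT f.

Lemma testP n (f : 'rV[R]_n -> R) :
  test f <-> smooth f /\ exists2 r, 0 <= r & supp_in r f.
Proof.
split=> [[sf [K [cK _] HK]]|[sf [r r0 Hr]]]; split => //.
  have [M [_ HM]] := compact_bounded cK.
  exists (`|M| + 1) => // x xM; apply: HK => Kx.
  have M1 : M < `|M| + 1 by rewrite (le_lt_trans (ler_norm M))// ltrDl.
  by have := HM _ M1 x Kx; rewrite /= leNgt xM.
exists [set x | `|x| <= r]; first by split => //; exact: compact_box.
by move=> x /negP; rewrite -ltNge; exact: Hr.
Qed.

Lemma test_smooth n (f : 'rV[R]_n -> R) : test f -> smooth f.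
Proof. by case. Qed.

Lemma testD n (f g : 'rV[R]_n -> R) : test f -> test g -> test (fun x => f x + g x).
Proof.
move=> /testP[sf [r r0 Hr]] /testP[sg [r' r'0 Hr']]; apply/testP.
split; first exact: smoothD.
exists (r + r'); first by rewrite addr_ge0.
move=> x xr; rewrite Hr; last by apply: le_lt_trans xr; rewrite lerDl.
by rewrite Hr' ?addr0//; apply: le_lt_trans xr; rewrite lerDr.
Qed.

Lemma testM n (f g : 'rV[R]_n -> R) : smooth f -> test g -> test (fun x =>
  f x * g x).
Proof.
move=> sf /testP[sg [r r0 Hr]]; apply/testP; split; first exact: smoothM.
by exists r => // x xr; rewrite Hr// mulr0.
Qed.

Lemma testZ n (a : R) (f : 'rV[R]_n -> R) : test f -> test (fun x => a * f x).
Proof. by move=> tf; apply: testM => //; exact: smooth_cst. Qed.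

Lemma testN n (f : 'rV[R]_n -> R) : test f -> test (fun x => - f x).
Proof.
move=> tf; rewrite (_ : (fun _ => _) = fun x => -1 * f x); first exact: testZ.
by apply/funext => x; rewrite mulN1r.
Qed.

Lemma test0 n : test (fun _ : 'rV[R]_n => 0).
Proof. by apply/testP; split; [exact: smooth_cst|exists 0]. Qed.

Lemma test_sum n (I : Type) (r : seq I) (P : pred I) (F : I -> 'rV[R]_n -> R) :
  (forall i, test (F i)) -> test (fun x => \sum_(i <- r | P i) F i x).
Proof.
move=> sF; elim: r => [|i r IH].
  rewrite (_ : (fun _ => _) = fun=> 0); first exact: test0.
  by apply/funext => x; rewrite big_nil.
case Pi: (P i); last first.
  rewrite (_ : (fun _ => _) = fun x => \sum_(j <- r | P j) F j x)//.
  by apply/funext => x; rewrite big_cons Pi.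
rewrite (_ : (fun _ => _) = fun x => F i x + \sum_(j <- r | P j) F j x).
  exact: testD.
by apply/funext => x; rewrite big_cons Pi.
Qed.

Lemma test_partial n (f : 'rV[R]_n -> R) i : test f -> test (partial i f).
Proof.
move=> /testP[sf [r r0 Hr]]; apply/testP; split; first exact: smooth_partial.
by exists r => //; exact: supp_partial.
Qed.

Lemma test_partials n (f : 'rV[R]_n -> R) s : test f -> test (partials s f).
Proof. by move=> tf; elim: s => //= i s; exact: test_partial. Qed.

Lemma test_schwartz n (f : 'rV[R]_n -> R) : test f -> schwartz f.
Proof.
move=> /testP[sf [r r0 Hr]]; split => // k s.
have [|M M0 HM] := @supp_bounded _ _ r (partials s f) _ (supp_partials s Hr).
  exact/smooth_cont/smooth_partials.
exists ((1 + r) ^+ k * M) => x; have [xr|xr] := leP `|x| r.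
  by rewrite ler_pM// ?lerXn2r ?nnegrE ?addr_ge0// lerD2l.
by rewrite (supp_partials s Hr)// normr0 mulr0 mulr_ge0// exprn_ge0// addr_ge0.
Qed.

Lemma test_bounded n (f : 'rV[R]_n -> R) : test f ->
  exists2 M, 0 <= M & forall x, `|f x| <= M.
Proof.
by move=> /testP[sf [r r0 Hr]]; apply: supp_bounded Hr; exact: smooth_cont.
Qed.

(** For [lam >= 1] the inverse image of a box shrinks, so one box serves all these dilations. The
    uniform bound on lifted solutions rests on this. *)
Lemma supp_dilation n (sigma : 'I_n -> nat) (lam r : R) (f : 'rV[R]_n -> R) :
  1 <= lam -> 0 <= r -> supp_in r f -> supp_in r (fun x =>
    f (dilation sigma lam x)).
Proof.
move=> l1 r0 Hr x xr; apply: Hr; have [i xi] := norm_gt_coord r0 xr.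
apply: lt_le_trans xi _; apply: le_trans (coord_le_norm _ i).
rewrite mxE normrM ler_peMl// ger0_norm; first exact: exprn_ege1.
by rewrite exprn_ge0// (le_trans _ l1).
Qed.

Lemma dilationK n (sigma : 'I_n -> nat) (lam : R) : lam != 0 ->
  cancel (dilation sigma lam^-1) (dilation sigma lam).
Proof.
by move=> l0 x; apply/rowP => i; rewrite !mxE mulrA -exprMn divff// expr1n mul1r.
Qed.

(** The homogeneous dimension [\sum_i sigma i] is a crude common upper bound for the exponents
    [sigma i]. *)
Lemma norm_dilation_le n (sigma : 'I_n -> nat) (lam : R) x : 1 <= lam ->
  `|dilation sigma lam x| <= lam ^+ (\sum_i sigma i) * `|x|.
Proof.
move=> l1; apply/norm_leP; first by rewrite mulr_ge0// exprn_ge0// (le_trans _ l1).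
move=> i; rewrite mxE normrM ler_pM ?coord_le_norm//.
rewrite ger0_norm; last by rewrite exprn_ge0// (le_trans _ l1).
by rewrite ler_weXn2l// (bigD1 i)//= leq_addr.
Qed.

Lemma test_dilation n (sigma : 'I_n -> nat) (lam : R) (f : 'rV[R]_n -> R) :
  0 < lam -> test f -> test (fun x => f (dilation sigma lam x)).
Proof.
move=> l0 /testP[sf [r r0 Hr]]; apply/testP; split; first exact: smooth_dilation.
have [l1|l1] := leP 1 lam; first by exists r => //; exact: supp_dilation.
(* For [lam < 1] the support grows, by no more than the inverse dilation allows, and to that one the
   bound for parameters at least 1 applies. *)
have k1 : 1 <= lam^-1 by rewrite invf_ge1// ltW.
have K0 : 0 < lam^-1 ^+ (\sum_i sigma i) by rewrite exprn_gt0// invr_gt0.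
exists (lam^-1 ^+ (\sum_i sigma i) * r); first by rewrite mulr_ge0// ltW.
move=> x xr; apply: Hr; rewrite -(ltr_pM2l K0); apply: lt_le_trans xr _.
have := norm_dilation_le sigma (dilation sigma lam x) k1.
rewrite -{2}(invrK lam) dilationK// gt_eqF// invr_gt0//.
Qed.

Lemma supp_tensor n p r r' (f : 'rV[R]_n -> R) (g : 'rV[R]_p -> R) :
  0 <= r -> 0 <= r' -> supp_in r f -> supp_in r' g ->
  supp_in (r + r') (tensor f g).
Proof.
move=> r0 r0' Hf Hg z zr.
have [i zi] := norm_gt_coord (addr_ge0 r0 r0') zr.
rewrite /tensor; case: (splitP i) => j ij.
  rewrite Hf ?mul0r//; apply: lt_le_trans (coord_le_norm _ j).
  rewrite mxE (_ : lshift p j = i); last exact: val_inj.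
  by apply: le_lt_trans zi; rewrite lerDl.
rewrite Hg ?mulr0//; apply: lt_le_trans (coord_le_norm _ j).
rewrite mxE (_ : rshift n j = i); last exact: val_inj.
by apply: le_lt_trans zi; rewrite lerDr.
Qed.

Lemma test_tensor n p (f : 'rV[R]_n -> R) (g : 'rV[R]_p -> R) :
  test f -> test g -> test (tensor f g).
Proof.
move=> /testP[sf [r r0 Hr]] /testP[sg [r' r'0 Hr']]; apply/testP.
split; first exact: smooth_tensor.
by exists (r + r'); [rewrite addr_ge0|exact: supp_tensor].
Qed.

Lemma norm_row_mxl n p (x : 'rV[R]_n) (xi : 'rV[R]_p) : `|x| <= `|row_mx x xi|.
Proof.
apply/norm_leP => // i; apply: le_trans (coord_le_norm _ (lshift p i)).
by rewrite row_mxEl.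
Qed.

Lemma norm_row_mxr n p (x : 'rV[R]_n) (xi : 'rV[R]_p) : `|xi| <= `|row_mx x xi|.
Proof.
apply/norm_leP => // i; apply: le_trans (coord_le_norm _ (rshift n i)).
by rewrite row_mxEr.
Qed.

(** The argument to which [vf_dist V u] applies [u]: the formal transpose of [V] as an operator of
    its own. *)
Definition vstar n (V : vfield R n) (phi : 'rV[R]_n -> R) : 'rV[R]_n -> R :=
  fun x => - \sum_(j < n) partial j (fun y => V y 0 j * phi y) x.

Lemma test_vstar n (V : vfield R n) phi : smooth_map V -> test phi ->
  test (vstar V phi).
Proof.
move=> sV tp; apply/testN/test_sum => j; apply: test_partial.
by apply: (testM (sV j)).
Qed.

(** A left fold: in [X_{i_1} ... X_{i_k} u] the outermost field is the first to be transposed onto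
    the test function. *)
Definition wstar n m (X : 'I_m -> vfield R n) (I : seq 'I_m) phi :=
  foldl (fun psi i => vstar (X i) psi) phi I.

Lemma word_distE n m (X : 'I_m -> vfield R n) I u phi :
  word_dist X I u phi = u (wstar X I phi).
Proof. by elim: I phi => //= i I IH phi; rewrite /vf_dist IH. Qed.

Lemma test_wstar n m (X : 'I_m -> vfield R n) I phi :
  (forall i, smooth_map (X i)) -> test phi -> test (wstar X I phi).
Proof.
by move=> sX; elim: I phi => //= i I IH phi tp; apply: IH; exact: test_vstar.
Qed.

End test_functions.

(** * Integration on row vectors *)

Section measurable_continuous.
Context {R : realType} {n : nat}.
Notation RR := (measurableTypeR R).

(** An open set is the countable union of the rational boxes inside it, and a box is a finite
    intersection of coordinate preimages, hence in the product sigma-algebra. *)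
Lemma measurable_open_rV (U : set 'rV[R]_n) : open U ->
  measurable (@rv_of_tuple R n @^-1` U).
Proof.
move=> oU.
pose B (qk : 'rV[rat]_n * nat) : set (n.-tuple RR) :=
  [set t | forall i, `|(tnth t i : R) - ratr (qk.1 0 i)| < qk.2.+1%:R^-1].
(* Boxes that leave [U] are replaced by the empty set, so that the union runs over a whole countable
   type. *)
pose V (qk : 'rV[rat]_n * nat) : set (n.-tuple RR) :=
  if `[< B qk `<=` @rv_of_tuple R n @^-1` U >] then B qk else set0.
have -> : @rv_of_tuple R n @^-1` U = \bigcup_qk V qk.
  apply/seteqP; split => [t Ut|t [qk _]]; last first.
    by rewrite /V; case: asboolP => [BU /BU|].
  have : nbhs (rv_of_tuple t) U by move: oU; rewrite openE; exact.
  move=> /nbhs_ballP[e /= e0 eU].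
  (* Two points of one box are within twice its radius, whence the factor 2. *)
  have [k ke] : exists k, 2 * k.+1%:R^-1 < e.
    have e2 : 0 < e / 2 by rewrite divr_gt0.
    have [k] := ltr_add_invr e2.
    by rewrite add0r => ke; exists k; rewrite mulrC -ltr_pdivlMr.
  have k0 : 0 < k.+1%:R^-1 :> R by rewrite invr_gt0.
  have /choice[q Hq] (i : 'I_n) : exists q : rat,
    `|(tnth t i : R) - ratr q| < k.+1%:R^-1.
    have /rat_in_itvoo[q] : (tnth t i : R) - k.+1%:R^-1 < (tnth t i : R) +
      k.+1%:R^-1.
      by rewrite ltrD2l gtrN.
    rewrite in_itv /= => /andP[q1 q2]; by exists q; rewrite ltr_distlC q1.
  have Bt : B (\row_i q i, k) t by move=> i; rewrite /= mxE.
  exists (\row_i q i, k) => //; rewrite /V; case: asboolP => // -[] u Bu /=.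
  apply: eU; rewrite -ball_normE /ball_ /=.
  apply: le_lt_trans ke; apply/norm_leP; first by rewrite mulr_ge0// ltW.
  move=> i; rewrite !mxE.
  have := Bt i; have := Bu i; rewrite /= mxE => b1 b2.
  rewrite mulr_natl mulr2n; apply: le_trans (ler_distD (ratr (q i)) _ _) _.
  by rewrite lerD// ltW// distrC.
apply: countable_bigcupT_measurable => // qk; rewrite /V; case: asboolP => // _.
have -> : B qk = \bigcap_(i in [set: 'I_n])
    ((fun t : n.-tuple RR => tnth t i) @^-1` ball (ratr (qk.1 0 i) : R)
      (qk.2.+1%:R^-1)).
  apply/seteqP; split=> [t Bt i _|t H i].
    by rewrite /= -ball_normE /ball_ /= distrC; exact: Bt.
  by have := H i I; rewrite /= -ball_normE /ball_ /= distrC.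
apply: fin_bigcap_measurable => [|i _]; first exact: finite_finset.
 rewrite -[X in measurable X]setTI.
apply: measurable_tnth => //.
by apply: open_measurable; apply: ball_open; rewrite invr_gt0.
Qed.

Lemma continuous_measurable_rV (f : 'rV[R]_n -> R) :
  continuous f -> measurable_rV f.
Proof.
move=> /continuousP cf; apply: (measurability _ (RGenOpens.measurableE R)).
move=> _ [_ [a [b ->]]] <-; rewrite setTI.
have oU : open (f @^-1` `]a, b[%classic) by apply: cf; exact: interval_open.
exact: (measurable_open_rV oU).
Qed.

End measurable_continuous.

(** * Integrability and Fubini under a product weight *)

Section decaying_functions.
Context {R : realType}.
Notation RR := (measurableTypeR R).
Notation leb := (@lebesgue_measure R).

Definition cauchy1 (t : R) : R := (oneDsqr t)^-1.

Lemma cauchy1_gt0 t : 0 < cauchy1 t.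
Proof. by rewrite invr_gt0 (lt_le_trans _ (oneDsqr_ge1 t)). Qed.

Lemma cauchy1_continuous : continuous cauchy1.
Proof. exact: continuous_oneDsqrV. Qed.

(** The function is even and its integral over the half line is known through the arctangent. *)
Lemma cauchy1_integrable : leb.-integrable setT (EFin \o cauchy1).
Proof.
have mw : measurable_fun setT cauchy1.
  exact: (continuous_measurable_fun cauchy1_continuous).
apply/integrableP; split; first exact/measurable_EFinP.
under eq_integral => t _ do rewrite /= (ger0_norm (ltW (cauchy1_gt0 t))).
rewrite ge0_symfun_integralT.
- by rewrite -set_itvcy integral0y_oneDsqr -EFinM ltry.
- by move=> t; exact/ltW/cauchy1_gt0.
- exact: cauchy1_continuous.
- by move=> t; rewrite /cauchy1 /oneDsqr /= sqrrN.
Qed.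

(* The integrable majorant used for compactly supported and Schwartz functions
   alike, so that one integrability proof covers both. *)
Definition cauchyn n (x : 'rV[R]_n) : R := \prod_(i < n) cauchy1 (x 0 i).

Lemma cauchyn_gt0 n (x : 'rV[R]_n) : 0 < cauchyn x.
Proof. by apply: prodr_gt0 => i _; exact: cauchy1_gt0. Qed.

Lemma cauchyn_continuous n : continuous (@cauchyn n).
Proof.
rewrite /cauchyn; elim: (index_enum _) => [|i r IH] x.
  rewrite (_ : (fun x => _) = (fun=> 1)); first exact: cst_continuous.
  by apply/funext => y; rewrite big_nil.
rewrite (_ : (fun x => _) =
    (fun x : 'rV[R]_n => cauchy1 (x 0 i) * \prod_(j <- r) cauchy1 (x 0 j)));
      last first.
  by apply/funext => y; rewrite big_cons.
apply: (@continuousM _ _ (fun x : 'rV[R]_n => cauchy1 (x 0 i))); last exact: IH.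
apply: (@continuous_comp _ _ _ (fun x : 'rV[R]_n => x 0 i) cauchy1).
  exact: coord_continuous.
exact: cauchy1_continuous.
Qed.

(** The type ['rV_(1 + n)] is convertible with ['rV_n.+1], so both the block lemmas and the
    recursion of [lebesgue_tuple] apply. *)
Definition rvcons n (a : R) (x : 'rV[R]_n) : 'rV[R]_(1 + n) := row_mx a%:M x.

Lemma rvcons_continuous n (x : 'rV[R]_n) : continuous (fun a => rvcons a x).
Proof.
apply: row_mx_continuous => [|a]; last exact: cst_continuous.
apply: mx_continuous => j a; rewrite /continuous_at; under eq_fun do rewrite mxE.
by rewrite mxE ord1 /= mulr1n; exact: cvg_id.
Qed.

Lemma rvcons_continuousr n a : continuous (@rvcons n a).
Proof. by apply: row_mx_continuous => x; [exact: cst_continuous|exact: cvg_id]. Qed.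

Lemma rvcons0 n a (x : 'rV[R]_n) : rvcons a x 0 ord0 = a.
Proof.
rewrite /rvcons (_ : ord0 = lshift n (ord0 : 'I_1)); last exact: val_inj.
by rewrite row_mxEl mxE eqxx.
Qed.

Lemma rvconsS n a (x : 'rV[R]_n) i : rvcons a x 0 (lift ord0 i) = x 0 i.
Proof.
rewrite /rvcons (_ : lift ord0 i = rshift 1 i); last exact: val_inj.
by rewrite row_mxEr.
Qed.

Lemma rv_of_tuple_cons n a (t : n.-tuple RR) :
  rv_of_tuple (consRR (a, t)) = rvcons a (rv_of_tuple t).
Proof.
apply/rowP => i; rewrite [LHS]mxE; case: (unliftP ord0 i) => [j ->|->].
  by rewrite rvconsS mxE /= tnthS.
by rewrite rvcons0 tnth0.
Qed.

Lemma cauchyn_cons n a (x : 'rV[R]_n) : cauchyn (rvcons a x) = cauchy1 a *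
  cauchyn x.
Proof.
rewrite /cauchyn big_ord_recl rvcons0; congr (_ * _).
by apply: eq_bigr => i _; rewrite rvconsS.
Qed.

Definition decaying n (f : 'rV[R]_n -> R) :=
  continuous f /\ exists C, forall x, `|f x| <= C * cauchyn x.

Definition rv_integrable n (f : 'rV[R]_n -> R) :=
  (lebesgue_tuple n).-integrable setT (fun t => (f (rv_of_tuple t))%:E).

Let consf n (f : 'rV[R]_(1 + n) -> R) (z : RR * n.-tuple RR) : \bar R :=
  (f (rvcons z.1 (rv_of_tuple z.2)))%:E.

Let measurable_consf n (f : 'rV[R]_(1 + n) -> R) : continuous f ->
  measurable_fun setT (consf f).
Proof.
move=> cf; apply/measurable_EFinP.
have := measurableT_comp (continuous_measurable_rV cf) (@measurable_consRR R n).
by congr measurable_fun; apply/funext => -[a t] /=; rewrite -rv_of_tuple_cons.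
Qed.

Let consf_push n (f : 'rV[R]_(1 + n) -> R) : continuous f ->
  (leb \x lebesgue_tuple n)%E.-integrable setT (consf f) -> @rv_integrable n.+1 f.
Proof.
move=> cf H; apply: (@integrable_pushforward _ _ _ _ _ _ (@measurable_consRR R
  n)) => //.
  by apply/measurable_EFinP; exact: (continuous_measurable_rV cf).
rewrite preimage_setT; move: H; congr integrable.
by apply/funext => -[a t]; rewrite /consf /= -rv_of_tuple_cons.
Qed.

(** The weight splits off its first coordinate, so the iterated integral is a one-dimensional one
    times a constant that is finite by hypothesis; Tonelli's criterion concludes. *)
Let prod_cauchyn n : rv_integrable (@cauchyn n) ->
  (leb \x lebesgue_tuple n)%E.-integrable setT (consf (@cauchyn (1 + n))).
Proof.
move=> /integrableP[mW iW]; apply/integrable12ltyP.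
  by apply: measurable_consf; exact: cauchyn_continuous.
have K : (\int[lebesgue_tuple n]_t (cauchyn (rv_of_tuple t))%:E)%E \is a fin_num.
  rewrite ge0_fin_numE; last first.
    by apply: integral_ge0 => t _; rewrite lee_fin ltW// cauchyn_gt0.
  apply: le_lt_trans iW; apply: ge0_le_integral => //.
  - by move=> t _; rewrite lee_fin ltW// cauchyn_gt0.
  - exact: measurableT_comp.
  - by move=> t _; rewrite /= lee_fin ler_norm.
under eq_integral => a _.
  under eq_integral => t _.
    rewrite /consf /= cauchyn_cons normrM !ger0_norm ?(ltW (cauchy1_gt0 _))
      ?(ltW (cauchyn_gt0 _))//.
    rewrite EFinM; over.
  rewrite ge0_integralZl//; first over.
  - by move=> t _; rewrite lee_fin ltW// cauchyn_gt0.
  - by rewrite lee_fin ltW// cauchy1_gt0.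
rewrite -(fineK K).
under eq_integral => a _ do rewrite -EFinM.
have := integrableZr measurableT (fine (\int[lebesgue_tuple n]_t (cauchyn
  (rv_of_tuple t))%:E)%E) cauchy1_integrable.
move=> /integrableP[_]; apply: le_lt_trans.
apply: ge0_le_integral => //.
- move=> a _; rewrite lee_fin mulr_ge0// ?(ltW (cauchy1_gt0 _))//.
  by apply/fine_ge0/integral_ge0 => t _; rewrite lee_fin ltW// cauchyn_gt0.
- apply/measurable_EFinP; apply: measurable_funM => //.
  exact: (continuous_measurable_fun cauchy1_continuous).
- apply: measurableT_comp => //; apply/measurable_EFinP;
  apply: measurable_funM => //.
  exact: (continuous_measurable_fun cauchy1_continuous).
- by move=> a _; rewrite /= lee_fin ler_norm.
Qed.

Lemma cauchyn_integrable n : rv_integrable (@cauchyn n).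
Proof.
elim: n => [|n IH].
  rewrite /rv_integrable /=.
  rewrite (_ : (fun t => _) = (fun=> 1%:E)); last first.
    by apply/funext => t; rewrite /cauchyn big_ord0.
  exact: finite_measure_integrable_cst.
apply: consf_push; first exact: cauchyn_continuous.
exact: prod_cauchyn.
Qed.

Lemma decaying_integrable n (f : 'rV[R]_n -> R) : decaying f -> rv_integrable f.
Proof.
move=> [cf [C HC]].
have := integrableZl measurableT C (cauchyn_integrable n).
apply: le_integrable => //; first by apply/measurable_EFinP;
  exact: (continuous_measurable_rV cf).
by move=> t _ /=; rewrite lee_fin (le_trans (HC _))// ler_norm.
Qed.

Let decaying_prod n (f : 'rV[R]_(1 + n) -> R) : decaying f ->
  (leb \x lebesgue_tuple n)%E.-integrable setT (consf f).
Proof.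
move=> [cf [C HC]].
have := integrableZl measurableT C (prod_cauchyn (cauchyn_integrable n)).
apply: le_integrable => //; first exact: measurable_consf.
by move=> t _; rewrite /consf /= lee_fin (le_trans (HC _))// ler_norm.
Qed.

Lemma decaying_slice n (f : 'rV[R]_(1 + n) -> R) a : decaying f ->
  decaying (fun x => f (rvcons a x)).
Proof.
move=> [cf [C HC]]; split.
  move=> x; apply: continuous_comp; [exact: rvcons_continuousr|exact: cf].
by exists (C * cauchy1 a) => x; rewrite -mulrA -cauchyn_cons.
Qed.

Lemma decaying_slicer n (f : 'rV[R]_(1 + n) -> R) x : decaying f ->
  leb.-integrable setT (fun a => (f (rvcons a x))%:E).
Proof.
move=> [cf [C HC]].
have := integrableZl measurableT (C * cauchyn x) cauchy1_integrable.
apply: le_integrable => //.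
  apply/measurable_EFinP; apply: continuous_measurable_fun => a.
  by apply: continuous_comp; [exact: rvcons_continuous|exact: cf].
move=> a _; rewrite /= lee_fin (le_trans (HC _))//.
by rewrite cauchyn_cons [cauchy1 a * _]mulrC mulrA ler_norm.
Qed.

(** Here the tail is integrated first, in [integral_rV_consr] the first coordinate. A derivative has
    to be integrated in its own variable, so both orders occur. *)
Lemma integral_rV_cons n (f : 'rV[R]_(1 + n) -> R) : decaying f ->
  @integral_rV R n.+1 f = \int[leb]_a integral_rV (fun x => f (rvcons a x)).
Proof.
move=> df; have [cf _] := df.
rewrite /integral_rV /Rintegral; congr fine.
rewrite [LHS](@integral_pushforward _ _ _ _ _ _ (@measurable_consRR R n)) //;
  last 2 first.
- by apply/measurable_EFinP; exact: (continuous_measurable_rV cf).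
- rewrite preimage_setT; have := decaying_prod df; congr integrable.
  by apply/funext => -[a t]; rewrite /consf /= -rv_of_tuple_cons.
rewrite preimage_setT.
transitivity (\int[leb \x lebesgue_tuple n]_z consf f z)%E.
  by apply: eq_integral => -[a t] _; rewrite /consf /= -rv_of_tuple_cons.
rewrite -integral12_prod_meas1; last exact: decaying_prod.
apply: eq_integral => a _; rewrite /fubini_F /consf /= fineK//.
apply: integrable_fin_num => //.
exact: (decaying_integrable (decaying_slice a df)).
Qed.

Lemma integral_rV_consr n (f : 'rV[R]_(1 + n) -> R) : decaying f ->
  @integral_rV R n.+1 f = integral_rV (fun x => \int[leb]_a f (rvcons a x)).
Proof.
move=> df; have [cf _] := df.
rewrite /integral_rV /Rintegral; congr fine.
rewrite [LHS](@integral_pushforward _ _ _ _ _ _ (@measurable_consRR R n)) //;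
  last 2 first.
- by apply/measurable_EFinP; exact: (continuous_measurable_rV cf).
- rewrite preimage_setT; have := decaying_prod df; congr integrable.
  by apply/funext => -[a t]; rewrite /consf /= -rv_of_tuple_cons.
rewrite preimage_setT.
transitivity (\int[leb \x lebesgue_tuple n]_z consf f z)%E.
  by apply: eq_integral => -[a t] _; rewrite /consf /= -rv_of_tuple_cons.
rewrite -integral21_prod_meas1; last exact: decaying_prod.
apply: eq_integral => t _; rewrite /fubini_G /consf /= fineK//.
apply: integrable_fin_num => //.
exact: decaying_slicer.
Qed.

Lemma decayingD n (f g : 'rV[R]_n -> R) : decaying f -> decaying g ->
  decaying (fun x => f x + g x).
Proof.
move=> [cf [C HC]] [cg [D HD]]; split.
  by move=> x; exact: (cvgD (cf x) (cg x)).
exists (C + D) => x; rewrite mulrDl (le_trans (ler_normD _ _))//.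
by rewrite lerD.
Qed.

Lemma decayingZ n (a : R) (f : 'rV[R]_n -> R) : decaying f ->
  decaying (fun x => a * f x).
Proof.
move=> [cf [C HC]]; split.
  move=> x; apply: (@continuousM _ _ (fun=> a)); [exact: cst_continuous|exact: cf].
by exists (`|a| * C) => x; rewrite normrM -mulrA ler_wpM2l.
Qed.

Lemma integral_rVD n (f g : 'rV[R]_n -> R) : decaying f -> decaying g ->
  integral_rV (fun x => f x + g x) = integral_rV f + integral_rV g.
Proof.
move=> df dg; rewrite /integral_rV RintegralD//; exact: decaying_integrable.
Qed.

Lemma integral_rVZ n (a : R) (f : 'rV[R]_n -> R) : decaying f ->
  integral_rV (fun x => a * f x) = a * integral_rV f.
Proof.
move=> df; rewrite /integral_rV RintegralZl//; exact: decaying_integrable.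
Qed.

Lemma integral_rVB n (f g : 'rV[R]_n -> R) : decaying f -> decaying g ->
  integral_rV (fun x => f x - g x) = integral_rV f - integral_rV g.
Proof.
move=> df dg; rewrite /integral_rV RintegralB//; exact: decaying_integrable.
Qed.

Lemma le_integral_rV n (f g : 'rV[R]_n -> R) : decaying f -> decaying g ->
  (forall x, f x <= g x) -> integral_rV f <= integral_rV g.
Proof.
move=> df dg fg; rewrite /integral_rV le_Rintegral//; exact: decaying_integrable.
Qed.

Lemma decaying_cauchyn n : decaying (@cauchyn n).
Proof.
split; first exact: cauchyn_continuous.
by exists 1 => x; rewrite mul1r ger0_norm// ltW// cauchyn_gt0.
Qed.

Lemma integral_cauchyn_ge0 n : 0 <= integral_rV (@cauchyn n).
Proof. by apply: Rintegral_ge0 => t _; rewrite ltW// cauchyn_gt0. Qed.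

Lemma norm_integral_rV n (f : 'rV[R]_n -> R) C : continuous f ->
  (forall x, `|f x| <= C * cauchyn x) ->
  `|integral_rV f| <= C * integral_rV (@cauchyn n).
Proof.
move=> cf HC; have df : decaying f by split => //; exists C.
rewrite -integral_rVZ; last exact: decaying_cauchyn.
have dC : decaying (fun x : 'rV[R]_n =>
  C * cauchyn x) by exact/decayingZ/decaying_cauchyn.
rewrite ler_norml; apply/andP; split; last first.
  by apply: le_integral_rV => // x; rewrite (le_trans _ (HC x))// ler_norm.
rewrite -mulN1r -integral_rVZ//.
apply: le_integral_rV => //; first exact: decayingZ.
by move=> x; rewrite mulN1r lerNl (le_trans _ (HC x))// ler_normr lexx orbT.
Qed.

(** On the box each factor [1 / (1 + x_i^2)] is at least [1 / (1 + r^2)]; the constant collects the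
    [n] coordinates. *)
Lemma supp_cauchyn n r M (f : 'rV[R]_n -> R) : supp_in r f ->
  (forall x, `|f x| <= M) -> forall x, `|f x| <= M * (1 + r ^+ 2) ^+ n * cauchyn x.
Proof.
move=> Hr HM x; have M0 : 0 <= M by exact: le_trans (normr_ge0 _) (HM x).
have r2 : 0 <= 1 + r ^+ 2 by rewrite addr_ge0// sqr_ge0.
have [xr|xr] := leP `|x| r; last first.
  by rewrite Hr// normr0 !mulr_ge0// ?exprn_ge0// ltW// cauchyn_gt0.
apply: le_trans (HM x) _; rewrite -mulrA ler_peMr//.
have -> : (1 + r ^+ 2) ^+ n = \prod_(i < n) (1 + r ^+ 2).
  by rewrite prodr_const card_ord.
rewrite /cauchyn -big_split /=.
have P1 : \prod_(i < n) (1 : R) = 1 by exact: big1.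
rewrite -[leLHS]P1; apply: ler_prod => i _; rewrite ler01 /=.
rewrite /cauchy1 ler_pdivlMr ?mul1r; last exact: lt_le_trans (oneDsqr_ge1 _).
rewrite lerD2l -(real_normK (num_real (x 0 i))) lerXn2r ?nnegrE//.
  exact: le_trans xr.
exact: le_trans (coord_le_norm x i) xr.
Qed.

Lemma supp_decaying n r (f : 'rV[R]_n -> R) : continuous f -> supp_in r f ->
  decaying f.
Proof.
move=> cf Hr; split => //; have [M M0 HM] := supp_bounded cf Hr.
by eexists; exact: supp_cauchyn Hr HM.
Qed.

Lemma test_decaying n (f : 'rV[R]_n -> R) : test f -> decaying f.
Proof.
by move=> /testP[sf [r r0 Hr]]; apply: supp_decaying Hr; exact: smooth_cont.
Qed.

End decaying_functions.

(** A quadratic remainder with one constant survives integration, which gives differentiation under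
    the integral sign; it also yields the derivative of [flat] at 0. *)
Lemma is_derive_quadratic {R : realType} (V : normedModType R) (f : V -> R) x v
  d (C : R) :
  (forall h : R, `|f (h *: v + x) - f x - h * d| <= C * h ^+ 2) ->
  is_derive x v f d.
Proof.
move=> H.
have C0 : 0 <= C by have := H 1; rewrite expr1n mulr1; exact: le_trans.
have L : (fun h : R => h^-1 *: (f (h *: v + x) - f x)) @ 0^' --> d.
  apply/cvgrPdist_lt => e e0.
  have C1 : 0 < C + 1 by rewrite ltr_wpDl.
  have : \forall h \near (0 : R)^', `|h| < e / (C + 1).
    by apply: dnbhs0_lt; rewrite divr_gt0.
  have : \forall h \near (0 : R)^', h != 0 by exact: nbhs_dnbhs_neq.
  apply: filterS2 => h /= h0 hb.
  have -> : d - h^-1 *: (f (h *: v + x) - f x) =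
      - (h^-1 * (f (h *: v + x) - f x - h * d)).
    by rewrite mulrBr mulrA mulVf// mul1r opprB.
  rewrite normrN normrM normfV ltr_pdivrMl ?normr_gt0//.
  apply: le_lt_trans (H h) _.
  rewrite -(real_normK (num_real h)) expr2 mulrA mulrC ltr_pM2l ?normr_gt0//.
  apply: (@le_lt_trans _ _ ((C + 1) * `|h|)); first by rewrite ler_wpM2r// lerDl.
  by rewrite mulrC -ltr_pdivlMr.
apply: DeriveDef; first by apply/cvg_ex; exists d.
exact: cvg_lim L.
Qed.

(** * Integration by parts *)

Section integral_of_derivatives.
Context {R : realType}.
Notation leb := (@lebesgue_measure R).

Lemma integral_derive_supp (g g' : R -> R) (r : R) : 0 <= r ->
  (forall t, is_derive t (1 : R) g (g' t)) -> continuous g' ->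
  (forall t, r < `|t| -> g t = 0) -> (forall t, r < `|t| -> g' t = 0) ->
  \int[leb]_t g' t = 0.
Proof.
move=> r0 dg cg' gr g'r.
(* The margin 1 puts both end points outside the support, where [g] vanishes. *)
have -> : g' = g' \_ `[- (r + 1), r + 1]%classic.
  apply/funext => t; rewrite patchE; case: ifPn => //.
  rewrite notin_setE /= in_itv /= -ler_norml => /negP; rewrite -ltNge => rt.
  by apply: g'r; apply: lt_trans rt; rewrite ltrDl.
rewrite -Rintegral_mkcond /Rintegral.
have cg : continuous g.
  by move=> t; apply: differentiable_continuous; apply/derivable1_diffP;
    have [] := dg t.
rewrite (@continuous_FTC2 _ g' g).
- have r1 : r < `|r + 1| by rewrite ger0_norm ?ltrDl// addr_ge0.
  by rewrite !gr ?normrN //= subrr.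
- by rewrite -subr_gt0 opprK addr_gt0// ltr_wpDl.
- exact: continuous_subspaceT.
- split; first by move=> t _; have [] := dg t.
    exact/cvg_at_right_filter/cg.
  exact/cvg_at_left_filter/cg.
- by move=> t _; rewrite derive1E; have [] := dg t.
Qed.

Lemma supp_row_mxr n p r (f : 'rV[R]_(n + p) -> R) x : supp_in r f ->
  supp_in r (fun xi => f (row_mx x xi)).
Proof. by move=> Hr xi xr; apply: Hr; apply: lt_le_trans xr (norm_row_mxr _ _). Qed.

Lemma test_row_mxr n p (f : 'rV[R]_(n + p) -> R) x : test f ->
  test (fun xi => f (row_mx x xi)).
Proof.
move=> /testP[sf [r r0 Hr]]; apply/testP; split; first exact: smooth_row_mxr.
by exists r => //; exact: supp_row_mxr.
Qed.

Lemma integral_rV0 n : integral_rV (fun _ : 'rV[R]_n => 0) = 0.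
Proof. by rewrite /integral_rV /Rintegral integral0. Qed.

(** Fubini lets the derivative be integrated in its own variable: by the fundamental theorem of
    calculus for the first coordinate, by induction on the dimension on each slice otherwise. *)
Lemma integral_partial n (f : 'rV[R]_n -> R) i : test f ->
  integral_rV (partial i f) = 0.
Proof.
elim: n f i => [f []//|n IH f i tf].
have dpf : decaying (partial i f) by exact/test_decaying/test_partial.
case: (unliftP ord0 i) => [j ij|i0].
  rewrite integral_rV_cons//.
  have H a : integral_rV (fun x => partial i f (rvcons a x)) = 0.
    rewrite ij (_ : lift ord0 j = rshift 1 j); last exact: val_inj.
    have := IH _ j (@test_row_mxr 1 n f a%:M tf).
    by rewrite (@partial_row_mxr _ 1 n f a%:M j (test_smooth tf)).
  under eq_Rintegral do rewrite H.
  by rewrite /Rintegral integral0.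
rewrite integral_rV_consr//.
have /testP[sf [r r0 Hr]] := tf.
have E a (x : 'rV[R]_n) : rvcons a x = a *: delta_mx 0 i + rvcons 0 x.
  apply/rowP => k; rewrite i0; rewrite [RHS]mxE [X in X + _]mxE [X in _ * X +
    _]mxE eqxx /=.
  case: (unliftP ord0 k) => [j ->|->]; first by rewrite !rvconsS mulr0 add0r.
  by rewrite !rvcons0 mulr1 addr0.
have H x : \int[leb]_a partial i f (rvcons a x) = 0.
  have rc a : `|a| <= `|rvcons a x|.
    by have := coord_le_norm (rvcons a x) ord0; rewrite rvcons0.
  apply: (@integral_derive_supp (fun a => f (rvcons a x)) _ r) => //.
  - move=> a; have := @is_derive_line _ _ f i (rvcons 0 x) a (fun=>
    smooth_derivable sf).
    rewrite -E; congr is_derive; by apply/funext => b; rewrite -E.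
  - move=> a; apply: continuous_comp; first exact: rvcons_continuous.
    exact/smooth_cont/smooth_partial.
  - by move=> a ra; apply: Hr; apply: lt_le_trans ra _.
  - by move=> a ra; apply: (supp_partial _ Hr); apply: lt_le_trans ra _.
under eq_fun do rewrite H.
exact: integral_rV0.
Qed.

Lemma integral_by_parts n (f g : 'rV[R]_n -> R) i : smooth f -> test g ->
  integral_rV (fun x => f x * partial i g x) =
  - integral_rV (fun x => partial i f x * g x).
Proof.
move=> sf tg; have /integral_partial := testM sf tg; move=> /(_ i).
rewrite partialM; [|exact: smooth_c0|exact/smooth_c0/test_smooth].
rewrite integral_rVD; last 2 first.
- by apply/test_decaying/testM => //; exact: test_partial.
- by apply/test_decaying/testM => //; exact: smooth_partial.
by move=> /eqP; rewrite addr_eq0 => /eqP.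
Qed.

(** The outermost letter is moved first, so the word reaches [f] reversed. *)
Lemma integral_by_parts_iter n (f g : 'rV[R]_n -> R) s : smooth f -> test g ->
  integral_rV (fun x => f x * partials s g x) =
  (-1) ^+ size s * integral_rV (fun x => partials (rev s) f x * g x).
Proof.
move=> sf tg; elim: s f sf => [|i s IH] f sf /=; first by rewrite mul1r.
rewrite integral_by_parts//; last exact: test_partials.
rewrite IH; last exact: smooth_partial.
by rewrite rev_cons partials_rcons exprS mulN1r mulNr.
Qed.

End integral_of_derivatives.

(** * Integration along the fibers of the lifting *)

Section partial_integration.
Context {R : realType} {n p : nat}.
Implicit Types phi : 'rV[R]_(n + p) -> R.

(* Adjoint of [u |-> u (x) 1]: testing the lift of [u] means applying [u] to this
   function. *)
Definition fiber_int phi (x : 'rV[R]_n) : R :=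
  integral_rV (fun xi : 'rV[R]_p => phi (row_mx x xi)).

Let K (r : R) := (1 + r ^+ 2) ^+ p * integral_rV (@cauchyn R p).

Lemma fiber_int_bound phi r M : continuous phi -> supp_in r phi ->
  (forall z, `|phi z| <= M) -> forall x, `|fiber_int phi x| <= M * K r.
Proof.
move=> cp Hr HM x; rewrite /K mulrA; apply: norm_integral_rV.
  move=> xi; apply: continuous_comp; last exact: cp.
  by apply: row_mx_continuous => y; [exact: cst_continuous|exact: cvg_id].
by apply: supp_cauchyn => //; exact: supp_row_mxr.
Qed.

Lemma fiber_intZD (a : R) phi psi : test phi -> test psi ->
  fiber_int (fun z => a * phi z + psi z) =
  fun x => a * fiber_int phi x + fiber_int psi x.
Proof.
move=> tp ts; apply/funext => x; rewrite /fiber_int integral_rVD.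
- by rewrite integral_rVZ//; exact/test_decaying/test_row_mxr.
- by apply: decayingZ; exact/test_decaying/test_row_mxr.
- exact/test_decaying/test_row_mxr.
Qed.

Lemma fiber_int0 : fiber_int (fun=> 0) = fun=> 0.
Proof. by apply/funext => x; exact: integral_rV0. Qed.

Lemma fiber_intN phi : test phi ->
  fiber_int (fun z => - phi z) = fun x => - fiber_int phi x.
Proof.
move=> tp; have := fiber_intZD (-1) tp (@test0 R (n + p)).
rewrite fiber_int0.
under eq_fun do rewrite mulN1r addr0.
move=> ->; apply/funext => x; by rewrite mulN1r addr0.
Qed.

Lemma fiber_int_sum (I : Type) (s : seq I) (F : I -> 'rV[R]_(n + p) -> R) :
  (forall i, test (F i)) ->
  fiber_int (fun z => \sum_(i <- s) F i z) =
  fun x => \sum_(i <- s) fiber_int (F i) x.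
Proof.
move=> tF; elim: s => [|i s IH].
  rewrite (_ : (fun z => _) = (fun=> 0)).
    by rewrite fiber_int0; apply/funext => x; rewrite big_nil.
  by apply/funext => z; rewrite big_nil.
rewrite (_ : (fun z => _) = (fun z => 1 * F i z + \sum_(i <- s) F i z)).
  rewrite fiber_intZD//; last exact: test_sum.
  by rewrite IH; apply/funext => x; rewrite mul1r big_cons.
by apply/funext => z; rewrite big_cons mul1r.
Qed.

(** The second-order Taylor bound is uniform in the fiber variable and the integrand lives in a
    fixed box, so integration leaves a quadratic remainder and no limit is exchanged with the
    integral. *)
Lemma is_derive_fiber_int phi i x : test phi ->
  is_derive x (delta_mx 0 i) (fiber_int phi)
    (fiber_int (partial (lshift p i) phi) x).
Proof.
move=> tp; have /testP[sp [r r0 Hr]] := tp.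
have [M M0 HM] := test_bounded (test_partial (lshift p i) (test_partial (lshift
  p i) tp)).
apply: (@is_derive_quadratic _ _ _ _ _ _ (M * K r)) => h.
pose e : 'rV[R]_(n + p) := delta_mx 0 (lshift p i).
pose A xi := phi (row_mx (h *: delta_mx 0 i + x) xi).
pose B xi := phi (row_mx x xi).
pose C xi := partial (lshift p i) phi (row_mx x xi).
have dA : decaying A by exact/test_decaying/test_row_mxr.
have dB : decaying B by exact/test_decaying/test_row_mxr.
have dC : decaying C by apply/test_decaying/test_row_mxr/test_partial.
have -> : fiber_int phi (h *: delta_mx 0 i + x) - fiber_int phi x -
    h * fiber_int (partial (lshift p i) phi) x =
    integral_rV (fun xi => A xi - B xi - h * C xi).
  rewrite integral_rVB; last 2 first.
  - rewrite (_ : (fun xi => _) = (fun xi => A xi + -1 * B xi)).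
      by apply: decayingD => //; exact: decayingZ.
    by apply/funext => xi; rewrite mulN1r.
  - exact: decayingZ.
  by rewrite integral_rVB// integral_rVZ.
have -> : M * K r * h ^+ 2 = (M * h ^+ 2) * (1 + r ^+ 2) ^+ p * integral_rV
  (@cauchyn R p).
  by rewrite /K; ring.
have cA : continuous A by case: dA.
have cB : continuous B by case: dB.
have cC : continuous C by case: dC.
apply: norm_integral_rV.
  move=> xi; apply: (@continuousB _ _ _ (fun xi => A xi - B xi) (fun xi =>
    h * C xi)).
    by apply: continuousB; [exact: cA|exact: cB].
  by apply: (@continuousM _ _ (fun=> h)); [exact: cst_continuous|exact: cC].
apply: supp_cauchyn => xi.
  move=> xr; rewrite /A /B /C; do 2 (rewrite (supp_row_mxr _ Hr)//).
  by rewrite (supp_row_mxr _ (supp_partial _ Hr))// mulr0 !subr0.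
rewrite /A /B /C row_mxl_step /= scale1r.
apply: taylor2_coord => // y; apply: smooth_derivable => //.
exact: smooth_partial.
Qed.

Lemma partial_fiber_int phi i : test phi ->
  partial i (fiber_int phi) = fiber_int (partial (lshift p i) phi).
Proof.
by move=> tp; apply/funext => x; have [] := is_derive_fiber_int i x tp.
Qed.

Lemma partials_fiber_int phi s : test phi ->
  partials s (fiber_int phi) = fiber_int (partials (map (lshift p) s) phi).
Proof.
move=> tp; elim: s => //= i s ->.
by rewrite partial_fiber_int//; exact: test_partials.
Qed.

Lemma supp_fiber_int phi r : supp_in r phi -> supp_in r (fiber_int phi).
Proof.
move=> Hr x xr; rewrite /fiber_int (_ : (fun xi => _) = (fun=> 0)).
  exact: integral_rV0.
by apply/funext => xi; apply: Hr; apply: lt_le_trans xr (norm_row_mxl _ _).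
Qed.

(** Continuity comes from bounded partial derivatives and the Lipschitz estimate. Higher orders
    follow by induction, each partial derivative being again a fiber integral of a test function. *)
Lemma test_fiber_int phi : test phi -> test (fiber_int phi).
Proof.
move=> tp; apply/testP; split; last first.
  by have /testP[sp [r r0 Hr]] := tp; exists r => //; exact: supp_fiber_int.
apply/smooth_ck => k.
have C0 psi : test psi -> c0 (fiber_int psi).
  move=> ts; have /testP[ss [r r0 Hr]] := ts.
  split=> [|i x]; last by have [] := is_derive_fiber_int i x ts.
  have /choice[M HM] (i : 'I_n) :
      exists M, forall x, `|partial i (fiber_int psi) x| <= M.
    have [M _ HM] := test_bounded (test_partial (lshift p i) ts).
    exists (M * K r) => x; rewrite partial_fiber_int//.
    apply: fiber_int_bound => //; last exact: supp_partial.
    exact/smooth_cont/smooth_partial.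
  have M0 i : 0 <= M i by exact: le_trans (normr_ge0 _) (HM i 0).
  apply: (@lipschitz_continuous _ _ _ (n%:R * \sum_i M i)).
  apply: lipschitz_partial.
  - by apply: sumr_ge0 => i _.
  - by move=> i y; have [] := is_derive_fiber_int i y ts.
  - move=> i y; apply: le_trans (HM i y) _.
    by rewrite (bigD1 i)//= lerDl; apply: sumr_ge0 => j _.
elim: k phi tp => [|k IH] phi tp; first exact: C0.
split; first exact: C0.
by move=> i; rewrite partial_fiber_int//; apply: IH; exact: test_partial.
Qed.

Lemma fiber_int_partialr phi j : test phi ->
  fiber_int (partial (rshift n j) phi) = fun=> 0.
Proof.
move=> tp; apply/funext => x; have := integral_partial j (test_row_mxr x tp).
by rewrite partial_row_mxr//; exact: test_smooth.
Qed.

Lemma fiber_intMl (a : 'rV[R]_n -> R) phi : test phi ->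
  fiber_int (fun z => a (lsubmx z) * phi z) = fun x => a x * fiber_int phi x.
Proof.
move=> tp; apply/funext => x; rewrite /fiber_int -integral_rVZ.
  by congr integral_rV; apply/funext => xi; rewrite row_mxKl.
exact/test_decaying/test_row_mxr.
Qed.

Lemma fiber_int_tensor (f : 'rV[R]_n -> R) (g : 'rV[R]_p -> R) : decaying g ->
  fiber_int (tensor f g) = fun x => f x * integral_rV g.
Proof.
move=> dg; apply/funext => x; rewrite /fiber_int -integral_rVZ//.
by congr integral_rV; apply/funext => xi; rewrite /tensor row_mxKl row_mxKr.
Qed.

(** In divergence form the fiber part is a sum of derivatives in the [xi] variables, which integrate
    to zero even though [W] depends on [xi]. The base coefficients do not depend on [xi] and leave
    the integral. *)
Lemma fiber_int_vstar (V : vfield R n) (Vt : vfield R (n + p)) (W : 'rV[R]_(n +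
  p) -> 'rV[R]_p) phi :
  smooth_map Vt -> (forall z, Vt z = row_mx (V (lsubmx z)) (W z)) -> test phi ->
  fiber_int (vstar Vt phi) = vstar V (fiber_int phi).
Proof.
move=> sV VE tp; rewrite /vstar.
pose F k := partial k (fun y => Vt y 0 k * phi y).
have tF k : test (F k) by apply/test_partial/testM => //; exact: sV.
rewrite (fiber_intN (test_sum _ _ tF)) (fiber_int_sum _ tF).
apply/funext => x; congr (- _); rewrite big_split_ord /= [X in _ + X]big1 ?addr0.
  apply: eq_bigr => i _; rewrite /F -partial_fiber_int;
    last by apply: testM => //; exact: sV.
  congr (partial i _ x); rewrite -fiber_intMl//.
  by congr fiber_int; apply/funext => z; rewrite VE row_mxEl.
by move=> j _; rewrite /F fiber_int_partialr//; apply: testM => //; exact: sV.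
Qed.

End partial_integration.

(** Fubini for the splitting into base and fiber, removing one base coordinate at a time; with none
    left, the base measure is the point mass at the empty tuple. *)
Lemma integral_rV_fiber {R : realType} n p (phi : 'rV[R]_(n + p) -> R) : test phi ->
  integral_rV phi = integral_rV (fiber_int phi).
Proof.
elim: n phi => [|n IH] phi tp.
  rewrite [RHS]/integral_rV /Rintegral /= integral_dirac//=; last first.
    have cf : continuous (@fiber_int R 0 p phi).
      exact/smooth_cont/test_smooth/test_fiber_int.
    by apply/measurable_EFinP; exact: (continuous_measurable_rV cf).
  rewrite indicT /= /fiber_int mul1r; congr integral_rV; apply/funext => x.
  congr phi; apply/rowP => i; rewrite mxE; case: splitP => [[]//|k ik].
  by congr (x 0 _); exact: val_inj.
have D : @decaying R (1 + (n + p)) phi by exact: test_decaying.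
have D' : @decaying R (1 + n) (@fiber_int R n.+1 p phi).
  exact/test_decaying/test_fiber_int.
rewrite (integral_rV_cons D) (integral_rV_cons D').
apply: eq_Rintegral => a _.
have ta : test (fun z : 'rV[R]_(n + p) =>
  phi (rvcons a z)) by exact: (@test_row_mxr R 1).
rewrite IH//; congr integral_rV; apply/funext => x; rewrite /fiber_int.
congr integral_rV; apply/funext => xi; congr phi.
apply/rowP => i; case: (unliftP ord0 i) => [j ->|->].
  rewrite rvconsS; case: (splitP j) => k jk.
    rewrite (_ : j = lshift p k); last exact: val_inj.
    rewrite row_mxEl (_ : lift ord0 (lshift p k) = @lshift n.+1 p (lift ord0
      k)); last exact: val_inj.
    by rewrite row_mxEl rvconsS.
  rewrite (_ : j = rshift n k); last exact: val_inj.
  rewrite row_mxEr (_ : lift ord0 (rshift n k) = @rshift n.+1 p k);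
    last exact: val_inj.
  by rewrite row_mxEr.
rewrite rvcons0 (_ : ord0 = @lshift n.+1 p ord0); last exact: val_inj.
by rewrite row_mxEl rvcons0.
Qed.

(** * Bump functions *)

Section flat_functions.
Context {R : realType}.
Implicit Types q : {poly R}.

(** Induction on the degree: half of the exponent absorbs the new factor [s], by
    [a / 2 * s <= expR (a / 2 * s)], and the other half absorbs the polynomial of lower degree. *)
Lemma poly_le_expR q (a : R) : 0 < a ->
  exists2 C, 0 <= C & forall s, 0 <= s -> `|q.[s]| <= C * expR (a * s).
Proof.
elim/poly_ind: q a => [|q c IH] a a0.
  by exists 0 => // s _; rewrite horner0 normr0 mul0r.
have a2 : 0 < a / 2 by rewrite divr_gt0.
have [C C0 HC] := IH _ a2.
exists (C * (a / 2)^-1 + `|c|) => [|s s0].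
  by rewrite addr_ge0// mulr_ge0// invr_ge0 ltW.
rewrite hornerMXaddC mulrDl (le_trans (ler_normD _ _))//.
have e1 : 1 <= expR (a * s) by rewrite -expR0 ler_expR mulr_ge0// ltW.
apply: lerD; last by rewrite ler_peMr.
have -> : a * s = a / 2 * s + a / 2 * s by rewrite -mulrDl -splitr.
rewrite expRD normrM (ger0_norm s0).
have -> : C / (a / 2) * (expR (a / 2 * s) * expR (a / 2 * s)) =
  (C * expR (a / 2 * s)) * ((a / 2)^-1 * expR (a / 2 * s)) by ring.
apply: ler_pM => //; first exact: HC.
rewrite mulrC ler_pdivlMr// mulrC.
by apply: le_trans (expR_ge1Dx _); rewrite lerDr.
Qed.

(* The family [q(1/t) exp(-1/t)] is closed under differentiation, which makes
   [exp(-1/t)] smooth at [0]. *)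
Definition flat q (t : R) : R :=
  if 0 < t then q.[t^-1] * expR (- t^-1) else 0.

(** Chain rule with [s = 1/t]: [ds/dt = - s^2], and [q(s) exp(-s)] has derivative
    [(q' - q)(s) exp(-s)] in [s]. *)
Definition flat_deriv q : {poly R} := 'X^2 * (q - q^`()).

(** Quadratic decay gives the derivative 0 at the origin. It comes from the exponential bound on
    [s^2 |q(s)|] with [s = 1/t]. *)
Lemma flat_quadratic q : exists C : R, forall t, `|flat q t| <= C * t ^+ 2.
Proof.
have [C C0 HC] := @poly_le_expR ('X^2 * q) 1 ltr01.
exists C => t; rewrite /flat; case: ifPn => [t0|_]; last first.
  by rewrite normr0 mulr_ge0// sqr_ge0.
have ti : 0 < t^-1 by rewrite invr_gt0.
have := HC _ (ltW ti); rewrite hornerM hornerXn mul1r normrM => H.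
rewrite normrM (ger0_norm (expR_ge0 _)) expRN ler_pdivrMr ?expR_gt0//.
rewrite -(ler_pM2l (exprn_gt0 2 ti)).
rewrite (ger0_norm (ltW (exprn_gt0 2 ti))) in H.
apply: le_trans H _.
have -> : t^-1 ^+ 2 * (C * t ^+ 2 * expR t^-1) = (t^-1 * t) ^+ 2 * (C * expR
  t^-1) by ring.
by rewrite mulVf ?gt_eqF// expr1n mul1r.
Qed.

Lemma is_derive_flat q t : is_derive t (1 : R) (flat q) (flat (flat_deriv q) t).
Proof.
have [t0|t0|t0] := ltgtP 0 t.
- have tn : t != 0 by rewrite gt_eqF.
  pose g := fun u : R => q.[u^-1] * expR (- u^-1).
  have dg : is_derive t (1 : R) g (flat (flat_deriv q) t).
    rewrite /flat t0 /flat_deriv hornerM hornerXn hornerD hornerN.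
    have di : is_derive t (1 : R) (fun u : R => u^-1) (- t^-1 ^+ 2).
      have di1 : derivable (@id R) t 1 by exact: derivable_id.
      apply: DeriveDef; first exact: (@derivableV _ _ id t 1 tn di1).
      rewrite (@deriveV _ _ id t 1 tn di1) derive_id -[_ *: 1]/(_ * 1) mulr1.
      by rewrite exprVn.
    have dq : is_derive t (1 : R) (fun u : R =>
      q.[u^-1]) (q^`().[t^-1] * - t^-1 ^+ 2).
      exact: (@is_derive1_comp _ (horner q) (fun u =>
        u^-1) t _ _ (is_derive_poly q _) di).
    have de : is_derive t (1 : R) (fun u : R =>
      expR (- u^-1)) (expR (- t^-1) * (- - t^-1 ^+ 2)).
      have dn : is_derive t (1 : R) (fun u : R => - u^-1) (- - t^-1 ^+ 2).
        have [d1 d2] := @is_deriveN _ _ _ (fun u : R => u^-1) t 1 _ di.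
        by apply: DeriveDef; [exact: d1|rewrite -d2].
      exact: (@is_derive1_comp _ expR _ t _ _ (is_derive_expR _) dn).
    have := is_deriveM dq de.
    move=> [d1 d2]; apply: DeriveDef => //; rewrite d2 /GRing.scale /=; ring.
  apply: near_eq_is_derive dg.
  have : nbhs t [set u : R | 0 < u] by exact: lt_nbhsr.
  by apply: filterS => u u0; rewrite /flat /= u0.
- rewrite [X in is_derive _ _ _ X](_ : _ = 0); last by rewrite /flat ltNge (ltW t0).
  have dc : is_derive t (1 : R) (cst (0 : R)) 0 by exact: is_derive_cst.
  apply: near_eq_is_derive dc.
  have : nbhs t [set u : R | u < 0] by exact: lt_nbhsl.
  by apply: filterS => u u0; rewrite /flat ltNge (ltW u0).
- rewrite -t0 [X in is_derive _ _ _ X](_ : _ = 0); last by rewrite /flat ltxx.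
  have [C HC] := flat_quadratic q.
  apply: (@is_derive_quadratic _ _ _ _ _ _ C) => h.
  rewrite mulr0 subr0 addr0 -[h *: 1]/(h * 1) mulr1 [X in _ - X](_ : _ = 0)
    ?subr0//.
  by rewrite /flat ltxx.
Qed.

Lemma flat_continuous q : continuous (flat q).
Proof.
move=> t; apply: differentiable_continuous; apply/derivable1_diffP.
by have [] := is_derive_flat q t.
Qed.

Lemma smooth_flat n q (a b : R) (i : 'I_n) :
  smooth (fun x : 'rV[R]_n => flat q (a + b * x 0 i)).
Proof.
have D r (x : 'rV[R]_n) j : is_derive x (delta_mx 0 j)
    (fun x : 'rV[R]_n => flat r (a + b * x 0 i))
    (if j == i then b * flat (flat_deriv r) (a + b * x 0 i) else 0).
  apply/is_derive_dirP.
  have [->|ji] := eqVneq j i.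
    have E (h : R) : a + b * (h *: delta_mx 0 i + x : 'rV[R]_n) 0 i = (a + b * x
      0 i) + b * h.
      by rewrite !mxE !eqxx mulr1; ring.
    under [X in is_derive _ _ X _]funext do rewrite E.
    have dl : is_derive (0 : R) (1 : R) (fun h : R => a + b * x 0 i + b * h) b.
      rewrite [X in is_derive _ _ X _](_ : _ = cst (a + b * x 0 i) + b *: (@id
        R)); last first.
        by apply/funext.
      by apply: is_derive_eq; rewrite add0r -[b *: 1]/(b * 1) mulr1.
    have := @is_derive1_comp _ (flat r) _ 0 _ _ (is_derive_flat r (a + b * x 0 i
      + b * 0)) dl.
    by rewrite mulr0 addr0 [X in is_derive _ _ _ X]mulrC.
  have E (h : R) : a + b * (h *: delta_mx 0 j + x : 'rV[R]_n) 0 i = a + b * x 0 i.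
    by rewrite !mxE eqxx eq_sym (negbTE ji) mulr0 add0r.
  under [X in is_derive _ _ X _]funext do rewrite E.
  exact: is_derive_cst.
have C0 r : c0 (fun x : 'rV[R]_n => flat r (a + b * x 0 i)).
  split=> [x|j x]; last by have [] := D r x j.
  apply: (@continuous_comp _ _ _ (fun x : 'rV[R]_n => a + b * x 0 i) (flat r));
    last exact: flat_continuous.
  apply: (@continuousD _ _ _ (fun=> a) (fun x : 'rV[R]_n => b * x 0 i));
    first exact: cst_continuous.
  apply: (@continuousM _ _ (fun=> b) (fun x : 'rV[R]_n => x 0 i));
    first exact: cst_continuous.
  exact: coord_continuous.
apply/smooth_ck => k; elim: k q => [|k IH] q; first exact: C0.
split; first exact: C0.
move=> j; have [ji|ji] := eqVneq j i.
  rewrite (_ : partial j _ = fun x => b * flat (flat_deriv q) (a + b * x 0 i)).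
    by apply: (@ckM _ _ k (fun=> b)); [exact: ck_cst|exact: IH].
  by apply/funext => x; rewrite /partial; have /@derive_val := D q x j;
    rewrite ji eqxx.
rewrite (_ : partial j _ = fun=> 0); first exact: ck_cst.
by apply/funext => x; rewrite /partial; have /@derive_val := D q x j;
  rewrite (negbTE ji).
Qed.

Lemma flat1_ge0 t : 0 <= flat 1 t.
Proof. by rewrite /flat; case: ifP => // _; rewrite hornerE mul1r expR_ge0. Qed.

Lemma flat1_gt0 t : 0 < t -> 0 < flat 1 t.
Proof. by rewrite /flat => ->; rewrite hornerE mul1r expR_gt0. Qed.

Lemma flat_le0 q t : t <= 0 -> flat q t = 0.
Proof. by rewrite /flat leNgt => /negbTE ->. Qed.

Lemma le_flat1 s t : 0 < s -> s <= t -> flat 1 s <= flat 1 t.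
Proof.
move=> s0 st; have t0 := lt_le_trans s0 st.
by rewrite /flat s0 t0 !hornerE ?mul1r ler_expR lerN2 lef_pV2.
Qed.

End flat_functions.

(** * Bumps with prescribed center and radius *)

Section bump_functions.
Context {R : realType}.
Notation leb := (@lebesgue_measure R).

(** Positive for [|t - c| < e] and zero elsewhere. The factors 1 and -1 give the arguments the
    affine form that [smooth_flat] expects. *)
Definition bump1 (c e t : R) : R :=
  flat 1 ((e - c) + 1 * t) * flat 1 ((e + c) + (-1) * t).

Lemma bump1_ge0 c e t : 0 <= bump1 c e t.
Proof. by rewrite mulr_ge0// flat1_ge0. Qed.

Lemma bump1_supp c e t : e <= `|t - c| -> bump1 c e t = 0.
Proof.
rewrite /bump1 ler_normr => /orP[H|H].
  by rewrite [X in _ * X]flat_le0 ?mulr0//; lra.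
by rewrite flat_le0 ?mul0r//; lra.
Qed.

Lemma bump1_continuous c e : continuous (bump1 c e).
Proof.
move=> t; apply: (@continuousM R R (fun t : R =>
  flat 1 ((e - c) + 1 * t)) (fun t : R => flat 1 ((e + c) + (-1) * t))).
  apply: (@continuous_comp R R R (fun t => (e - c) + 1 * t) (flat 1));
    last exact: flat_continuous.
  apply: (@continuousD _ _ R (fun=> e - c)); first exact: cst_continuous.
  by apply: (@continuousM R R (fun=> 1)); [exact: cst_continuous|exact: cvg_id].
apply: (@continuous_comp R R R (fun t => (e + c) + (-1) * t) (flat 1));
  last exact: flat_continuous.
apply: (@continuousD _ _ R (fun=> e + c)); first exact: cst_continuous.
by apply: (@continuousM R R (fun=> -1)); [exact: cst_continuous|exact: cvg_id].
Qed.

(** The product of [g] with [1 + t^2] is continuous with bounded support, hence bounded; it is read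
    as a function on ['rV_1] to reuse [supp_bounded]. *)
Lemma cc1_cauchy (g : R -> R) (r : R) : continuous g -> (forall t,
  r < `|t| -> g t = 0) ->
  exists2 C, 0 <= C & forall t, `|g t| <= C * cauchy1 t.
Proof.
move=> cg gr.
pose G (x : 'rV[R]_1) := g (x 0 0) * oneDsqr (x 0 0).
have cG : continuous G.
  move=> x; apply: (@continuousM _ _ (fun x : 'rV[R]_1 =>
    g (x 0 0)) (fun x : 'rV[R]_1 => oneDsqr (x 0 0))).
    apply: (@continuous_comp _ _ _ (fun x : 'rV[R]_1 => x 0 0) g); last exact: cg.
    exact: coord_continuous.
  apply: (@continuous_comp _ _ _ (fun x : 'rV[R]_1 => x 0 0) oneDsqr).
    exact: coord_continuous.
  exact: continuous_oneDsqr.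
have sG : supp_in r G.
  move=> x xr; rewrite /G gr ?mul0r//.
  case: (leP 0 r) => r0; last exact: lt_le_trans r0 _.
  by have [i] := norm_gt_coord r0 xr; rewrite (ord1 i).
have [C C0 HC] := supp_bounded cG sG.
exists C => // t.
have := HC (t%:M); rewrite /G mxE eqxx mulr1n normrM => H.
have o1 : 0 < oneDsqr t by exact: lt_le_trans (oneDsqr_ge1 _).
by rewrite /cauchy1 ler_pdivlMr// -{1}(ger0_norm (ltW o1)).
Qed.

Lemma bump1_cauchy c e : exists2 C, 0 <= C & forall t,
  `|bump1 c e t| <= C * cauchy1 t.
Proof.
apply: (@cc1_cauchy _ (`|e| + `|c|)); first exact: bump1_continuous.
move=> t H; apply: bump1_supp.
have := ler_normD (t - c) c; rewrite subrK => H2.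
have := ler_norm e; lra.
Qed.

(** On the middle interval, of length [e], both factors are at least [flat 1 (e / 2)]. *)
Lemma bump1_integral_gt0 c e : 0 < e -> 0 < \int[leb]_t bump1 c e t.
Proof.
move=> e0; have [C C0 HC] := bump1_cauchy c e.
have ib : leb.-integrable setT (EFin \o bump1 c e).
  have := integrableZl measurableT C (@cauchy1_integrable R).
  apply: le_integrable => //.
    by apply/measurable_EFinP; apply: continuous_measurable_fun;
      exact: bump1_continuous.
  by move=> t _; rewrite /= lee_fin (le_trans (HC _))// ler_norm.
pose D : set (measurableTypeR R) := `[c - e / 2, c + e / 2]%classic.
have mD : measurable D by exact: measurable_itv.
pose m := flat 1 (e / 2) ^+ 2.
have m0 : 0 < m by rewrite exprn_gt0// flat1_gt0// divr_gt0.
have lD : leb D = e%:E.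
  rewrite /D lebesgue_measure_itv /= lte_fin ifT; last lra.
  by rewrite -EFinD; congr (_%:E); lra.
have H1 : \int[leb]_(t in D) m = m * e.
  by rewrite Rintegral_cst// [X in fine X](_ : _ = e%:E)//; exact: lD.
apply: (@lt_le_trans _ _ (m * e)); first by rewrite mulr_gt0.
rewrite -H1; apply: (@le_trans _ _ (\int[leb]_(t in D) bump1 c e t)).
  apply: le_Rintegral => //.
  - have : leb.-integrable D (EFin \o cst m).
      apply: measurable_bounded_integrable => //.
        by have := ltry e; rewrite -lD.
      by exists m; split; rewrite ?num_real// => y my t _; rewrite /= ger0_norm ltW.
    by [].
  - by apply: integrableS ib.
  - move=> t; rewrite /D /= in_itv /= => /andP[t1 t2].
    rewrite /m expr2 /bump1 ler_pM ?flat1_ge0//; apply: le_flat1;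
      rewrite ?divr_gt0//; lra.
rewrite Rintegral_mkcond; apply: le_Rintegral => //.
  have iD : leb.-integrable D (EFin \o bump1 c e) by apply: integrableS ib.
  by have := (integrable_mkcond _ mD).1 iD; rewrite restrict_EFin.
by move=> t _; rewrite patchE; case: ifP => // _; exact: bump1_ge0.
Qed.

Lemma integral_rV_prod n (g : 'I_n -> R -> R) :
  (forall i, continuous (g i)) ->
  (forall i, exists2 C, 0 <= C & forall t, `|g i t| <= C * cauchy1 t) ->
  integral_rV (fun x : 'rV[R]_n => \prod_(i < n) g i (x 0 i)) =
  \prod_(i < n) \int[leb]_t g i t.
Proof.
elim: n g => [|n IH] g cg Hg.
  rewrite big_ord0 (_ : (fun x => _) = (fun=> 1)); last by apply/funext => x;
    rewrite big_ord0.
  by rewrite /integral_rV Rintegral_cst// mul1r /= indicT.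
have dg : @decaying R (1 + n) (fun x => \prod_(i < n.+1) g i (x 0 i)).
  split.
    elim: (index_enum _) => [|i r IHr] x.
      rewrite (_ : (fun x => _) = (fun=> 1)); first exact: cst_continuous.
      by apply/funext => y; rewrite big_nil.
    rewrite (_ : (fun x => _) = (fun x : 'rV[R]_n.+1 =>
      g i (x 0 i) * \prod_(j <- r) g j (x 0 j))); last first.
      by apply/funext => y; rewrite big_cons.
    apply: (@continuousM _ _ (fun x : 'rV[R]_n.+1 => g i (x 0 i))); last exact: IHr.
    apply: (@continuous_comp _ _ _ (fun x : 'rV[R]_n.+1 => x 0 i) (g i));
      last exact: cg.
    exact: coord_continuous.
  have /choice[C HC] (i : 'I_n.+1) : exists C, forall t, `|g i t| <= C * cauchy1 t.
    by have [C _ HC] := Hg i; exists C.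
  exists (\prod_i C i) => x; rewrite normr_prod /cauchyn -big_split /=.
  by apply: ler_prod => i _; rewrite normr_ge0 /=; exact: HC.
rewrite integral_rV_cons// big_ord_recl /=.
have E a : integral_rV (fun x : 'rV[R]_n => \prod_(i < n.+1) g i (rvcons a x 0 i)) =
    g ord0 a * \prod_(i < n) \int[leb]_t g (lift ord0 i) t.
  rewrite -(IH (fun i => g (lift ord0 i)))//.
  rewrite (_ : (fun x => _) = (fun x : 'rV[R]_n =>
    g ord0 a * \prod_(i < n) g (lift ord0 i) (x 0 i))); last first.
    apply/funext => x; rewrite big_ord_recl rvcons0; congr (_ * _).
    by apply: eq_bigr => i _; rewrite rvconsS.
  (* The remaining product is shown to be decaying by dividing a slice by [g ord0 a]; if that number
     is 0, both sides vanish. *)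
  have [Z|Z] := eqVneq (g ord0 a) 0.
    by rewrite Z mul0r (_ : (fun x => _) = (fun=> 0)) ?integral_rV0//;
      apply/funext => x; rewrite mul0r.
  rewrite integral_rVZ//.
  have := decayingZ (g ord0 a)^-1 (decaying_slice a dg).
  rewrite (_ : (fun x => _) = (fun x : 'rV[R]_n =>
    \prod_(i < n) g (lift ord0 i) (x 0 i)))//.
  apply/funext => x; rewrite big_ord_recl rvcons0 mulrA mulVf// mul1r.
  by apply: eq_bigr => i _; rewrite rvconsS.
under eq_Rintegral do rewrite E.
rewrite RintegralZr//.
have [C C0 HC] := Hg ord0.
have := integrableZl measurableT C (@cauchy1_integrable R).
apply: le_integrable => //.
  by apply/measurable_EFinP; apply: continuous_measurable_fun; exact: cg.
by move=> t _; rewrite /= lee_fin (le_trans (HC _))// ler_norm.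
Qed.

Variable n : nat.

Definition bump (c : 'rV[R]_n) (e : R) (x : 'rV[R]_n) : R :=
  \prod_(i < n) bump1 (c 0 i) e (x 0 i).

Lemma smooth_bump c e : smooth (bump c e).
Proof.
by apply: smooth_prod => i; apply: smoothM; exact: smooth_flat.
Qed.

Lemma bump_ge0 c e x : 0 <= bump c e x.
Proof. by apply: prodr_ge0 => i _; exact: bump1_ge0. Qed.

Lemma bump_supp c e x : 0 <= e -> e < `|x - c| -> bump c e x = 0.
Proof.
move=> e0 ex; have [i ei] := norm_gt_coord e0 ex.
rewrite /bump (bigD1 i)//= bump1_supp ?mul0r//.
by move: ei; rewrite !mxE; exact: ltW.
Qed.

Lemma bump_integral_gt0 c e : 0 < e -> 0 < integral_rV (bump c e).
Proof.
move=> e0; rewrite (@integral_rV_prod _ (fun i => bump1 (c 0 i) e)) => [|i|i].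
- by apply: prodr_gt0 => i _; exact: bump1_integral_gt0.
- exact: bump1_continuous.
- exact: bump1_cauchy.
Qed.

End bump_functions.

(** * Normalised test functions and uniqueness of densities *)

Section mollifiers.
Context {R : realType}.

Lemma supp_bump n (c : 'rV[R]_n) e : 0 <= e -> supp_in (`|c| + e) (bump c e).
Proof.
move=> e0 x xr; apply: bump_supp => //.
by rewrite -(ltrD2l `|c|) (lt_le_trans xr)// addrC; have := ler_normD (x - c) c;
  rewrite subrK.
Qed.

Lemma test_bump n (c : 'rV[R]_n) e : 0 <= e -> test (bump c e).
Proof.
move=> e0; apply/testP; split; first exact: smooth_bump.
by exists (`|c| + e); [rewrite addr_ge0|exact: supp_bump].
Qed.

Lemma bump_center_gt0 n (c : 'rV[R]_n) e : 0 < e -> 0 < bump c e c.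
Proof.
move=> e0; apply: prodr_gt0 => i _; rewrite /bump1 mul1r mulN1r subrK addrK.
by rewrite mulr_gt0// flat1_gt0.
Qed.

(** Such a [chi] is a profile in the fiber variables: tensoring with it is a right inverse of
    [fiber_int]. *)
Lemma unit_mass_test n : exists2 chi : 'rV[R]_n -> R,
  test chi & integral_rV chi = 1.
Proof.
have I0 := bump_integral_gt0 (0 : 'rV[R]_n) ltr01.
exists (fun x => (integral_rV (bump (0 : 'rV[R]_n) 1))^-1 * bump 0 1 x).
  by apply: testZ; exact: test_bump.
rewrite integral_rVZ ?mulVf// ?gt_eqF//.
by apply: test_decaying; exact: test_bump.
Qed.

Lemma unit_center_test n : exists2 chi : 'rV[R]_n -> R, test chi & chi 0 = 1.
Proof.
have b0 := bump_center_gt0 (0 : 'rV[R]_n) ltr01.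
exists (fun x => (bump (0 : 'rV[R]_n) 1 0)^-1 * bump 0 1 x).
  by apply: testZ; exact: test_bump.
by rewrite mulVf// gt_eqF.
Qed.

(** If [g c] exceeded [M], then [g] would exceed [M] by half of that excess near [c], and a bump
    supported there would violate the inequality. *)
Lemma le_of_test_integrals n (g : 'rV[R]_n -> R) (M : R) : continuous g ->
  (forall psi, test psi -> (forall x, 0 <= psi x) ->
    integral_rV (fun x => g x * psi x) <= M * integral_rV psi) ->
  forall x, g x <= M.
Proof.
move=> cg H c; rewrite leNgt; apply/negP => Mg.
pose d := (g c - M) / 2.
have d0 : 0 < d by rewrite divr_gt0// subr_gt0.
have : nbhs c [set x | M + d < g x].
  apply: (cg c [set t : R | M + d < t]).
  by apply: lt_nbhsr; rewrite /d; lra.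
move=> /nbhs_ballP[e /= e0 eH].
have e2 : 0 < e / 2 by rewrite divr_gt0.
pose psi := bump c (e / 2).
have tp : test psi by apply: test_bump; exact: ltW.
have p0 x : 0 <= psi x by exact: bump_ge0.
have I0 : 0 < integral_rV psi by exact: bump_integral_gt0.
have := H psi tp p0; apply/negP; rewrite -ltNge.
apply: (@lt_le_trans _ _ ((M + d) * integral_rV psi)).
  by rewrite ltr_pM2r// ltrDl.
have dp := test_decaying tp.
rewrite -integral_rVZ//; apply: le_integral_rV.
- exact: decayingZ.
- have /testP[sp [r r0 Hr]] := tp.
  apply: (@supp_decaying _ _ r); last by move=> x xr; rewrite Hr// mulr0.
  by move=> x; apply: continuousM; [exact: cg|exact: smooth_cont].
move=> x; have [xe|xe] := ltP (e / 2) `|x - c|.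
  by rewrite /psi bump_supp ?mulr0// ltW.
apply: ler_wpM2r => //; apply: ltW; apply: eH.
rewrite -ball_normE /ball_ /= distrC; apply: le_lt_trans xe _; lra.
Qed.

Lemma du_bois_reymond n (g : 'rV[R]_n -> R) : continuous g ->
  (forall psi, test psi -> integral_rV (fun x => g x * psi x) = 0) ->
  forall x, g x = 0.
Proof.
move=> cg H x; apply/eqP; rewrite eq_le; apply/andP; split.
  by apply: (le_of_test_integrals cg) => psi tp _; rewrite H// mul0r.
rewrite -oppr_le0; have cN : continuous (fun x => - g x).
  by move=> y; apply: continuousN; exact: cg.
apply: (le_of_test_integrals cN) => psi tp p0; rewrite mul0r.
have dgp : decaying (fun x => g x * psi x).
  have /testP[sp [r r0 Hr]] := tp.
  apply: (@supp_decaying _ _ r); last by move=> y yr; rewrite Hr// mulr0.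
  by move=> y; apply: continuousM; [exact: cg|exact: smooth_cont].
rewrite (_ : (fun x => _) = (fun x => -1 * (g x * psi x))).
  by rewrite integral_rVZ// H// mulr0.
by apply/funext => y; rewrite mulN1r mulNr.
Qed.

End mollifiers.

(** * Polynomial functions *)

Section polynomial_functions.
Import (canonicals) mpoly.
Context {R : realType} {n : nat}.
Implicit Types (m : 'I_n -> nat) (l : seq (R * ('I_n -> nat))) (x : 'rV[R]_n).

Definition mono m x : R := \prod_(i < n) x 0 i ^+ m i.

(** With a list of coefficients and exponents, primitives are a map and restrictions to coordinate
    subspaces a filter. The passage to [mpoly] happens once, in [polyfun_mpoly]. *)
Definition polysum l x : R := \sum_(cm <- l) cm.1 * mono cm.2 x.

Definition polyfun (f : 'rV[R]_n -> R) := exists l, forall x, f x = polysum l x.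

Lemma polyfun_cst (a : R) : polyfun (fun=> a).
Proof.
exists [:: (a, fun=> 0%N)] => x; rewrite /polysum big_seq1 /mono big1 ?mulr1//.
Qed.

Lemma polyfunD f g : polyfun f -> polyfun g -> polyfun (fun x => f x + g x).
Proof.
move=> [l Hl] [k Hk]; exists (l ++ k) => x.
by rewrite /polysum big_cat Hl Hk.
Qed.

Lemma polyfunN f : polyfun f -> polyfun (fun x => - f x).
Proof.
move=> [l Hl]; exists [seq (- cm.1, cm.2) | cm <- l] => x.
rewrite Hl /polysum big_map -sumrN; apply: eq_bigr => cm _ /=.
by rewrite mulNr.
Qed.

Definition masked (b : pred 'I_n) x : 'rV[R]_n := \row_i (if b i then x 0 i else 0).

Lemma mono_masked b m x :
  mono m (masked b x) = if [forall i, b i || (m i == 0%N)] then mono m x else 0.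
Proof.
case: forallP => [H|/forallP].
  apply: eq_bigr => i _; rewrite mxE; have := H i.
  by case: (b i) => //= /eqP ->; rewrite !expr0.
rewrite negb_forall => /existsP[i]; rewrite negb_or => /andP[bi mi].
by rewrite /mono (bigD1 i)//= mxE (negbTE bi) expr0n (negbTE mi) mul0r.
Qed.

Lemma polyfun_masked b f : polyfun f -> polyfun (fun x => f (masked b x)).
Proof.
move=> [l Hl].
exists [seq cm <- l | [forall i, b i || (cm.2 i == 0%N)]] => x.
rewrite Hl /polysum big_filter [RHS]big_mkcond; apply: eq_bigr => cm _.
by rewrite mono_masked; case: ifP => // _; rewrite mulr0.
Qed.

Lemma is_derive_mono m i x :
  is_derive x (delta_mx 0 i) (mono (fun j => ((i == j) + m j)%N))
    ((m i).+1%:R * mono m x).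
Proof.
apply/is_derive_dirP.
pose c := \prod_(j < n | j != i) x 0 j ^+ m j.
have E (h : R) : mono (fun j => ((i == j) + m j)%N) (h *: delta_mx 0 i + x) =
    c * (h + x 0 i) ^+ (m i).+1.
  rewrite /mono (bigD1 i)//= mulrC; congr (_ * _).
    apply: eq_bigr => j ji; rewrite !mxE eqxx (negbTE ji) /= mulr0 add0r.
    by rewrite eq_sym (negbTE ji).
  by rewrite !mxE !eqxx mulr1.
under [X in is_derive _ _ X _]funext do rewrite E.
have dl : is_derive (0 : R) (1 : R) (fun h : R => h + x 0 i) 1.
  have := is_deriveD (is_derive_id (0 : R) (1 : R)) (is_derive_cst (x 0 i) (0 :
    R) (1 : R)).
  by rewrite addr0.
have dX := is_deriveX (m i).+1 dl.
have -> : (fun h : R => c * (h + x 0 i) ^+ (m i).+1) =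
    c *: (fun h : R => h + x 0 i) ^+ (m i).+1.
  by apply/funext => h; rewrite /GRing.scale /= exprfctE.
have [d1 d2] := is_deriveZ c dX.
apply: DeriveDef; first exact: d1.
rewrite d2.
rewrite /GRing.scale /= add0r mulr1 /mono (bigD1 i)//= -/c.
by rewrite -mulr_natl; ring.
Qed.

Lemma is_derive_polysum l (F : R * ('I_n -> nat) -> 'rV[R]_n -> R) (F' : R *
  ('I_n -> nat) -> R) x v :
  (forall cm, is_derive x v (F cm) (F' cm)) ->
  is_derive x v (fun y => \sum_(cm <- l) F cm y) (\sum_(cm <- l) F' cm).
Proof.
move=> H; elim: l => [|cm l IH].
  rewrite big_nil (_ : (fun y => _) = cst 0); first exact: is_derive_cst.
  by apply/funext => y; rewrite big_nil.
rewrite big_cons (_ : (fun y => _) = (F cm + (fun y => \sum_(cm <- l) F cm y))).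
  exact: is_deriveD.
by apply/funext => y; rewrite big_cons.
Qed.

Lemma polyfun_primitive f i : polyfun f ->
  exists2 F, polyfun F & forall x, is_derive x (delta_mx 0 i) F (f x).
Proof.
move=> [l Hl].
pose G (cm : R * ('I_n -> nat)) :=
  (cm.1 / (cm.2 i).+1%:R, fun j => ((i == j) + cm.2 j)%N).
exists (polysum (map G l)); first by exists (map G l).
move=> x; rewrite Hl /polysum.
under [X in is_derive _ _ X _]funext do rewrite big_map.
apply: is_derive_polysum => cm /=.
have [d1 d2] := is_deriveZ (cm.1 / (cm.2 i).+1%:R) (is_derive_mono cm.2 i x).
apply: DeriveDef; first exact: d1.
rewrite [LHS](_ : _ = 'D_(delta_mx 0 i) ((cm.1 /
  (cm.2 i).+1%:R) *: mono (fun j => ((i == j) + cm.2 j)%N)) x)// d2.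
by rewrite /GRing.scale /= mulrA mulfVK// pnatr_eq0.
Qed.

(** A staircase from 0 to [x] switches on one coordinate at a time. On each stair [g] and a
    polynomial primitive of its partial derivative have the same derivative, so [g] changes by a
    difference of polynomial functions. *)
Lemma polyfun_of_partials g :
  (forall i x, derivable g x (delta_mx 0 i)) ->
  (forall i, polyfun (partial i g)) -> polyfun g.
Proof.
move=> dg pg.
pose r k := masked (fun i => (i < k)%N).
have r0 x : r 0%N x = 0 by apply/rowP => i; rewrite !mxE.
have rn x : r n x = x by apply/rowP => i; rewrite !mxE ltn_ord.
have rS k (kn : (k < n)%N) x :
    r k.+1 x = (x 0 (Ordinal kn)) *: delta_mx 0 (Ordinal kn) + r k x.
  apply/rowP => i; rewrite !mxE /=; case: (eqVneq i (Ordinal kn)) => [->|ik] /=.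
    by rewrite ltnS leqnn ltnn mulr1 addr0.
  rewrite mulr0 add0r ltnS leq_eqVlt.
  suff /negbTE -> : (i != k :> nat) by [].
  by apply: contraNN ik => /eqP ik; apply/eqP/val_inj.
suff H k : (k <= n)%N -> polyfun (fun x => g (r k x)).
  by have [l Hl] := H n (leqnn n); exists l => x; rewrite -Hl rn.
elim: k => [_|k IH kn].
  by have [l Hl] := polyfun_cst (g 0); exists l => x; rewrite r0 -(Hl x).
pose i := Ordinal kn.
have [A pA dA] := polyfun_primitive i (pg i).
have E x : g (r k.+1 x) = g (r k x) + (A (r k.+1 x) - A (r k x)).
  have dAl t : is_derive t (1 : R) (fun h : R => A (h *: delta_mx 0 i + r k x))
      (partial i g (t *: delta_mx 0 i + r k x)).
    have eA y : derivable A y (delta_mx 0 i) by case: (dA y).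
    have := @is_derive_line _ _ A i (r k x) t eA.
    by rewrite [partial i A _](_ : _ = partial i g (t *: delta_mx 0 i + r k
      x))//; case: (dA (t *: delta_mx 0 i + r k x)).
  have dgl t := @is_derive_line _ _ g i (r k x) t (dg i).
  have d0 (t : R) : is_derive t (1 : R) ((fun h : R =>
    g (h *: delta_mx 0 i + r k x)) -
      (fun h : R => A (h *: delta_mx 0 i + r k x))) 0.
    by have := is_deriveB (dgl t) (dAl t); rewrite subrr.
  have := @is_derive_0_is_cst _ _ (x 0 i) 0 d0.
  rewrite /= !fctE scale0r add0r -rS => H.
  move: H; lra.
have [l Hl] := polyfunD (IH (ltnW kn)) (polyfunD (polyfun_masked (fun i =>
  (i < k.+1)%N) pA)
  (polyfunN (polyfun_masked (fun i => (i < k)%N) pA))).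
by exists l => x; rewrite -Hl E.
Qed.

Lemma polyfun_of_vanishing_partials K g : smooth g ->
  (forall s x, size s = K -> partials s g x = 0) -> polyfun g.
Proof.
elim: K g => [|K IH] g sg H.
  have [l Hl] := polyfun_cst 0; exists l => x.
  by rewrite -(Hl x); exact: (H [::]).
apply: polyfun_of_partials => [i x|i]; first exact: smooth_derivable.
apply: IH => [|s x sK]; first exact: smooth_partial.
by rewrite -partials_rcons; apply: H; rewrite size_rcons sK.
Qed.

Lemma polyfun_mpoly f : polyfun f -> exists P, forall x, f x = mpoly_fun P x.
Proof.
move=> [l Hl]; elim: l f Hl => [|[c m] l IH] f Hl.
  exists 0 => x; rewrite Hl /polysum big_nil /mpoly_fun.
  by rewrite mpoly.meval0.
have [P HP] := IH _ (fun x => erefl).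
exists (c *: (\prod_(i < n) mpoly.mpolyX R (mpoly.mnm1 i) ^+ m i) + P) => x.
rewrite Hl /polysum big_cons [X in _ + X]HP /mpoly_fun mpoly.mevalD mpoly.mevalZ /=.
congr (_ * _ + _); rewrite /mono rmorph_prod /=; apply: eq_bigr => i _.
by rewrite rmorphXn /= mpoly.mevalXU.
Qed.

(** Decay of [q * 'X + c] forces decay of [q], so [q = 0] by induction, and a constant that decays
    is 0. *)
Lemma poly_decay0 (q : {poly R}) (C : R) :
  (forall t, 1 <= t -> `|q.[t]| <= C / t) -> q = 0.
Proof.
elim/poly_ind: q C => [//|q c IH] C H.
have q0 : q = 0.
  apply: (IH (`|C| + `|c|)) => t t1; have t0 : 0 < t by exact: lt_le_trans t1.
  rewrite ler_pdivlMr// -[X in _ * X](ger0_norm (ltW t0)) -normrM.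
  have -> : q.[t] * t = (q * 'X + c%:P).[t] - c by rewrite hornerMXaddC addrK.
  apply: le_trans (ler_normB _ _) _; rewrite lerD2r.
  apply: le_trans (H t t1) _; rewrite ler_pdivrMr//.
  apply: le_trans (ler_norm C) _; by rewrite ler_peMr.
rewrite q0 mul0r add0r; congr (_%:P); apply/eqP; rewrite -normr_le0 leNgt.
apply/negP => c0.
have C1 : 0 < `|C| + `|c| by rewrite ltr_wpDl.
(* At this point [|c| * t] is [2 * (|C| + |c|)], which exceeds [C]. *)
pose t := (`|C| + `|c|) / `|c| * 2.
have t1 : 1 <= t.
  rewrite /t -ler_pdivrMr// mul1r ler_pdivlMr// mulrC.
  have := normr_ge0 C; lra.
have t0 : 0 < t by exact: lt_le_trans t1.
have := H t t1; rewrite q0 mul0r add0r hornerC ler_pdivlMr// /t.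
have -> : `|c| * ((`|C| + `|c|) / `|c| * 2) = (`|C| + `|c|) * 2.
  by field; rewrite gt_eqF.
have := ler_norm C; have := normr_ge0 C; lra.
Qed.

Lemma poly_bounded_const (q : {poly R}) (M : R) :
  (forall t, `|q.[t]| <= M) -> forall t, q.[t] = q.[0].
Proof.
elim/poly_ind: q => [_ t|q c _ H t]; first by rewrite !horner0.
suff -> : q = 0 by rewrite mul0r add0r !hornerC.
apply: (@poly_decay0 _ (M + `|c|)) => u u1.
have u0 : 0 < u by exact: lt_le_trans u1.
rewrite ler_pdivlMr// -[X in _ * X](ger0_norm (ltW u0)) -normrM.
have -> : q.[u] * u = (q * 'X + c%:P).[u] - c by rewrite hornerMXaddC addrK.
by apply: le_trans (ler_normB _ _) _; rewrite lerD2r.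
Qed.

(** On the line through 0 and [x] the function is a bounded polynomial in one variable, so its
    values at 1 and 0 agree. *)
Lemma polyfun_bounded_const f (M : R) : polyfun f -> (forall x, `|f x| <= M) ->
  forall x, f x = f 0.
Proof.
move=> [l Hl] HM x.
pose q : {poly R} := \sum_(cm <- l) (cm.1 * mono cm.2 x) *: 'X^(\sum_i cm.2 i).
have qE t : q.[t] = f (t *: x).
  rewrite Hl /q /polysum horner_sum; apply: eq_bigr => cm _.
  rewrite hornerZ hornerXn -mulrA; congr (_ * _).
  rewrite /mono -prodrXr -big_split /=; apply: eq_bigr => i _.
  by rewrite mxE exprMn mulrC.
have := @poly_bounded_const q M (fun t => _) 1.
by rewrite !qE scale1r scale0r; apply => t; rewrite qE.
Qed.

End polynomial_functions.

(** * Gliding hump and series of functionals *)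

Section gliding_hump.
Context {R : realType}.
Variables (T : nat -> nat -> R) (l : nat -> nat).

(* The sign of the [k]-th term is chosen so that it cannot cancel the part of the
   [k]-th row already built; the ratio [3^-1] keeps the later terms too small to
   undo this. *)
Fixpoint hump_seq (k : nat) : seq R :=
  if k is k'.+1 then
    let s := hump_seq k' in
    let y := \sum_(i < k') s`_i * T k' (l i) in
    rcons s ((if 0 <= y * T k' (l k') then 1 else -1) * 3^-1 ^+ k')
  else [::].

Definition hump (k : nat) : R := (hump_seq k.+1)`_k.

Lemma size_hump_seq k : size (hump_seq k) = k.
Proof. by elim: k => //= k IH; rewrite size_rcons IH. Qed.

Lemma nth_hump_seq m k : (k < m)%N -> (hump_seq m)`_k = hump k.
Proof.
elim: m => // m IH; rewrite ltnS leq_eqVlt => /predU1P[->//|km].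
by rewrite /= nth_rcons size_hump_seq km IH.
Qed.

Lemma humpE k : hump k =
  (if 0 <= (\sum_(i < k) hump i * T k (l i)) * T k (l k) then 1 else -1) * 3^-1
    ^+ k.
Proof.
rewrite {1}/hump /= nth_rcons size_hump_seq ltnn eqxx.
by under eq_bigr do rewrite nth_hump_seq//.
Qed.

Lemma norm_hump k : `|hump k| = 3^-1 ^+ k.
Proof.
rewrite humpE normrM (ger0_norm (exprn_ge0 _ _)) ?invr_ge0//.
by case: ifP => _; rewrite ?normrN normr1 mul1r.
Qed.

(** By the choice of sign the new term never opposes the sum before it, so the total is at least as
    large as the new term. *)
Lemma hump_step k :
  3^-1 ^+ k * `|T k (l k)| <= `|\sum_(i < k.+1) hump i * T k (l i)|.
Proof.
rewrite big_ord_recr /= [hump k]humpE.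
set y := \sum_(i < k) _; set t := T k (l k).
set e := 3^-1 ^+ k; have e0 : 0 <= e by rewrite exprn_ge0// invr_ge0.
have A (u w : R) : 0 <= u * w -> `|w| <= `|u + w|.
  have [w0|w0|<-] := ltgtP 0 w => H; last by rewrite normr0.
    have u0 : 0 <= u by rewrite -(pmulr_lge0 u w0).
    by rewrite !ger0_norm ?addr_ge0 ?lerDr// ltW.
  have u0 : u <= 0 by rewrite -(nmulr_lge0 u w0).
  by rewrite !ler0_norm; lra.
case: ifPn => [yt|]; rewrite ?mul1r ?mulN1r ?mulNr.
  have -> : e * `|t| = `|e * t| by rewrite normrM ger0_norm.
  by apply: A; rewrite mulrCA mulr_ge0.
rewrite -ltNge => yt; have -> : e * `|t| = `|- (e * t)| by rewrite normrN normrM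
  ger0_norm.
by apply: A; rewrite mulrN mulrCA -mulrN mulr_ge0// oppr_ge0 ltW.
Qed.

Hypothesis almost_max : forall j k, `|T j k| <= 10 / 9 * `|T j (l j)|.

(** Relative to the [j]-th term, all later ones amount to at most [10/9 * (1/3 + 1/9 + ...) = 5/9],
    so 4/9 survive. The summand with [j + d] is the part of these 5/9 not yet spent after [d]
    further terms. *)
Lemma hump_tail j d : `|T j (l j)| * (4 / 9 * 3^-1 ^+ j + 5 /
  9 * 3^-1 ^+ (j + d)) <=
  `|\sum_(i < (j + d).+1) hump i * T j (l i)|.
Proof.
elim: d => [|d IH].
  rewrite addn0; apply: le_trans (hump_step j); rewrite -mulrDl mulrC.
  by rewrite (_ : 4 / 9 + 5 / 9 = 1 :> R) ?mul1r//; lra.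
rewrite addnS big_ord_recr /=; set y := \sum_(i < _) _ in IH *.
set z := hump _ * _.
have zb : `|z| <= 3^-1 ^+ (j + d).+1 * (10 / 9 * `|T j (l j)|).
  by rewrite normrM norm_hump ler_wpM2l// exprn_ge0// invr_ge0.
have := ler_normB (y + z) z; rewrite addrK.
rewrite exprS in zb *.
move: IH zb; set t := `|T j (l j)|; set p := 3^-1 ^+ (j + d); set q := 3^-1 ^+ j.
have -> : t * (4 / 9 * q + 5 / 9 * (3^-1 * p)) = t * (4 / 9 * q + 5 /
  9 * p) - 3^-1 * p * (10 / 9 * t).
  by field.
lra.
Qed.

End gliding_hump.

(** The bound [B j] gives row [j] a supremum, which column [l j] nearly attains. The constant is
    [2/5 = 4/9 * 9/10]: the fraction that survives the tail, times the loss in comparing [T j (l j)]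
    with the large entry of the row. *)
Lemma gliding_hump {R : realType} (T : nat -> nat -> R) (B : nat -> R) (c : R) :
  0 < c -> (forall j k, `|T j k| <= B j) ->
  (forall j, exists k, c * 4 ^+ j <= `|T j k|) ->
  exists (a : nat -> R) (l : nat -> nat), (forall k, `|a k| <= 3^-1 ^+ k) /\
    forall j K, (j < K)%N ->
      2 / 5 * c * (4 / 3) ^+ j <= `|\sum_(i < K) a i * T j (l i)|.
Proof.
move=> c0 HB Hc.
have /choice[l Hl] j : exists lj, forall k, `|T j k| <= 10 / 9 * `|T j lj|.
  have [k0 Hk0] := Hc j.
  pose S : set R := range (fun k => `|T j k|).
  have hS : has_sup S.
    split; first by exists `|T j k0|; exists k0.
    by exists (B j) => _ [k _ <-].
  have s0 : 0 < sup S.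
    apply: (@lt_le_trans _ _ (c * 4 ^+ j)); first by rewrite mulr_gt0// exprn_gt0.
    by apply: le_trans Hk0 _; apply: sup_upper_bound => //; exists k0.
  (* An entry above 9/10 of the supremum yields the factor [10 / 9]. *)
  have [_ [lj _ <-] Hlj] := @sup_adherent _ S (sup S /
    10) (divr_gt0 s0 (ltr0Sn _ 9)) hS.
  exists lj => k; have : `|T j k| <= sup S by apply: sup_upper_bound => //;
    exists k.
  move: Hlj; lra.
exists (hump T l), l; split=> [k|j K jK]; first by rewrite norm_hump.
have [d ->] : exists d, K = (j + d).+1.
  by exists (K - j.+1)%N; rewrite -addSn subnKC.
apply: le_trans (hump_tail Hl j d).
have [k0 Hk0] := Hc j; have Hj := Hl j k0.
have q0 : 0 < 3^-1 ^+ j :> R by rewrite exprn_gt0// invr_gt0.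
have p0 : 0 < 3^-1 ^+ (j + d) :> R by rewrite exprn_gt0// invr_gt0.
have t0 : 0 <= `|T j (l j)| by [].
rewrite expr_div_n -exprVn.
apply: (@le_trans _ _ (`|T j (l j)| * (4 / 9 * 3^-1 ^+ j))); last first.
  by rewrite ler_wpM2l// lerDl mulr_ge0// ltW.
rewrite !mulrA ler_pM2r//.
have -> : 2 / 5 * c * 4 ^+ j = 2 / 5 * (c * 4 ^+ j) by rewrite mulrA.
lra.
Qed.

(** * Schwartz seminorms *)

Section seminorms.
Context {R : realType} {n : nat}.
Implicit Types phi psi : 'rV[R]_n -> R.

Definition seminorm_le k phi (M : R) := forall s : seq 'I_n, (size s <= k)%N ->
  forall x, (1 + `|x|) ^+ k * `|partials s phi x| <= M.

Lemma uniform_bound_partials (w : 'rV[R]_n -> R) k phi :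
  (forall s, exists M : R, forall x, w x * `|partials s phi x| <= M) ->
  exists M : R, forall s, (size s <= k)%N -> forall x,
    w x * `|partials s phi x| <= M.
Proof.
elim: k phi => [|k IH] phi H.
  by have [M HM] := H [::]; exists M => -[].
have [M0 HM0] := H [::].
have /choice[M HM] (i : 'I_n) : exists M : R, forall s, (size s <= k)%N ->
    forall x, w x * `|partials s (partial i phi) x| <= M.
  by apply: IH => s; have [M HM] := H (rcons s i); exists M => x;
    rewrite -partials_rcons.
exists (`|M0| + \sum_i `|M i|) => s; case/lastP: s => [_ x|s i].
  apply: le_trans (HM0 x) _; apply: le_trans (ler_norm _) _.
  by rewrite lerDl sumr_ge0.
rewrite size_rcons ltnS => sk x; rewrite partials_rcons.
apply: le_trans (HM i s sk x) _; apply: le_trans (ler_norm _) _.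
rewrite (bigD1 i)//= addrCA lerDl addr_ge0// sumr_ge0//.
Qed.

Lemma schwartz_seminorm k phi : schwartz phi -> exists M, seminorm_le k phi M.
Proof. by move=> [_ H]; apply: uniform_bound_partials => s; exact: H. Qed.

Lemma seminorm_ge0 k phi M : seminorm_le k phi M -> 0 <= M.
Proof.
move=> /(_ [::] (leq0n _) 0); apply: le_trans.
by rewrite mulr_ge0// exprn_ge0// addr_ge0.
Qed.

(** Each derivative at most doubles the number of products: a crude Leibniz rule. It is stated at
    one point, so that [a] and [b] may depend on [x]. *)
Lemma partials_mul_bound (f g : 'rV[R]_n -> R) k x (a b : R) :
  smooth f -> smooth g -> 0 <= a -> 0 <= b ->
  (forall s, (size s <= k)%N -> `|partials s f x| <= a) ->
  (forall s, (size s <= k)%N -> `|partials s g x| <= b) ->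
  forall s, (size s <= k)%N -> `|partials s (fun y =>
    f y * g y) x| <= 2 ^+ size s * (a * b).
Proof.
move=> + + a0 b0.
elim: k f g => [|k IH] f g sf sg Hf Hg s; case/lastP: s => [_|s i] //=.
- by rewrite expr0 mul1r normrM ler_pM// ?(Hf [::])// (Hg [::]).
- by rewrite size_rcons.
- by rewrite expr0 mul1r normrM ler_pM// ?(Hf [::])// (Hg [::]).
rewrite size_rcons ltnS => sk; rewrite partials_rcons.
have sf' := smooth_partial i sf; have sg' := smooth_partial i sg.
rewrite partialM; [|exact: smooth_c0|exact: smooth_c0].
rewrite partialsD; [|exact: smoothM|exact: smoothM].
apply: le_trans (ler_normD _ _) _.
have -> : 2 ^+ (size s).+1 * (a * b) = 2 ^+ size s * (a * b) + 2 ^+ size s * (a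
  * b).
  by rewrite exprS; ring.
apply: lerD.
  apply: IH => // [t tk|t tk]; first by apply: Hf; exact: leqW.
  by rewrite -partials_rcons; apply: Hg; rewrite size_rcons.
apply: IH => // [t tk|t tk]; last by apply: Hg; exact: leqW.
by rewrite -partials_rcons; apply: Hf; rewrite size_rcons.
Qed.

End seminorms.

(** * Absolutely convergent series of functionals *)

Section functionals.
Context {R : realType} {n : nat}.
Notation F := ('rV[R]_n -> R).
Implicit Types (u v : F -> R) (phi psi : F).

Definition test_linear u := forall (a : R) phi psi, test phi -> test psi ->
  u (fun x => a * phi x + psi x) = a * u phi + u psi.

Definition seminorm_bounded k (C : R) u := forall phi M, test phi ->
  seminorm_le k phi M -> `|u phi| <= C * M.

Lemma test_linear0 u : test_linear u -> u (fun=> 0) = 0.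
Proof.
move=> lu; have := lu 1 _ _ (@test0 R n) (@test0 R n).
rewrite (_ : (fun x : 'rV[R]_n => 1 * 0 + 0) = (fun=> 0 : R)); last first.
  by apply/funext => x; rewrite mul1r addr0.
lra.
Qed.

Lemma test_linearZ u a phi : test_linear u -> test phi ->
  u (fun x => a * phi x) = a * u phi.
Proof.
move=> lu tp; have := lu a _ _ tp (@test0 R n); rewrite test_linear0// addr0 => <-.
by congr u; apply/funext => x; rewrite addr0.
Qed.

Lemma op_distE m (nu : 'I_m -> nat) d c (X : 'I_m -> vfield R n) u phi :
  op_dist nu d c X u phi =
  \sum_(k < d.+1) \sum_(I : k.-tuple 'I_m | weight nu I == d) c I * u (wstar X I
    phi).
Proof.
by apply: eq_bigr => k _; apply: eq_bigr => I _; rewrite word_distE.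
Qed.

Variables (u : nat -> F -> R) (K0 : nat) (C : R).
Hypothesis C0 : 0 <= C.
Hypothesis lin_u : forall k, test_linear (u k).
Hypothesis bd_u : forall k, seminorm_bounded K0 (C * 3^-1 ^+ k) (u k).

Definition series_fun phi : R := limn (series (fun k => u k phi)).

Lemma series_fun_cvg phi : test phi ->
  series (fun k => u k phi) @ \oo --> series_fun phi.
Proof.
move=> tp; suff : cvgn (series (fun k => u k phi)) by [].
have [M HM] := schwartz_seminorm K0 (test_schwartz tp).
have M0 := seminorm_ge0 HM.
apply: normed_cvg; apply: (@series_le_cvg _ _ (geometric (C * M) 3^-1)) => //=.
- by move=> k; rewrite !mulr_ge0// exprn_ge0// invr_ge0.
- by move=> k; have := bd_u k tp HM; rewrite mulrAC.
- by apply: is_cvg_geometric_series; rewrite ger0_norm ?invr_ge0// invf_lt1// ltr1n.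
Qed.

Lemma series_fun_linear : test_linear series_fun.
Proof.
move=> a phi psi tp ts.
apply: (@cvg_lim _ (@Rhausdorff R)).
have -> : series (fun k => u k (fun x => a * phi x + psi x)) =
    (fun K => a * series (fun k => u k phi) K + series (fun k => u k psi) K).
  apply/funext => K; rewrite /series /= mulr_sumr -big_split /=.
  by apply: eq_bigr => k _; rewrite lin_u.
apply: cvgD; last exact: series_fun_cvg.
by apply: cvgMl_tmp; exact: series_fun_cvg.
Qed.

Lemma series_fun_bounded : seminorm_bounded K0 (2 * C) series_fun.
Proof.
move=> phi M tp HM; have M0 := seminorm_ge0 HM.
have S K : `|series (fun k => u k phi) K| <= 2 * C * M.
  apply: le_trans (ler_norm_sum _ _ _) _.
  (* The induction needs the exact sum [3 / 2 * (1 - 3^-1 ^+ K)] of the first [K] powers of 1/3;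
     only afterwards is [3 / 2] rounded up to 2. *)
  apply: (@le_trans _ _ (3 / 2 * C * M * (1 - 3^-1 ^+ K))); last first.
    rewrite (_ : 2 * C * M = 2 * (C * M)); last by rewrite mulrA.
    rewrite (_ : 3 / 2 * C * M * _ = 3 / 2 * (C * M) * (1 - 3^-1 ^+ K));
      last by rewrite mulrA.
    have CM : 0 <= C * M by exact: mulr_ge0.
    have q0 : 0 <= 3^-1 ^+ K :> R by rewrite exprn_ge0// invr_ge0.
    have := mulr_ge0 CM q0; lra.
  elim: K => [|K IH]; first by rewrite big_nil expr0 subrr mulr0.
  rewrite big_nat_recr//=.
  have := bd_u K tp HM; rewrite exprS; move: IH; set p := 3^-1 ^+ K.
  have -> : 3 / 2 * C * M * (1 - 3^-1 * p) = 3 /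
    2 * C * M * (1 - p) + C * p * M by field.
  exact: lerD.
have cn : `|series (fun k => u k phi) K| @[K --> \oo] --> `|series_fun phi|.
  by apply: cvg_norm; exact: series_fun_cvg.
rewrite -(cvg_lim (@Rhausdorff R) cn); apply: limr_le; first by apply/cvg_ex;
  exists `|series_fun phi|.
by near=> K; exact: S.
Unshelve. all: by end_near. Qed.

Lemma series_fun_ge phi (B : R) (j : nat) : test phi ->
  (forall K, (j < K)%N -> B <= `|\sum_(k < K) u k phi|) -> B <= `|series_fun phi|.
Proof.
move=> tp H; have cn : `|series (fun k =>
  u k phi) K| @[K --> \oo] --> `|series_fun phi|.
  by apply: cvg_norm; exact: series_fun_cvg.
rewrite -(cvg_lim (@Rhausdorff R) cn); apply: limr_ge; first by apply/cvg_ex;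
  exists `|series_fun phi|.
near=> K; rewrite /series /= big_mkord; apply: H.
by near: K; exact: nbhs_infty_gt.
Unshelve. all: by end_near. Qed.

(** The operator is a finite combination of values at transposed words, so it commutes with the
    limit. *)
Lemma op_dist_series_fun m (nu : 'I_m -> nat) d c (X : 'I_m -> vfield R n) phi :
  (forall i, smooth_map (X i)) -> test phi ->
  (forall k, op_dist nu d c X (u k) phi = 0) ->
  op_dist nu d c X series_fun phi = 0.
Proof.
move=> sX tp H; rewrite op_distE.
have cvgs : (fun K => \sum_(k < d.+1) \sum_(I : k.-tuple 'I_m | weight nu I == d)
    c I * series (fun k => u k (wstar X I phi)) K) @ \oo -->
    \sum_(k < d.+1) \sum_(I : k.-tuple 'I_m | weight nu I == d) c I * series_fun
      (wstar X I phi).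
  apply: (@cvg_big _ _ _ _ _ add_continuous) => k _.
  apply: (@cvg_big _ _ _ _ _ add_continuous) => I _.
  by apply: cvgMl_tmp; apply: series_fun_cvg; exact: test_wstar.
rewrite -(cvg_lim (@Rhausdorff R) cvgs); apply: (@cvg_lim _ (@Rhausdorff R)).
rewrite (_ : (fun K => _) = (fun=> 0)); first exact: cvg_cst.
apply/funext => K; rewrite /series /=.
under eq_bigr do under eq_bigr do rewrite mulr_sumr.
under eq_bigr do rewrite exchange_big.
rewrite exchange_big /= big1// => k _.
by have := H k; rewrite op_distE.
Qed.

End functionals.

(** * Homogeneity and lifting *)

Section scaling.
Context {R : realType} {n : nat} (sigma : 'I_n -> nat).
Implicit Types (u : ('rV[R]_n -> R) -> R) (phi : 'rV[R]_n -> R) (lam : R).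

Definition scale_dist lam u phi : R := u (fun x => phi (dilation sigma lam^-1 x)).

Lemma scale_dist_linear lam u : 0 < lam -> test_linear u ->
  test_linear (scale_dist lam u).
Proof.
move=> l0 lu a phi psi tp ts; rewrite /scale_dist lu//; apply: test_dilation => //;
  by rewrite invr_gt0.
Qed.

(** For [lam >= 1] each derivative of the rescaled test function brings a factor at most 1. The
    whole cost is in the weight: [1 + |x|] grows at most by [lam ^+ (\sum_i sigma i)], and this is
    raised to the power [k]. *)
Lemma scale_dist_bounded lam u k C : 1 <= lam -> seminorm_bounded k C u ->
  seminorm_bounded k (C * lam ^+ ((\sum_i sigma i) * k)) (scale_dist lam u).
Proof.
move=> l1 bu phi M tp HM; have l0 : 0 < lam by exact: lt_le_trans l1.
have li0 : 0 <= lam^-1 by rewrite invr_ge0 ltW.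
rewrite -mulrA; apply: bu; first by apply: test_dilation; rewrite ?invr_gt0.
move=> s sk x; rewrite partials_dilation; last exact: test_smooth.
set y := dilation sigma lam^-1 x.
have xy : x = dilation sigma lam y by rewrite /y dilationK// gt_eqF.
have L1 : 1 <= lam ^+ (\sum_i sigma i) by exact: exprn_ege1.
have nx : 1 + `|x| <= lam ^+ (\sum_i sigma i) * (1 + `|y|).
  by rewrite mulrDr mulr1 lerD// {1}xy norm_dilation_le.
rewrite normrM (ger0_norm (exprn_ge0 _ li0)).
apply: (@le_trans _ _ ((lam ^+ (\sum_i sigma i) * (1 + `|y|)) ^+ k * `|partials
  s phi y|)).
  apply: ler_pM.
  - by rewrite exprn_ge0// addr_ge0.
  - by rewrite mulr_ge0 ?exprn_ge0.
  - rewrite lerXn2r// nnegrE ?addr_ge0// mulr_ge0 ?addr_ge0// (le_trans _ L1)//.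
  - by rewrite ler_piMl// exprn_ile1// invf_le1.
rewrite exprMn exprM -mulrA ler_wpM2l// ?exprn_ge0 ?exprn_ge0 ?(ltW l0)//.
exact: HM.
Qed.

(** The two dilations cancel and leave the weight of the word as exponent, to be compared with the
    exponent in [scale_dist_bounded]. *)
Lemma scale_dist_partials lam u s phi : 0 < lam -> test_linear u -> test phi ->
  scale_dist lam u (partials s (fun x => phi (dilation sigma lam x))) =
  lam ^+ (\sum_(i <- s) sigma i) * u (partials s phi).
Proof.
move=> l0 lu tp; rewrite /scale_dist partials_dilation; last exact: test_smooth.
rewrite -test_linearZ//; last exact: test_partials.
by congr u; apply/funext => x; rewrite dilationK// gt_eqF.
Qed.

Lemma is_derive_coord (i j : 'I_n) (x : 'rV[R]_n) :
  is_derive x (delta_mx 0 i) (fun y : 'rV[R]_n => y 0 j) (i == j)%:R.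
Proof.
apply/is_derive_dirP.
have -> : (fun h : R => (h *: delta_mx 0 i + x) 0 j) = ((i == j)%:R *: @id R +
  cst (x 0 j)).
  by apply/funext => h; rewrite !mxE eqxx /= /GRing.scale /= !fctE mulrC eq_sym.
by apply: is_derive_eq; rewrite addr0 -[_ *: 1]/(_ * 1) mulr1.
Qed.

Lemma smooth_coord (j : 'I_n) : smooth (fun x : 'rV[R]_n => x 0 j).
Proof.
have C0 : c0 (fun x : 'rV[R]_n => x 0 j).
  split=> [x|i x]; first exact: coord_continuous.
  by have [] := is_derive_coord i j x.
apply/smooth_ck => -[//|k]; split => // i.
rewrite (_ : partial i _ = fun=> (i == j)%:R); first exact: ck_cst.
by apply/funext => x; have [] := is_derive_coord i j x.
Qed.

(** Homogeneity is given as an identity on functions; the coordinate function [x_j] turns it into a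
    scaling law for the [j]-th coefficient. *)
Lemma homogeneous_coef (V : vfield R n) k lam x j : 0 < lam ->
  vf_homogeneous sigma k V ->
  V x 0 j * lam ^+ sigma j = lam ^+ k * V (dilation sigma lam x) 0 j.
Proof.
move=> l0 /(_ lam l0 _ (smooth_coord j) x).
have P y i : partial i (fun x : 'rV[R]_n => x 0 j) y = (i == j)%:R.
  by have [] := is_derive_coord i j y.
have Q i : partial i ((fun x : 'rV[R]_n => x 0 j) \o dilation sigma lam) x =
    lam ^+ sigma i * (i == j)%:R.
  by rewrite -(P (dilation sigma lam x));
    have -> := partial_dilation sigma lam i (smooth_coord j).
rewrite /vf_app; under eq_bigr do rewrite Q.
under [X in _ = _ * X -> _]eq_bigr do rewrite P.
rewrite (bigD1 j)//= [X in _ + X]big1 ?addr0; last first.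
  by move=> i ij; rewrite (negbTE ij) !mulr0.
rewrite eqxx mulr1 => ->; congr (_ * _).
rewrite (bigD1 j)//= [X in _ + X]big1 ?addr0; last first.
  by move=> i ij; rewrite (negbTE ij) !mulr0.
by rewrite eqxx mulr1.
Qed.

(** The factor [lam ^+ sigma j] from differentiation cancels the one in the scaling law of the
    coefficient, so the transpose has the degree of [V]. *)
Lemma vstar_dilation (V : vfield R n) k lam phi : 0 < lam -> smooth_map V ->
  vf_homogeneous sigma k V -> test phi ->
  vstar V (fun x => phi (dilation sigma lam x)) =
  fun x => lam ^+ k * vstar V phi (dilation sigma lam x).
Proof.
move=> l0 sV hV tp; apply/funext => x; rewrite /vstar mulrN mulr_sumr; congr (- _).
apply: eq_bigr => j _.
have lj : lam ^+ sigma j != 0 by rewrite expf_eq0 (gt_eqF l0) andbF.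
have -> : (fun y => V y 0 j * phi (dilation sigma lam y)) =
    fun y => lam ^+ k / lam ^+ sigma j *
      (fun z => V z 0 j * phi z) (dilation sigma lam y).
  apply/funext => y /=; rewrite mulrA; congr (_ * _).
  by rewrite mulrAC -(homogeneous_coef y j l0 hV) mulfK.
have sVp : smooth (fun z => V z 0 j * phi z).
  by apply: smoothM; [exact: sV|exact: test_smooth].
rewrite partialZ; last by apply: smooth_c0; exact: (smooth_dilation sigma lam sVp).
by rewrite (partial_dilation sigma lam j sVp) mulrA mulfVK.
Qed.

Lemma vstarZ (V : vfield R n) a phi : smooth_map V -> test phi ->
  vstar V (fun x => a * phi x) = fun x => a * vstar V phi x.
Proof.
move=> sV tp; apply/funext => x; rewrite /vstar mulrN mulr_sumr; congr (- _).
apply: eq_bigr => j _.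
have -> : (fun y => V y 0 j * (a * phi y)) = fun y => a * (V y 0 j * phi y).
  by apply/funext => y; rewrite mulrCA.
by rewrite partialZ//; apply/smooth_c0/smoothM; [exact: sV|exact: test_smooth].
Qed.

Variables (m : nat) (nu : 'I_m -> nat) (X : 'I_m -> vfield R n).
Hypothesis sX : forall i, smooth_map (X i).
Hypothesis hX : forall i, vf_homogeneous sigma (nu i) (X i).

Lemma wstarZ I a phi : test phi ->
  wstar X I (fun x => a * phi x) = fun x => a * wstar X I phi x.
Proof.
elim: I phi => //= i I IH phi tp.
by rewrite vstarZ// IH//; exact: test_vstar.
Qed.

Lemma wstar_dilation I lam phi : 0 < lam -> test phi ->
  wstar X I (fun x => phi (dilation sigma lam x)) =
  fun x => lam ^+ weight nu I * wstar X I phi (dilation sigma lam x).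
Proof.
move=> l0; elim: I phi => [|i I IH] phi tp /=.
  by apply/funext => x; rewrite /weight big_nil mul1r.
rewrite (vstar_dilation l0 (sX i) (hX i) tp).
have tv : test (vstar (X i) phi) by exact: test_vstar.
rewrite wstarZ ?IH//; last exact: test_dilation.
by apply/funext => x; rewrite /weight big_cons exprD mulrA.
Qed.

(** All words of the operator have the same weight [d], so the dilation produces one common nonzero
    factor, which cancels. *)
Lemma op_dist_scale d c lam u phi : 0 < lam -> test_linear u ->
  (forall psi, test psi -> op_dist nu d c X u psi = 0) -> test phi ->
  op_dist nu d c X (scale_dist lam u) phi = 0.
Proof.
move=> l0 lu H tp; have k0 : 0 < lam^-1 by rewrite invr_gt0.
have tk := test_dilation sigma k0 tp.
have := H _ tk; rewrite !op_distE => E.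
apply: (mulfI (_ : lam^-1 ^+ d != 0)); first by rewrite expf_eq0 (gt_eqF k0) andbF.
rewrite mulr0 -[RHS]E mulr_sumr; apply: eq_bigr => k _.
rewrite mulr_sumr; apply: eq_bigr => I /eqP wI; rewrite mulrCA; congr (_ * _).
rewrite wstar_dilation// wI test_linearZ//.
by apply: test_dilation => //; exact: test_wstar.
Qed.

End scaling.

(** * Lifted solutions and vanishing of derivatives of large weight *)

Section lifting.
Context {R : realType} {n m p : nat} (sigma : 'I_n -> nat) (nu : 'I_m -> nat)
  (X : 'I_m -> vfield R n) (tau : 'I_p -> nat)
  (op : 'rV[R]_(n + p) -> 'rV[R]_(n + p) -> 'rV[R]_(n + p))
  (Xt : 'I_m -> vfield R (n + p)) (d : nat) (c : seq 'I_m -> R).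
Hypothesis hL : generalized_rockland sigma nu X tau op Xt d c.

Let sX i : smooth_map (X i).
Proof. by case: hL => _ []. Qed.

Let hX i : vf_homogeneous sigma (nu i) (X i).
Proof. by case: hL => _ []. Qed.

Let sXt i : smooth_map (Xt i).
Proof. by case: hL => _ _ _ _ [] _ _ _ _ H _ _ _ _; case: (H i). Qed.

Lemma fiber_int_wstar I phi : test phi ->
  fiber_int (wstar Xt I phi) = wstar X I (fiber_int phi).
Proof.
elim: I phi => //= i I IH phi tp; rewrite IH; last exact: test_vstar.
have [Rj [_ _ E]] := lift_split (gr_lifting hL) i.
by rewrite (fiber_int_vstar (sXt i) E tp).
Qed.

(** Hypoellipticity is applied on the whole space to [v] composed with [fiber_int], that is, to [v]
    tensored with the constant 1. *)
Lemma lifted_solution_smooth (v : ('rV[R]_n -> R) -> R) k C : 0 <= C ->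
  test_linear v -> seminorm_bounded k C v ->
  (forall psi, test psi -> op_dist nu d c X v psi = 0) ->
  exists2 f : 'rV[R]_(n + p) -> R, smooth f &
    forall phi, test phi -> v (fiber_int phi) = integral_rV (fun z => f z * phi z).
Proof.
move=> C0 lv bv Lv.
have dv : Defs.distribution setT (fun phi => v (@fiber_int R n p phi)).
  split=> [a phi psi tp ts|K cK _].
    by rewrite fiber_intZD// lv//; exact: test_fiber_int.
  have [M0 [_ HM0]] := compact_bounded cK.
  pose r := `|M0| + 1.
  have r0 : 0 <= r by rewrite addr_ge0.
  have Kr x : K x -> `|x| <= r.
    by move=> Kx; apply: (HM0 r _ x Kx);
      rewrite (le_lt_trans (ler_norm M0))// ltrDl.
  pose B := (1 + r ^+ 2) ^+ p * integral_rV (@cauchyn R p).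
  have B0 : 0 <= B.
    by rewrite mulr_ge0 ?integral_cauchyn_ge0// exprn_ge0// addr_ge0// sqr_ge0.
  (* On the box the weight is at most [(1 + r) ^+ k], and [B] is the cost of integrating over the
     fiber. *)
  exists (C * ((1 + r) ^+ k * B)), k => phi M sp Kp HM.
  have Hr : supp_in r phi.
    by move=> x xr; apply: Kp => /Kr; rewrite leNgt xr.
  have tp : test phi by apply/testP; split => //; exists r.
  have M0' : 0 <= M by exact: le_trans (normr_ge0 _) (HM [::] (leq0n _) 0).
  rewrite -mulrA; apply: bv; first exact: test_fiber_int.
  move=> s sk x; rewrite partials_fiber_int//.
  have [xr|xr] := leP `|x| r; last first.
    rewrite (@supp_fiber_int _ _ _ _ r)//; last exact: supp_partials.
    have L : 0 <= (1 + r) ^+ k by rewrite exprn_ge0// addr_ge0.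
    by rewrite normr0 mulr0; exact: mulr_ge0 (mulr_ge0 L B0) M0'.
  rewrite -mulrA; apply: ler_pM; [by rewrite exprn_ge0// addr_ge0|by []| |].
    by rewrite lerXn2r ?nnegrE ?addr_ge0// lerD2l.
  rewrite mulrC; apply: fiber_int_bound.
  - exact/smooth_cont/smooth_partials.
  - exact: supp_partials.
  - by move=> z; apply: HM; rewrite size_map.
(* Transposed lifted words commute with fiber integration, so the lifted equation holds with
   right-hand side 0. *)
have sol : is_smooth_dist setT (op_dist nu d c Xt (fun phi =>
  v (@fiber_int R n p phi))).
  exists (fun=> 0); first exact: smooth_cst.
  move=> phi tp; rewrite op_distE /dist_of_fun.
  rewrite (_ : (fun x : 'rV[R]_(n + p) => 0 * phi x) = (fun=> 0)); last first.
    by apply/funext => z; rewrite mul0r.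
  rewrite integral_rV0 -[RHS](Lv _ (test_fiber_int tp)) op_distE.
  by apply: eq_bigr => j _; apply: eq_bigr => I _; rewrite fiber_int_wstar.
have [f sf Hf] := gr_hypoelliptic hL openT openT (@subset_refl _ setT) dv sol.
by exists f => // phi tp; exact: Hf.
Qed.

(** With the profile [chi] the value becomes an integral against a derivative of the fixed smooth
    [f]. The test function is left undifferentiated, so its supremum and its box do not depend on
    [lam]. *)
Lemma lifted_solution_bounded (v : ('rV[R]_n -> R) -> R) k C s psi : 0 <= C ->
  test_linear v -> seminorm_bounded k C v ->
  (forall phi, test phi -> op_dist nu d c X v phi = 0) -> test psi ->
  exists B, forall lam, 1 <= lam ->
    `|v (partials s (fun x => psi (dilation sigma lam x)))| <= B.
Proof.
move=> C0 lv bv Lv tp; have [f sf Hf] := lifted_solution_smooth C0 lv bv Lv.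
have [chi tc Ic] := @unit_mass_test R p.
have /testP[sp [r r0 Hr]] := tp; have /testP[sc [r' r'0 Hr']] := tc.
have [Mp Mp0 HMp] := test_bounded tp; have [Mc Mc0 HMc] := test_bounded tc.
pose s' := map (lshift p) s.
have sF : smooth (partials (rev s') f) by exact: smooth_partials.
have [Mf Mf0 HMf] := continuous_box_bounded (r + r') (smooth_cont sF).
exists (Mf * (Mp * Mc) * (1 + (r + r') ^+ 2) ^+ (n + p) * integral_rV (@cauchyn
  R (n + p))).
move=> lam l1.
pose pl x := psi (dilation sigma lam x).
have tl : test pl by apply: test_dilation => //; exact: lt_le_trans l1.
have -> : partials s (fun x => psi (dilation sigma lam x)) =
    fiber_int (partials s' (tensor pl chi)).
  rewrite partials_tensor; [|exact: test_smooth|exact: test_smooth].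
  rewrite fiber_int_tensor; last exact: test_decaying.
  by apply/funext => x; rewrite Ic mulr1.
have tt : test (tensor pl chi) by exact: test_tensor.
rewrite Hf; last exact: test_partials.
rewrite integral_by_parts_iter// normrM normrX normrN1 expr1n mul1r.
have supT : supp_in (r + r') (tensor pl chi).
  by apply: supp_tensor => //; exact: supp_dilation.
apply: norm_integral_rV.
  by apply: smooth_cont; apply: smoothM => //; exact: test_smooth.
apply: supp_cauchyn => z; first by move=> zr; rewrite supT// mulr0.
have [zr|zr] := leP `|z| (r + r'); last first.
  by rewrite supT// mulr0 normr0 !mulr_ge0.
rewrite normrM ler_pM ?HMf// /tensor normrM ler_pM//.
exact: HMp.
Qed.

Lemma solution_partials_vanish (u : ('rV[R]_n -> R) -> R) k C s psi : 0 <= C ->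
  test_linear u -> seminorm_bounded k C u ->
  (forall phi, test phi -> op_dist nu d c X u phi = 0) -> test psi ->
  ((\sum_i sigma i) * k < \sum_(i <- s) sigma i)%N -> u (partials s psi) = 0.
Proof.
move=> C0 lu bu Lu tp sE; apply/eqP; apply/negPn/negP => N0.
pose E := ((\sum_i sigma i) * k)%N.
pose lam j : R := 4 ^+ j.
have lam1 j : 1 <= lam j by rewrite exprn_ege1// ler1n.
have lam0 j : 0 < lam j by exact: lt_le_trans (lam1 j).
(* Division by [lam l ^+ E] undoes the growth under dilation: every [w l] obeys the seminorm bound
   of [u] with the same constant. *)
pose w l phi := lam l ^- E * scale_dist sigma (lam l) u phi.
pose theta j := partials s (fun x => psi (dilation sigma (lam j) x)).
have tt j : test (theta j) by exact/test_partials/test_dilation.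
have lw l : test_linear (w l).
  move=> a phi chi t1 t2; rewrite /w scale_dist_linear//; ring.
have bw l : seminorm_bounded k C (w l).
  move=> phi M t1 HM; have := scale_dist_bounded sigma (lam1 l) bu t1 HM.
  rewrite /w normrM normfV (ger0_norm (exprn_ge0 _ (ltW (lam0 l)))) => H.
  by rewrite ler_pdivrMl ?exprn_gt0// mulrCA mulrA.
have /choice[M HM] j : exists M, seminorm_le k (theta j) M.
  exact/schwartz_seminorm/test_schwartz.
pose T j l := w l (theta j).
have HB j l : `|T j l| <= C * M j by exact: bw.
pose c0 := `|u (partials s psi)|.
have c00 : 0 < c0 by rewrite normr_gt0.
(* The witness is [l = j]: the entry is [u (partials s psi)] times a power of [lam j] whose
   exponent, the weight of [s] minus [E], is at least 1. *)
have Hc j : exists l, c0 * 4 ^+ j <= `|T j l|.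
  exists j; rewrite /T /w scale_dist_partials// normrM normfV normrM.
  rewrite !(ger0_norm (exprn_ge0 _ (ltW (lam0 j)))) mulrA -/c0 [leRHS]mulrC.
  rewrite ler_wpM2l ?(ltW c00)// ler_pdivlMl ?exprn_gt0// mulrC -exprS.
  by rewrite ler_weXn2l.
have [a [l [Ha Hal]]] := gliding_hump c00 HB Hc.
pose uk i phi := a i * w (l i) phi.
have luk i : test_linear (uk i).
  by move=> b phi chi t1 t2; rewrite /uk lw//; ring.
have buk i : seminorm_bounded k (C * 3^-1 ^+ i) (uk i).
  move=> phi N t1 HN; rewrite /uk normrM [C * _]mulrC -mulrA ler_pM//.
  exact: bw.
have Luk i phi : test phi -> op_dist nu d c X (uk i) phi = 0.
  move=> t1; have := op_dist_scale (sigma := sigma) sX hX (lam0 (l i)) lu Lu t1.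
  rewrite !op_distE => H.
  rewrite -[RHS](mulr0 (a i * lam (l i) ^- E)) -[in RHS]H mulr_sumr.
  apply: eq_bigr => j _; rewrite mulr_sumr; apply: eq_bigr => I _.
  by rewrite /uk /w; ring.
have [B HBd] := lifted_solution_bounded s (mulr_ge0 (ler0n _ 2) C0)
  (series_fun_linear C0 luk buk) (series_fun_bounded C0 buk)
  (fun phi tphi => op_dist_series_fun C0 buk sX tphi (fun i => Luk i phi tphi)) tp.
have Hj j : 2 / 5 * c0 * (4 / 3) ^+ j <= B.
  apply: le_trans (HBd (lam j) (lam1 j)).
  apply: (series_fun_ge C0 buk (j := j)); first exact: tt.
  by move=> K jK; exact: Hal.
(* Bernoulli's inequality for [1 + 1/3], enough to pass any bound [B]. *)
have bern j : 1 + j%:R / 3 <= (4 / 3) ^+ j :> R.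
  elim: j => [|j IH]; first by rewrite mul0r addr0.
  rewrite exprS -natr1; have j0 : 0 <= j%:R :> R by [].
  apply: (@le_trans _ _ (4 / 3 * (1 + j%:R / 3))); first lra.
  by rewrite ler_wpM2l.
have cp : 0 < 2 / 5 * c0 by rewrite mulr_gt0.
have B0 : 0 <= B by apply: le_trans (Hj 0%N); rewrite expr0 mulr1 ltW.
pose j := Num.bound (3 * (B / (2 / 5 * c0))).
have jB : 3 * (B / (2 / 5 * c0)) < j%:R.
  by apply: archi_boundP; rewrite mulr_ge0// divr_ge0// ltW.
have := Hj j; apply/negP; rewrite -ltNge.
apply: (@lt_le_trans _ _ (2 / 5 * c0 * (1 + j%:R / 3))); last by rewrite ler_pM2l.
rewrite mulrC -ltr_pdivrMr//; move: jB; set b := B / _; lra.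
Qed.

End lifting.

(** * Polynomial form of a solution on test functions *)

Section polynomial_representation.
Context {R : realType} {n m p : nat} (sigma : 'I_n -> nat) (nu : 'I_m -> nat)
  (X : 'I_m -> vfield R n) (tau : 'I_p -> nat)
  (op : 'rV[R]_(n + p) -> 'rV[R]_(n + p) -> 'rV[R]_(n + p))
  (Xt : 'I_m -> vfield R (n + p)) (d : nat) (c : seq 'I_m -> R).
Hypothesis hL : generalized_rockland sigma nu X tau op Xt d c.

Let sigma_gt0 i : (0 < sigma i)%N.
Proof.
have hs := gr_system hL; pose i0 : 'I_n := Ordinal (hs_dim_gt0 hs).
by have := @hs_sigma_nd _ _ _ _ _ _ hs i0 i (leq0n _);
  rewrite (@hs_sigma1 _ _ _ _ _ _ hs i0 erefl).
Qed.

Lemma solution_polyfun (u : ('rV[R]_n -> R) -> R) k C : 0 <= C ->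
  test_linear u -> seminorm_bounded k C u ->
  (forall phi, test phi -> op_dist nu d c X u phi = 0) ->
  exists g, [/\ smooth g, polyfun g &
    forall phi, test phi -> u phi = integral_rV (fun x => g x * phi x)].
Proof.
move=> C0 lu bu Lu; have [f sf Hf] := lifted_solution_smooth hL C0 lu bu Lu.
(* All exponents are positive, so a word of length [K] has weight at least [K], beyond the threshold
   of [solution_partials_vanish]. *)
pose K := ((\sum_i sigma i) * k).+1.
have V s psi : size s = K -> test psi -> u (partials s psi) = 0.
  move=> sK tp; apply: (solution_partials_vanish hL C0 lu bu Lu tp).
  rewrite -[X in (X < _)%N]/(K.-1) -sK /=.
  apply: (@leq_trans (size s)); first by rewrite prednK// sK.
  by rewrite -sum1_size leq_sum.
(* Vanishing passes from [u] to [f], since the fiber integral of a test function is a test function.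
   The reversed word compensates the reversal in iterated integration by parts. *)
have dx t : size t = K -> forall z, partials (map (lshift p) t) f z = 0.
  move=> tK; apply: du_bois_reymond; first exact/smooth_cont/smooth_partials.
  move=> psi tp; have := integral_by_parts_iter (map (lshift p) (rev t)) sf tp.
  rewrite -map_rev revK -Hf; last exact: test_partials.
  rewrite -partials_fiber_int// V ?size_rev//; last exact: test_fiber_int.
  by move=> /esym/eqP; rewrite mulf_eq0 signr_eq0 => /eqP.
have dxi j z : partial (rshift n j) f z = 0.
  move: z; apply: du_bois_reymond; first exact/smooth_cont/smooth_partial.
  move=> psi tp; have := integral_by_parts (rshift n j) sf tp.
  rewrite -Hf; last exact: test_partial.
  rewrite fiber_int_partialr// test_linear0// => /esym/eqP.
  by rewrite oppr_eq0 => /eqP.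
pose g x := f (row_mx x 0).
have sg : smooth g by exact: smooth_row_mxl.
have fg z : f z = g (lsubmx z).
  rewrite -{1}(hsubmxK z) /g; set x := lsubmx z.
  have sx := smooth_row_mxr x sf.
  (* The derivatives in [xi] vanish, so the Lipschitz constant is 0 and [f] is constant on each
     fiber. *)
  have := @lipschitz_partial _ _ (fun xi => f (row_mx x xi)) 0 (lexx _)
    (fun i y => smooth_derivable sx) _ 0 (rsubmx z).
  rewrite mulr0 mul0r normr_le0 subr_eq0 => H; apply/eqP; apply: H => i y.
  by rewrite partial_row_mxr// dxi normr0.
exists g; split => //.
  apply: (@polyfun_of_vanishing_partials _ _ K) => // s x sK.
  suff -> : partials s g = fun x =>
    partials (map (lshift p) s) f (row_mx x 0) by exact: dx.
  elim: (s) => //= i t ->.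
  by rewrite partial_row_mxl//; exact: smooth_partials.
move=> phi tp; have [chi tc Ic] := @unit_mass_test R p.
have dc := test_decaying tc.
(* Writing [phi] as a fiber integral lets the formula for [f] descend to the base. *)
have <- : fiber_int (tensor phi chi) = phi.
  by rewrite fiber_int_tensor//; apply/funext => x; rewrite Ic mulr1.
rewrite Hf; last exact: test_tensor.
have tg : test (fun x => g x * phi x) by exact: testM.
have -> : (fun z => f z * tensor phi chi z) = tensor (fun x => g x * phi x) chi.
  by apply/funext => z; rewrite fg /tensor mulrA.
rewrite integral_rV_fiber; last exact: test_tensor.
by rewrite !fiber_int_tensor//; congr integral_rV; apply/funext => x;
  rewrite Ic !mulr1.
Qed.

End polynomial_representation.

(** * From test functions to Schwartz functions *)

Section density.
Context {R : realType} {n : nat}.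

Lemma one_norm_ge1 (x : 'rV[R]_n) : 1 <= 1 + `|x|.
Proof. by rewrite lerDl. Qed.

Lemma polyfun_growth (g : 'rV[R]_n -> R) : polyfun g ->
  exists (C : R) (D : nat), 0 <= C /\ forall x, `|g x| <= C * (1 + `|x|) ^+ D.
Proof.
move=> [l Hl]; elim: l g Hl => [|[a e] l IH] g Hl.
  by exists 0, 0%N; split => // x; rewrite Hl /polysum big_nil normr0 mul0r.
have [C [D [C0 HC]]] := IH _ (fun x => erefl).
exists (`|a| + C), (\sum_i e i + D)%N; split; first by rewrite addr_ge0.
move=> x; rewrite Hl /polysum big_cons /= mulrDl (le_trans (ler_normD _ _))//.
have x1 := one_norm_ge1 x; have x0 : 0 <= 1 + `|x| by exact: le_trans x1.
apply: lerD.
  rewrite normrM ler_wpM2l// exprD.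
  apply: (@le_trans _ _ ((1 + `|x|) ^+ (\sum_i e i))); last first.
    by rewrite ler_peMr ?exprn_ge0// exprn_ege1.
  rewrite /mono normr_prod -prodrXr; apply: ler_prod => i _.
  rewrite normr_ge0 normrX lerXn2r ?nnegrE//.
  by rewrite (le_trans (coord_le_norm x i))// lerDr.
apply: le_trans (HC x) _; rewrite ler_wpM2l// exprD ler_peMl ?exprn_ge0//.
exact: exprn_ege1.
Qed.

(** Since [1 + x_i^2 <= (1 + |x|)^2], an extra [2 * n] powers of the weight buy the integrable
    majorant. *)
Lemma cauchyn_lower (x : 'rV[R]_n) : 1 <= (1 + `|x|) ^+ (2 * n) * cauchyn x.
Proof.
have -> : (1 + `|x|) ^+ (2 * n) = \prod_(i < n) (1 + `|x|) ^+ 2.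
  by rewrite prodr_const card_ord exprM.
rewrite /cauchyn -big_split /=.
have P1 : \prod_(i < n) (1 : R) = 1 by exact: big1.
rewrite -[leLHS]P1; apply: ler_prod => i _; rewrite ler01 /=.
rewrite /cauchy1 ler_pdivlMr ?mul1r; last exact: lt_le_trans (oneDsqr_ge1 _).
rewrite /oneDsqr -(real_normK (num_real (x 0 i))) sqrrD expr1n -addrA lerD2l.
rewrite ler_wpDl// ?mulrn_wge0 ?mul1r// lerXn2r ?nnegrE//.
exact: coord_le_norm.
Qed.

Lemma decay_cauchyn (f : 'rV[R]_n -> R) M : 0 <= M ->
  (forall x, (1 + `|x|) ^+ (2 * n) * `|f x| <= M) -> forall x,
    `|f x| <= M * cauchyn x.
Proof.
move=> M0 H x; have c0 := cauchyn_gt0 x.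
rewrite -ler_pdivrMr//; apply: le_trans (H x).
rewrite ler_pdivrMr// mulrAC [leRHS]mulrAC mulrAC ler_peMl//; exact: cauchyn_lower.
Qed.

Lemma schwartzP (f : 'rV[R]_n -> R) : smooth f ->
  (forall k, exists M, seminorm_le k f M) -> schwartz f.
Proof.
move=> sf H; split => // k s; have [M HM] := H (maxn k (size s)).
exists M => x; apply: le_trans (HM s (leq_maxr _ _) x).
by rewrite ler_wpM2r// ler_weXn2l ?one_norm_ge1// leq_maxl.
Qed.

(** Isotropic scaling, written as a dilation with all exponents 1 so that the lemmas on dilations
    apply. *)
Let unif (N : nat) (x : 'rV[R]_n) := dilation (fun=> 1%N) (N.+1%:R^-1 : R) x.

(** At order 0, [chi 0 = 1] and the Lipschitz estimate give [n * M * |x| / (N + 1)], at the price of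
    one power of [1 + |x|]. Each derivative brings its own factor [1 / (N + 1)]. *)
Lemma cutoff_bound (chi : 'rV[R]_n -> R) k : test chi -> chi 0 = 1 ->
  exists2 L, 0 <= L & forall N s x, (size s <= k)%N ->
    `|partials s (fun y => 1 + -1 * chi (unif N y)) x| <= L * (1 + `|x|) / N.+1%:R.
Proof.
move=> tc c1; have sc := test_smooth tc.
have /testP[_ [r r0 Hr]] := tc.
have [M HM] : exists M : R, forall s, (size s <= k.+1)%N ->
    forall x, 1 * `|partials s chi x| <= M.
  apply: uniform_bound_partials => s.
  by have [M _ HM] := test_bounded (test_partials s tc); exists M => x;
    rewrite mul1r.
have M0 : 0 <= M by have := HM [::] (leq0n _) 0; apply: le_trans; rewrite mul1r.
exists (n.+1%:R * M) => [|N s x sk]; first by rewrite mulr_ge0.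
have N0 : 0 < N.+1%:R^-1 :> R by rewrite invr_gt0.
have N1 : N.+1%:R^-1 <= 1 :> R by rewrite invf_le1// ler1n.
have su : smooth (fun y => chi (unif N y)) by exact: smooth_dilation.
case: s sk => [_|i s sk].
  rewrite /= mulN1r -[X in X - _]c1.
  apply: (@le_trans _ _ (n%:R * M * `|0 - unif N x|)).
    apply: lipschitz_partial => // [j y|j y]; first exact: smooth_derivable.
    by have := HM [:: j] isT y; rewrite mul1r.
  have ux : unif N x = N.+1%:R^-1 *: x by apply/rowP => j; rewrite !mxE expr1.
  rewrite sub0r normrN ux normrZ (ger0_norm (ltW N0)) mulrCA [leLHS]mulrC
    ler_wpM2r ?(ltW N0)//.
  rewrite ler_pM// ?mulr_ge0//; first by rewrite ler_wpM2r// ler_nat.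
  by rewrite lerDr.
rewrite partialsD; [|exact: smooth_cst|exact: smoothZ].
rewrite partialsZ//.
have -> : partials (i :: s) (fun _ : 'rV[R]_n => 1) x = 0.
  have -> : partials (i :: s) (fun _ : 'rV[R]_n => 1) = (fun=> 0 : R).
    elim: s i {sk} => [|j s IH] i; first exact: partial_cst.
    by rewrite -[LHS]/(partial i (partials (j :: s) _)) IH partial_cst.
  by [].
rewrite add0r mulN1r normrN partials_dilation//.
rewrite big_const_seq count_predT iter_addn_0 mul1n.
rewrite normrM (ger0_norm (exprn_ge0 _ (ltW N0))) mulrC.
apply: ler_pM; rewrite ?exprn_ge0 ?(ltW N0)//; last first.
  by rewrite exprS ler_piMr ?(ltW N0)// exprn_ile1// ltW.
have := HM (i :: s) (leqW sk) (dilation (fun=> 1%N) (N.+1%:R^-1) x);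
  rewrite mul1r => H.
apply: le_trans H _; rewrite mulrAC ler_peMl//.
by rewrite -[leLHS]mulr1 ler_pM// ?ler1n// one_norm_ge1.
Qed.

Lemma test_determines (Lambda : ('rV[R]_n -> R) -> R) (g : 'rV[R]_n -> R) :
  tempered Lambda -> smooth g -> polyfun g ->
  (forall phi, test phi -> Lambda phi = integral_rV (fun x => g x * phi x)) ->
  forall phi, schwartz phi -> Lambda phi = integral_rV (fun x => g x * phi x).
Proof.
move=> [linL [C [k HC]]] sg pg H phi sp; have [sphi _] := sp.
have [chi tc c1] := @unit_center_test R n.
have [Cg [D [Cg0 HCg]]] := polyfun_growth pg.
pose h N y := 1 + -1 * chi (unif N y).
have sh N : smooth (h N).
  by apply: smoothD; [exact: smooth_cst|apply: smoothZ;
    exact: smooth_dilation (test_smooth tc)].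
have tphi N : test (fun x => chi (unif N x) * phi x).
  rewrite (_ : (fun x => _) = (fun x => phi x * chi (unif N x))); last first.
    by apply/funext => x; rewrite mulrC.
  by apply: testM => //; apply: test_dilation => //; rewrite invr_gt0.
have sem j : exists2 B, 0 <= B &
    forall N, seminorm_le j (fun x => h N x * phi x) (B / N.+1%:R).
  have [L L0 HL] := cutoff_bound j tc c1.
  (* One order above [j]: the extra power of the weight absorbs the factor [1 + |x|] of the cutoff
     bound. *)
  have [M HM] := schwartz_seminorm j.+1 sp.
  have M0 := seminorm_ge0 HM.
  exists (2 ^+ j * (L * M)) => [|N s sj x]; first by rewrite !mulr_ge0// exprn_ge0.
  have x0 : 0 < 1 + `|x| by exact: lt_le_trans (one_norm_ge1 x).
  pose a := L * (1 + `|x|) / N.+1%:R; pose b := M / (1 + `|x|) ^+ j.+1.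
  have a0 : 0 <= a by rewrite /a divr_ge0// mulr_ge0// ltW.
  have b0 : 0 <= b by rewrite /b divr_ge0// exprn_ge0// ltW.
  have Q := @partials_mul_bound _ _ (h N) phi j x a b (sh N) sphi a0 b0
    (fun t tj => HL N t x tj) _ s sj.
  apply: (@le_trans _ _ ((1 + `|x|) ^+ j * (2 ^+ size s * (a * b)))).
    rewrite ler_wpM2l ?exprn_ge0 ?(ltW x0)//; apply: Q => t tj.
    by rewrite ler_pdivlMr ?exprn_gt0// mulrC HM// leqW.
  have -> : (1 + `|x|) ^+ j * (2 ^+ size s * (a * b)) = 2 ^+ size s * (L * M /
    N.+1%:R).
    rewrite /a /b exprS; field.
    by rewrite expf_eq0 (gt_eqF x0) andbF nat1r pnatr_eq0.
  rewrite -!mulrA ler_wpM2r//; first by rewrite !mulr_ge0.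
  by rewrite ler_weXn2l// ler1n.
have shp N : schwartz (fun x => h N x * phi x).
  apply: schwartzP => [|j]; first exact: smoothM.
  by have [B _ HB] := sem j; exists (B / N.+1%:R); exact: HB.
(* [D] powers of the weight compensate the growth of [g], and [2 * n] more give the integrable
   majorant. *)
have dec (f : 'rV[R]_n -> R) M : smooth f -> seminorm_le (D + 2 * n)%N f M ->
    forall x, `|g x * f x| <= Cg * M * cauchyn x.
  move=> sf HM; have M0 := seminorm_ge0 HM.
  apply: decay_cauchyn; first exact: mulr_ge0.
  move=> x; rewrite normrM mulrCA.
  have x0 : 0 <= 1 + `|x| by exact: le_trans (one_norm_ge1 x).
  apply: (@le_trans _ _ ((Cg * (1 + `|x|) ^+ D) * ((1 + `|x|) ^+ (2 * n) * `|f
    x|))).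
    by rewrite ler_wpM2r// mulr_ge0// exprn_ge0.
  rewrite -mulrA ler_wpM2l// mulrA -exprD.
  exact: (HM [::]).
have [B B0 HB] := sem k.
have [B' B'0 HB'] := sem (D + 2 * n)%N.
have cgf (f : 'rV[R]_n -> R) : smooth f -> continuous (fun x => g x * f x).
  by move=> sf; exact/smooth_cont/smoothM.
have dgphi : decaying (fun x => g x * phi x).
  have [M HM] := schwartz_seminorm (D + 2 * n)%N sp.
  by split; [exact: cgf|exists (Cg * M); exact: dec].
(* [Lambda] and the integral agree on the truncated [phi]; on the remainder both are of order
   [1 / (N + 1)]. *)
have E N : `|Lambda phi - integral_rV (fun x => g x * phi x)| <=
    (`|C| * B + Cg * B' * integral_rV (@cauchyn R n)) / N.+1%:R.
  have spl : phi = fun x => 1 * (chi (unif N x) * phi x) + h N x * phi x.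
    by apply/funext => x; rewrite /h; ring.
  have dh : decaying (fun x => g x * (h N x * phi x)).
    split; first by apply: cgf; exact: smoothM.
    exists (Cg * (B' / N.+1%:R)); apply: dec; last exact: HB'.
    exact: smoothM.
  have -> : Lambda phi = integral_rV (fun x => g x * (chi (unif N x) * phi x)) +
      Lambda (fun x => h N x * phi x).
    rewrite {1}spl linL//; last exact: test_schwartz.
    by rewrite mul1r H.
  have -> : integral_rV (fun x => g x * phi x) =
      integral_rV (fun x => g x * (chi (unif N x) * phi x)) +
      integral_rV (fun x => g x * (h N x * phi x)).
    rewrite -integral_rVD//; last by apply/test_decaying/testM.
    by congr integral_rV; apply/funext => x; rewrite /h; ring.
  rewrite opprD addrACA subrr add0r.
  apply: le_trans (ler_normB _ _) _; rewrite mulrDl; apply: lerD.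
    apply: (@le_trans _ _ (C * (B / N.+1%:R)));
      first exact: (HC _ _ (shp N) (HB N)).
    by rewrite mulrA ler_wpM2r ?invr_ge0// ler_wpM2r// ler_norm.
  have -> : Cg * B' * integral_rV (@cauchyn R n) / N.+1%:R =
    Cg * (B' / N.+1%:R) * integral_rV (@cauchyn R n) by ring.
  apply: norm_integral_rV; first by apply: cgf; exact: smoothM.
  by apply: dec; [exact: smoothM|exact: HB'].
apply/eqP; rewrite -subr_eq0 -normr_le0 leNgt; apply/negP => e0.
move: E; set e := `|_ - _| in e0 *; set A := `|C| * B + _ => E.
have A0 : 0 <= A.
  by have := E 0%N; rewrite divr1; apply: le_trans; exact: ltW.
have := archi_boundP (divr_ge0 A0 (ltW e0)).
set N := Num.Def.archi_bound _ => AN.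
have := E N; apply/negP; rewrite -ltNge ltr_pdivrMr// mulrC -ltr_pdivrMr//.
by apply: lt_le_trans AN _; rewrite ler_nat.
Qed.

End density.

(** Since [f0] is only measurable, integrability comes from the majorant [M * psi] and not from
    [decaying], which asks for continuity. *)
Lemma bounded_dist_le {R : realType} n (f0 psi : 'rV[R]_n -> R) (M : R) :
  measurable_rV f0 -> (forall x, `|f0 x| <= M) -> test psi -> (forall x,
    0 <= psi x) ->
  `|integral_rV (fun x => f0 x * psi x)| <= M * integral_rV psi.
Proof.
move=> mf fM tp p0; have dp := test_decaying tp.
have ip := decaying_integrable dp.
have iMp : rv_integrable (fun x =>
  M * psi x) by exact/decaying_integrable/decayingZ.
have ifp : rv_integrable (fun x => f0 x * psi x).
  apply: le_integrable iMp => //.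
    apply/measurable_EFinP; apply: measurable_funM; first exact: mf.
    exact: (continuous_measurable_rV (smooth_cont (test_smooth tp))).
  move=> t _ /=; rewrite lee_fin !normrM ler_wpM2r//.
  by rewrite (le_trans (fM _))// ler_norm.
rewrite -integral_rVZ//; apply: le_trans (le_normr_Rintegral _ ifp) _ => //.
apply: le_Rintegral => //.
  by have := integrable_norm ifp.
move=> t _ /=; rewrite normrM (ger0_norm (p0 _)) ler_wpM2r//.
Qed.

Theorem theorem1p11 (R : realType) (n m p : nat)
  (sigma : 'I_n -> nat) (nu : 'I_m -> nat) (X : 'I_m -> vfield R n)
  (tau : 'I_p -> nat)
  (op : 'rV[R]_(n + p) -> 'rV[R]_(n + p) -> 'rV[R]_(n + p))
  (Xt : 'I_m -> vfield R (n + p)) (d : nat) (c : seq 'I_m -> R)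
  (hL : generalized_rockland sigma nu X tau op Xt d c)
  (hLstar : generalized_rockland sigma nu X tau op Xt d (transpose_coef c))
  (Lambda : ('rV[R]_n -> R) -> R) (hLambda : tempered Lambda)
  (hsol : dist_eq (@schwartz R n) (op_dist nu d c X Lambda) (fun=> 0)) :
  (exists P : mpoly.mpoly n R,
     dist_eq (@schwartz R n) Lambda (dist_of_fun (mpoly_fun P))) /\
  (is_bounded_dist Lambda ->
   exists a : R, dist_eq (@schwartz R n) Lambda (dist_of_fun (fun=> a))).
Proof.
have [linL [C [k HC]]] := hLambda.
have lin : test_linear Lambda.
  by move=> a phi psi tp ts; apply: linL; exact: test_schwartz.
(* [tempered] does not fix the sign of its constant, hence the absolute value. *)
have bnd : seminorm_bounded k `|C| Lambda.
  move=> phi M tp HM; apply: le_trans (HC _ M (test_schwartz tp) HM) _.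
  by rewrite ler_wpM2r ?ler_norm// (seminorm_ge0 HM).
have sol phi : test phi -> op_dist nu d c X Lambda phi = 0.
  by move=> tp; apply: hsol; exact: test_schwartz.
have [g [sg pg Hg]] := solution_polyfun hL (normr_ge0 C) lin bnd sol.
have Hs := test_determines hLambda sg pg Hg.
have [P HP] := polyfun_mpoly pg.
have gP : g = mpoly_fun P by apply/funext.
split; first by exists P => phi sp; rewrite Hs// gP.
move=> [f0 [mf [M fM] Hf]].
(* The continuous density [g] inherits the bound of [f0], because both have the same pairing with
   nonnegative test functions. *)
have gM x : `|g x| <= M.
  have cg := smooth_cont sg.
  have le psi : test psi -> (forall x, 0 <= psi x) ->
      `|integral_rV (fun x => g x * psi x)| <= M * integral_rV psi.
    move=> tp p0; rewrite -Hg// Hf; last exact: test_schwartz.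
    exact: bounded_dist_le.
  rewrite ler_norml lerNl; apply/andP; split.
    apply: (@le_of_test_integrals _ _ (fun x => - g x)).
      by move=> y; apply: continuousN; exact: cg.
    move=> psi tp p0; apply: le_trans (le psi tp p0).
    rewrite (_ : (fun x => _) = (fun x => -1 * (g x * psi x))); last first.
      by apply/funext => y; rewrite mulN1r mulNr.
    rewrite integral_rVZ; last exact/test_decaying/testM.
    by rewrite mulN1r ler_normr lexx orbT.
  apply: (le_of_test_integrals cg) => psi tp p0; apply: le_trans (le psi tp p0).
  exact: ler_norm.
exists (g 0) => phi sp; rewrite Hs//.
by congr integral_rV; apply/funext => x; rewrite (polyfun_bounded_const pg gM x).
Qed.
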